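(* Let $r\in(0,1)$, $m\in\mathbb{N}$ with $m\ge2$, let $G_{r,m}=\{z:|z^m-1|<r^m\}$ and let $\mu_0$ be planar area measure restricted to $G_{r,m}$. Let $J$ be a closed arc contained in $\partial G_{r,m}$. For $z_0\in J$ write $w_0=\frac{z_0^m-1}{r^m}$ (so $|w_0|=1$) and, for $a,b\in\mathbb{C}$, \[ A=\frac{\overline{w}_0\,a\,z_0^{m-1}+w_0\,\bar b\,\bar z_0^{m-1}}{r^m}. \] Then, uniformly for $a$ and $b$ in compact subsets of $\mathbb{C}$ and $z_0\in J$, \[ K_n\!\left(z_0+\frac an,z_0+\frac bn;\mu_0\right)=n^2H(A)\frac{|z_0|^{2m-2}}{2\pi r^{2m}}+o(n^2)\qquad(n\to\infty), \] where $H(t)=2\frac{e^t(t-1)+1}{t^2}$ for $t\neq0$ and $H(0)=1$.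
   Context: $\varphi_n(z;\mu_0)$ denote the orthonormal polynomials for $\mu_0$ with positive leading coefficients, and $K_n(z,w;\mu_0)=\sum_{k=0}^n\varphi_k(z;\mu_0)\overline{\varphi_k(w;\mu_0)}$. *)

(* Defs.v *)
(* MathComp + MathComp-Analysis (R : realType), complex numbers R[i]
   from mathcomp-real-closed. *)
From HB Require Import structures.
From mathcomp Require Import all_boot all_order all_algebra.
From mathcomp Require Import all_classical all_reals all_analysis.
From mathcomp Require Import complex.
Set Implicit Arguments. Unset Strict Implicit. Unset Printing Implicit Defensive.
Import Order.TTheory GRing.Theory Num.Theory.
Import numFieldNormedType.Exports.
Local Open Scope classical_set_scope.
Local Open Scope ring_scope.
Local Open Scope complex_scope.

Notation normc := ComplexField.Normc.normc.

(* identification R^2 = C : (x, y) |-> x + i y *)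
Definition toC {R : realType} (x : R * R) : R[i] := (x.1 +i* x.2)%C.

(* G_{r,m} = { z : |z^m - 1| < r^m }, as a subset of R^2 *)
Definition lemG {R : realType} (r : R) (m : nat) : set (R * R) :=
  [set x | normc ((toC x) ^+ m - 1) < r ^+ m].

(* the lemniscate  partial G_{r,m} = { z : |z^m - 1| = r^m } *)
Definition lemBd {R : realType} (r : R) (m : nat) : set R[i] :=
  [set z | normc (z ^+ m - 1) = r ^+ m].

(* planar area (Lebesgue) measure on R^2 = C *)
Definition area (R : realType) := ((@lebesgue_measure R) \x (@lebesgue_measure R))%E.

(* real and imaginary parts of <f, g>_{mu_0} = int_{G_{r,m}} f conj(g) dA *)
Definition ip_re {R : realType} (r : R) (m : nat) (f g : {poly R[i]}) : \bar R :=
  (\int[@area R]_(x in lemG r m) (complex.Re (f.[toC x] * (g.[toC x])^*))%:E)%E.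
Definition ip_im {R : realType} (r : R) (m : nat) (f g : {poly R[i]}) : \bar R :=
  (\int[@area R]_(x in lemG r m) (complex.Im (f.[toC x] * (g.[toC x])^*))%:E)%E.

(* phi is the sequence of orthonormal polynomials for mu_0 (area measure on
   G_{r,m}): deg phi_k = k, positive leading coefficient, orthonormal in
   L^2(mu_0). *)
Definition is_ONP {R : realType} (r : R) (m : nat) (phi : nat -> {poly R[i]}) :=
  (forall k, size (phi k) = k.+1 /\ 0 < lead_coef (phi k)) /\
  (forall j k, ip_re r m (phi j) (phi k) = ((j == k)%:R)%:E /\
               ip_im r m (phi j) (phi k) = 0%E).

(* Christoffel-Darboux kernel K_n(z, w) = sum_{k=0}^n phi_k(z) conj(phi_k(w)) *)
Definition Kn {R : realType} (phi : nat -> {poly R[i]}) (n : nat) (z w : R[i]) : R[i] :=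
  \sum_(k < n.+1) (phi k).[z] * ((phi k).[w])^*.

(* complex exponential *)
Definition cexp {R : realType} (t : R[i]) : R[i] :=
  (expR (complex.Re t))%:C * (cos (complex.Im t) +i* sin (complex.Im t))%C.

(* H(t) = 2 (e^t (t - 1) + 1) / t^2 for t <> 0, H(0) = 1 *)
Definition Hfun {R : realType} (t : R[i]) : R[i] :=
  if t == 0 then 1 else 2 * (cexp t * (t - 1) + 1) / t ^+ 2.

(* J is a closed arc in partial G_{r,m}: J = gamma([0,1]) with gamma continuous
   and injective on [0,1] *)
Definition closed_arc_in {R : realType} (r : R) (m : nat) (gamma : R -> R[i]) :=
  {within [set` `[0, 1]%R], continuous (fun t => complex.Re (gamma t))} /\
  {within [set` `[0, 1]%R], continuous (fun t => complex.Im (gamma t))} /\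
  (forall s t, s \in `[0, 1]%R -> t \in `[0, 1]%R -> gamma s = gamma t -> s = t) /\
  (forall t, t \in `[0, 1]%R -> lemBd r m (gamma t)).

(* w_0 = (z_0^m - 1) / r^m *)
Definition w0 {R : realType} (r : R) (m : nat) (z0 : R[i]) : R[i] :=
  (z0 ^+ m - 1) / (r ^+ m)%:C.

(* A = (conj(w_0) a z_0^{m-1} + w_0 conj(b) conj(z_0)^{m-1}) / r^m *)
Definition Acoef {R : realType} (r : R) (m : nat) (z0 a b : R[i]) : R[i] :=
  ((w0 r m z0)^* * a * z0 ^+ (m - 1) + w0 r m z0 * b^* * (z0^*) ^+ (m - 1))
    / (r ^+ m)%:C.

(* n^2 H(A) |z_0|^{2m-2} / (2 pi r^{2m}) *)
Definition main_term {R : realType} (r : R) (m n : nat) (z0 a b : R[i]) : R[i] :=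
  (n%:R) ^+ 2 * Hfun (Acoef r m z0 a b) *
    ((normc z0) ^+ (2 * m - 2) / (2 * pi * r ^+ (2 * m)))%:C.

(* Main.v *)
Require Import Defs.
From HB Require Import structures.
From mathcomp Require Import all_boot all_order all_algebra all_solvable all_field.
From mathcomp Require Import all_classical all_reals all_analysis.
From mathcomp Require Import measurable_realfun.
From mathcomp Require Import complex ring lra zify.
Set Implicit Arguments. Unset Strict Implicit. Unset Printing Implicit Defensive.
Import Order.TTheory GRing.Theory Num.Theory.
Import numFieldNormedType.Exports.
Local Open Scope classical_set_scope.
Local Open Scope ring_scope.

(** Put u = (z^m - 1) / r^m. The map z |-> z^m pushes |z|^(2m-2) dA on G_{r,m}
    to a multiple of area measure on a disc (uniqueness of the Haar measure of
    C^* gives this without a change of variables formula), so the functions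
    sqrt(m (k + 1) / (pi r^(2m))) u^k are orthonormal for |z|^(2m-2) dA. Splitting
    a polynomial as sum_(j < m) z^j P_j(z^m) gives m pieces that are orthogonal
    by rotation by m-th roots of unity, and on the j-th piece area measure is
    |z|^(2m-2) dA up to the weight |z|^(2(m-1-j)). Since z^m stays in a disc of
    radius < 1 around 1, this weight is |T(z^m)|^2 for a polynomial T up to a
    factor 1 + O(delta) (truncate the Taylor series of powers of w^(1/m)), and
    likewise for its inverse. Hence K_n is squeezed, as a quadratic form and up
    to a factor 1 + delta, between explicit kernels whose sizes differ from n/m
    by O(1); on the diagonal both are sums of (k + 1) |u|^(2k), and polarization
    carries the lower bound off the diagonal. The rescaled limit of
    sum_(k < N) (k + 1) x^k at x = 1 + A / N is N^2 H(A) / 2. *)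

(** The orthonormal polynomials themselves are never computed. What is accessible is the kernel: its
    value at (z, z) is the squared norm of the functional p |-> p(z) on polynomials of degree at
    most n, and likewise for p |-> p(z) + lam p(w). Mapping one space of functions into another with
    norms growing by at most 1 + delta therefore compares kernels. Polarization uses the full
    quadratic form of one comparison only, so the upper one is proved at single points, where
    dividing by the multipliers is harmless. Because r < 1, the closure of G avoids 0, and |z| and
    its approximations are bounded away from 0. The order of choices matters: delta is fixed first,
    this fixes the degrees of the approximating polynomials, and only then does n tend to infinity,
    so that these degrees shift n/m by a bounded amount. The final constant comes from m residue
    classes, each contributing m/(pi r^(2m)) |z_0|^(2m-2) (n/m)^2 H(A)/2. *)

(** * Lebesgue measure on the line under affine maps *)

Section affine.
Context {R : realType}.
Local Notation mu := (@lebesgue_measure R).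

Lemma measurable_affine (a b : R) :
  measurable_fun setT ((fun x => a * x + b) : measurableTypeR R -> measurableTypeR R).
Proof. by apply: measurable_funD => //; exact: measurable_funM. Qed.

(** Lebesgue measure is determined by its values on the intervals []c, d]]; for [a < 0] their
    preimages are half-open on the other side, which does not change the length. *)
Lemma lebesgue_measure_affine (a b : R) (A : set (measurableTypeR R)) :
  a != 0 -> measurable A ->
  (`|a|%:E * mu ((fun x => a * x + b)%R @^-1` A))%E = mu A.
Proof.
move=> a0 mA.
have na : 0 <= `|a| by [].
apply/esym.
apply: (@lebesgue_measure_unique R (mscale (NngNum na)
  (pushforward mu ((fun x => a * x + b) : measurableTypeR R -> measurableTypeR R)))) mA.
- exact: measurable_affine.
move=> mf _ [[c d]] _ <-.
rewrite -[RHS]/(`|a|%:E * mu ((fun x => a * x + b)%R @^-1` `]c, d]%classic))%E.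
have [a1|a1|/eqP] := ltgtP a 0; last by rewrite (negbTE a0).
- have -> : (fun x => a * x + b)%R @^-1` `]c, d]%classic = `[(d - b) / a, (c - b) / a[%classic.
    apply/seteqP; split => x /=; rewrite !in_itv/= ler_ndivrMr// ltr_ndivlMr//; lra.
  rewrite !lebesgue_measure_itv /= !lte_fin ltr_ndivrMr// divfK// ltrD2r.
  case: ifPn => cd; rewrite ?mule0// -EFinB -EFinM ltr0_norm//; congr EFin; field => //.
- have -> : (fun x => a * x + b)%R @^-1` `]c, d]%classic = `](c - b) / a, (d - b) / a]%classic.
    apply/seteqP; split => x /=; rewrite !in_itv/= ltr_pdivrMr// ler_pdivlMr//; lra.
  rewrite !lebesgue_measure_itv /= !lte_fin ltr_pdivrMr// divfK// ltrD2r.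
  case: ifPn => cd; rewrite ?mule0// -EFinB -EFinM gtr0_norm//; congr EFin; field => //.
Qed.

Lemma ge0_integral_affine (a b : R) (f : R -> \bar R) :
  a != 0 -> measurable_fun setT f -> (forall x, 0 <= f x)%E ->
  (`|a|%:E * \int[mu]_x f (a * x + b)%R)%E = (\int[mu]_x f x)%E.
Proof.
move=> a0 mf f0.
have na : 0 <= `|a| by [].
pose g : measurableTypeR R -> measurableTypeR R := fun x => a * x + b.
have mg : measurable_fun setT g by exact: measurable_affine.
have -> : (\int[mu]_x f (a * x + b)%R = \int[pushforward mu g]_x f x)%E.
  by rewrite (ge0_integral_pushforward mg)//.
rewrite -[X in (X * _)%E]/((NngNum na)%:num%:E).
rewrite -(@ge0_integral_mscale _ _ _ (pushforward mu g))//.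
apply: eq_measure_integral => // A mA _.
exact: lebesgue_measure_affine.
Qed.

End affine.

(** * Tonelli for a measure with a given proof of sigma-finiteness *)

Section sigma_finite_tonelli.
Context d (T : measurableType d) (R : realType).
Variables (m : {measure set T -> \bar R}) (s : sigma_finite setT m).

(** The proof of sigma-finiteness is a parameter, so that the copy can carry the structure which
    Tonelli requires; it serves for double integrals over pairs of points of the plane. *)
Definition sigma_finite_copy of sigma_finite setT m : set T -> \bar R := m.
Local Notation sfm := (sigma_finite_copy s).
HB.instance Definition _ := Measure.copy sfm m.
Let sfm_sigma_finite : sigma_finite setT sfm. Proof. exact: s. Qed.
HB.instance Definition _ := Measure_isSigmaFinite.Build _ _ _ sfm sfm_sigma_finite.

Lemma sigma_finite_tonelli (f : T * T -> \bar R) :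
  measurable_fun setT f -> (forall p, 0 <= f p)%E ->
  (\int[m]_x \int[m]_y f (x, y) = \int[m]_y \int[m]_x f (x, y))%E.
Proof. by move=> mf f0; exact: (@fubini_tonelli _ _ T T R sfm sfm f mf f0). Qed.

End sigma_finite_tonelli.

(** * Area measure in the plane under linear substitutions *)

Section plane.
Context {R : realType}.
Local Notation mu := (@lebesgue_measure R).
Local Notation mu2 := (mu \x mu)%E.
Implicit Types (f : R * R -> \bar R) (F : R[i] -> \bar R).

Lemma integral_xy f : measurable_fun setT f -> (forall z, 0 <= f z)%E ->
  (\int[mu2]_z f z = \int[mu]_x \int[mu]_y f (x, y))%E.
Proof. by move=> mf f0; exact: fubini_tonelli1. Qed.

Lemma integral_yx f : measurable_fun setT f -> (forall z, 0 <= f z)%E ->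
  (\int[mu2]_z f z = \int[mu]_y \int[mu]_x f (x, y))%E.
Proof. by move=> mf f0; exact: fubini_tonelli2. Qed.

(** On each horizontal line [k z.2] is a constant, so after Tonelli this is the affine substitution
    in one variable. Shears are the factors of multiplication by a complex number. *)
Lemma integral_shear1 (a : R) (k : R -> R) f :
  a != 0 -> measurable_fun setT k -> measurable_fun setT f ->
  (forall z, 0 <= f z)%E ->
  (`|a|%:E * \int[mu2]_z f (a * z.1 + k z.2, z.2)%R)%E = (\int[mu2]_z f z)%E.
Proof.
move=> a0 mk mf f0.
have mg : measurable_fun setT (fun z : R * R => (a * z.1 + k z.2, z.2)).
  apply: measurable_fun_pair => //.
  apply: measurable_funD; first exact: measurable_funM.
  exact: measurableT_comp.
rewrite !integral_yx//; last exact: measurableT_comp.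
rewrite -ge0_integralZl//.
- apply: eq_integral => y _ /=.
  rewrite -[RHS](@ge0_integral_affine _ a (k y))//.
  by apply: measurableT_comp.
- apply: (measurable_fun_fubini_tonelli_G (m1 := mu) (fun z => f (a * z.1 + k z.2, z.2)%R)) => //.
  exact: measurableT_comp.
- by move=> y _; exact: integral_ge0.
Qed.

Lemma integral_shear2 (a : R) (k : R -> R) f :
  a != 0 -> measurable_fun setT k -> measurable_fun setT f ->
  (forall z, 0 <= f z)%E ->
  (`|a|%:E * \int[mu2]_z f (z.1, a * z.2 + k z.1)%R)%E = (\int[mu2]_z f z)%E.
Proof.
move=> a0 mk mf f0.
have mg : measurable_fun setT (fun z : R * R => (z.1, a * z.2 + k z.1)).
  apply: measurable_fun_pair => //.
  apply: measurable_funD; first exact: measurable_funM.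
  exact: measurableT_comp.
rewrite !integral_xy//; last exact: measurableT_comp.
rewrite -ge0_integralZl//.
- apply: eq_integral => x _ /=.
  rewrite -[RHS](@ge0_integral_affine _ a (k x))//.
  by apply: measurableT_comp.
- apply: (measurable_fun_fubini_tonelli_F (m2 := mu) (fun z => f (z.1, a * z.2 + k z.1)%R)) => //.
  exact: measurableT_comp.
- by move=> y _; exact: integral_ge0.
Qed.

(** * Measurability of complex-valued functions by real and imaginary parts *)

Section cmeasurable.
Context {d : measure_display} {T : measurableType d}.
Implicit Types g h : T -> R[i].

Definition cmeasurable g :=
  measurable_fun setT (fun x => complex.Re (g x)) /\
  measurable_fun setT (fun x => complex.Im (g x)).

Lemma cmeasurable_cst c : cmeasurable (fun=> c).
Proof. by split; exact: measurable_cst. Qed.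

Lemma cmeasurableD g h : cmeasurable g -> cmeasurable h ->
  cmeasurable (fun x => g x + h x).
Proof.
move=> [g1 g2] [h1 h2]; split.
- rewrite (_ : (fun _ => _) = (fun x => complex.Re (g x) + complex.Re (h x))).
    exact: measurable_funD.
  by apply/funext => x; case: (g _) => ? ?; case: (h _).
- rewrite (_ : (fun _ => _) = (fun x => complex.Im (g x) + complex.Im (h x))).
    exact: measurable_funD.
  by apply/funext => x; case: (g _) => ? ?; case: (h _).
Qed.

Lemma cmeasurableM g h : cmeasurable g -> cmeasurable h ->
  cmeasurable (fun x => g x * h x).
Proof.
move=> [g1 g2] [h1 h2]; split.
- rewrite (_ : (fun _ => _) = (fun x => complex.Re (g x) * complex.Re (h x)
     - complex.Im (g x) * complex.Im (h x))).
    by apply: measurable_funB; exact: measurable_funM.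
  by apply/funext => x; case: (g _) => ? ?; case: (h _).
- rewrite (_ : (fun _ => _) = (fun x => complex.Re (g x) * complex.Im (h x)
     + complex.Im (g x) * complex.Re (h x))).
    by apply: measurable_funD; exact: measurable_funM.
  by apply/funext => x; case: (g _) => ? ?; case: (h _).
Qed.

Lemma cmeasurableX g n : cmeasurable g -> cmeasurable (fun x => g x ^+ n).
Proof.
move=> mg; elim: n => [|n IH]; first exact: cmeasurable_cst.
under eq_fun do rewrite exprS.
exact: cmeasurableM.
Qed.

Lemma cmeasurable_sum (I : Type) (r : seq I) (gs : I -> T -> R[i]) :
  (forall i, cmeasurable (gs i)) -> cmeasurable (fun x => \sum_(i <- r) gs i x).
Proof.
move=> mg; elim: r => [|i r IH].
  by under eq_fun do rewrite big_nil; exact: cmeasurable_cst.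
by under eq_fun do rewrite big_cons; exact: cmeasurableD.
Qed.

Lemma cmeasurable_conj g : cmeasurable g -> cmeasurable (fun x => (g x)^*%C).
Proof.
move=> [g1 g2]; split.
- by rewrite (_ : (fun _ => _) = (fun x => complex.Re (g x)))//; apply/funext => x; case: (g _).
- rewrite (_ : (fun _ => _) = (fun x => - complex.Im (g x))); first exact: measurable_funN.
  by apply/funext => x; case: (g _).
Qed.

Lemma cmeasurable_horner (p : {poly R[i]}) g : cmeasurable g ->
  cmeasurable (fun x => p.[g x]).
Proof.
move=> mg; under eq_fun do rewrite horner_coef.
apply: cmeasurable_sum => i; apply: cmeasurableM; first exact: cmeasurable_cst.
exact: cmeasurableX.
Qed.

Lemma measurable_comp_cmeasurable d' (T' : measurableType d') (F : R[i] -> T') g :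
  measurable_fun setT (fun z : R * R => F (toC z)) -> cmeasurable g ->
  measurable_fun setT (fun x => F (g x)).
Proof.
move=> mF [g1 g2].
rewrite (_ : (fun _ => _) = (fun z : R * R => F (toC z)) \o
  (fun x => (complex.Re (g x), complex.Im (g x)))); last first.
  by apply/funext => z /=; rewrite /toC/=; case: (g _).
apply: measurableT_comp => //.
exact: measurable_fun_pair.
Qed.

Lemma cmeasurable_toC (h : T -> R * R) : measurable_fun setT h ->
  cmeasurable (fun x => toC (h x)).
Proof.
by move=> mh; split; [exact: (measurableT_comp measurable_fst mh)|exact: (measurableT_comp measurable_snd mh)].
Qed.

End cmeasurable.

Lemma normc2E (z : R[i]) : normc z ^+ 2 = complex.Re z ^+ 2 + complex.Im z ^+ 2.
Proof. by case: z => x y /=; rewrite sqr_sqrtr// addr_ge0// sqr_ge0. Qed.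

Lemma normc_ge0 (z : R[i]) : 0 <= normc z.
Proof. by case: z => x y; exact: sqrtr_ge0. Qed.

Lemma cmeasurable_normc d (T : measurableType d) (g : T -> R[i]) : cmeasurable g ->
  measurable_fun setT (fun x => normc (g x) ^+ 2).
Proof.
move=> [g1 g2]; under eq_fun do rewrite normc2E.
by apply: measurable_funD; exact: measurable_funX.
Qed.

(** Triangular factorization of multiplication by c = p + iq: the shear (p x - q y + s, y), then a
    shear of the second coordinate with pivot [(p ^+ 2 + q ^+ 2) / p]. The pivot p must be nonzero,
    and the two pivots multiply to |c|^2. *)
Let integral_affine_Re (c b : R[i]) F : complex.Re c != 0 ->
  measurable_fun setT (fun z : R * R => F (toC z)) -> (forall z, 0 <= F z)%E ->
  ((normc c ^+ 2)%:E * \int[mu2]_z F (c * toC z + b)%R)%E =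
  (\int[mu2]_z F (toC z))%E.
Proof.
case: c => p q /= p0; case: b => s t mF F0.
have n0 : p ^+ 2 + q ^+ 2 != 0.
  by rewrite paddr_eq0 ?sqr_ge0// negb_and sqrf_eq0 p0.
have mk1 : measurable_fun setT (fun y : R => - q * y + s).
  by apply: measurable_funD => //; exact: measurable_funM.
have mk2 : measurable_fun setT (fun x : R => q / p * (x - s) + t).
  apply: measurable_funD => //; apply: measurable_funM => //.
  exact: measurable_funB.
rewrite -[RHS](@integral_shear2 ((p ^+ 2 + q ^+ 2) / p) _ _ _ mk2 mF)//; last first.
  by rewrite mulf_neq0// invr_eq0.
rewrite -[in RHS](@integral_shear1 p _ (fun z => F (toC (z.1, _))) p0 mk1)//; last first.
  apply: (measurable_comp_cmeasurable (g := fun z : R * R => toC (z.1,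
    (p ^+ 2 + q ^+ 2) / p * z.2 + (q / p * (z.1 - s) + t)))) => //.
  split => /=; first exact: measurable_fst.
  apply: (measurable_funD (f := fun z : R * R => _ * z.2) (g := fun z : R * R => _ + t)).
    by apply: measurable_funM => //; exact: measurable_snd.
  exact: (measurableT_comp mk2 measurable_fst).
rewrite muleA -EFinM -normrM divfK// sqr_sqrtr ?addr_ge0 ?sqr_ge0//.
rewrite ger0_norm ?addr_ge0 ?sqr_ge0//.
congr (_ * _)%E; apply: eq_integral => -[x y] _; congr F; rewrite /toC/=.
by simpc; congr Complex; field.
Qed.

(** When [c] is purely imaginary, both c / (1 + i) and 1 + i have nonzero real part, and the
    substitution is made in two stages. *)
Lemma integral_caffine (c b : R[i]) F : c != 0 ->
  measurable_fun setT (fun z : R * R => F (toC z)) -> (forall z, 0 <= F z)%E ->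
  ((normc c ^+ 2)%:E * \int[mu2]_z F (c * toC z + b)%R)%E =
  (\int[mu2]_z F (toC z))%E.
Proof.
move=> c0 mF F0; have [c1|c1] := eqVneq (complex.Re c) 0; last exact: integral_affine_Re.
have i10 : (1 +i* 1)%C != 0 :> R[i] by rewrite eq_complex /= oner_eq0.
have -> : c = (c / (1 +i* 1)%C) * (1 +i* 1)%C by rewrite divfK.
under eq_integral do rewrite -mulrA.
rewrite ComplexField.Normc.normcM exprMn EFinM -muleA.
rewrite -[RHS](@integral_affine_Re (c / (1 +i* 1)%C) b)//; last first.
  rewrite {mF F0 i10}; move: c0 c1; case: c => p q /=; rewrite eq_complex /= => + p0.
  rewrite p0 eqxx /= => q0.
  rewrite mul0r expr1n sub0r mulrN opprK mul1r mulf_neq0// invr_eq0 -natrD pnatr_eq0//.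
rewrite [X in (_ * X)%E = _](_ : _ = \int[mu2]_z F (c / (1 +i* 1)%C * toC z + b)%R)%E//.
rewrite -[RHS](@integral_affine_Re (1 +i* 1)%C 0 (fun z => F (c / (1 +i* 1)%C * z + b)))//=.
- by congr (_ * _)%E; apply: eq_integral => z _; rewrite addr0.
- apply: (measurable_comp_cmeasurable (g := fun z : R * R => (c / (1 +i* 1)%C * toC z + b))) => //.
  apply: cmeasurableD; last exact: cmeasurable_cst.
  by apply: cmeasurableM; [exact: cmeasurable_cst|exact: cmeasurable_toC].
Qed.

(** * Radial integrals and the area of the unit disc *)

Definition sqmod (z : measurableTypeR R * measurableTypeR R) : measurableTypeR R := z.1 ^+ 2 + z.2 ^+ 2.

Lemma sqmodE z : sqmod z = normc (toC z) ^+ 2.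
Proof. by rewrite normc2E. Qed.

Lemma measurable_sqmod : measurable_fun setT sqmod.
Proof. by apply: measurable_funD; exact: measurable_funX. Qed.

(** The area of the closed unit disc, an unknown constant until the Gaussian integral identifies it
    in [varpiE]. *)
Definition varpi : \bar R := mu2 (sqmod @^-1` `]-oo, 1%R]).

Lemma measurable_sqmod_le (t : R) : measurable (sqmod @^-1` `]-oo, t]).
Proof. by rewrite -[X in measurable X]setTI; exact: measurable_sqmod. Qed.

Lemma varpi_fin : varpi \is a fin_num.
Proof.
rewrite /varpi ge0_fin_numE ?measure_ge0//.
apply: (@le_lt_trans _ _ (mu2 (`[(-1)%R, 1%R] `*` `[(-1)%R, 1%R]))).
  apply: le_measure; rewrite ?inE//.
  - exact: measurable_sqmod_le.
  - exact: measurableX.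
  - move=> [x y]; rewrite /= /sqmod/= !in_itv/=.
    have H : forall x y : R, x ^+ 2 + y ^+ 2 <= 1 -> -1 <= x <= 1 /\ -1 <= y <= 1.
      by move=> {}x {}y xy; split; nra.
    exact: H.
rewrite product_measure1E// -[X in (X < _)%E]/(mu `[(-1)%R, 1%R]%classic * mu `[(-1)%R, 1%R]%classic)%E.
by rewrite lebesgue_measure_itv/=; case: ifP => _; rewrite ?mule0// -EFinB -EFinM ltry.
Qed.

Lemma indic_sqmod (i : interval R) z :
  \1_(sqmod @^-1` [set` i]) z = (sqmod z \in i)%:R :> R.
Proof.
by rewrite indicE; congr ((nat_of_bool _)%:R); apply/idP/idP; rewrite inE.
Qed.

Lemma integral_mu2_indic (A : set (R * R)) : measurable A ->
  (\int[mu2]_z (\1_A z)%:E)%E = mu2 A.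
Proof. by move=> mA; have := integral_indic mu2 measurableT mA; rewrite setIT. Qed.

Lemma mu2_sqmod_le (t : R) : 0 <= t -> mu2 (sqmod @^-1` `]-oo, t]) = (t%:E * varpi)%E.
Proof.
have pos : forall t : R, 0 < t -> mu2 (sqmod @^-1` `]-oo, t]) = (t%:E * varpi)%E.
  move=> {}t t0.
  pose F (z : R[i]) : \bar R := (\1_(sqmod @^-1` `]-oo, t]) (complex.Re z, complex.Im z))%:E.
  have st0 : Num.sqrt t != 0 by rewrite sqrtr_eq0 -ltNge.
  have := @integral_caffine (Num.sqrt t)%:C%C 0 F.
  rewrite /F; have -> : normc (Num.sqrt t)%:C%C ^+ 2 = t.
    by rewrite normc2E/= expr0n addr0 sqr_sqrtr// ltW.
  move=> H; rewrite -integral_mu2_indic//; last exact: measurable_sqmod_le.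
  rewrite [LHS](_ : _ = (\int[mu2]_z F (toC z))%E); last first.
    by apply: eq_integral => -[].
  rewrite -H//.
  - congr (_ * _)%E; rewrite /varpi -[RHS]integral_mu2_indic//; last exact: measurable_sqmod_le.
    apply: eq_integral => -[x y] _; rewrite addr0/= !indicE; congr ((nat_of_bool _)%:R%:E).
    apply: asbool_equiv_eq; rewrite /= !in_itv/= /sqmod /=.
    rewrite !mul0r subr0 addr0.
    by rewrite !exprMn sqr_sqrtr ?(ltW t0)// -mulrDr -ler_pdivlMl// mulVf ?gt_eqF.
  - by rewrite eq_complex /= negb_and st0.
  - by apply/measurable_EFinP; apply: (measurable_indic (D:=setT)); exact: measurable_sqmod_le.
(* Scaling does not reach [t = 0]; there the set lies in a disc of area at most [e], for each
   [e > 0]. *)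
rewrite le_eqVlt => /predU1P[<-|]; last exact: pos.
rewrite mul0e; apply/eqP; rewrite -measure_le0; apply/lee_addgt0Pr => e e0.
rewrite add0e.
have vp : (0 <= varpi)%E by exact: measure_ge0.
have vf := varpi_fin.
apply: (@le_trans _ _ (mu2 (sqmod @^-1` `]-oo, e / (fine varpi + 1)]))).
  apply: le_measure; rewrite ?inE; [exact: measurable_sqmod_le..|].
  move=> z/=; rewrite !in_itv/= => /le_trans; apply.
  by rewrite divr_ge0 ?(ltW e0)// addr_ge0// fine_ge0.
rewrite pos; last by rewrite divr_gt0// ltr_wpDl// fine_ge0.
rewrite -[X in (_ * X)%E](fineK vf) -EFinM lee_fin.
have := fine_ge0 vp; move: (fine varpi) => v v0.
by rewrite mulrAC ler_pdivrMr ?ltr_wpDl// ler_pM2l//; lra.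
Qed.

Lemma varpi_gt0 : (0 < varpi)%E.
Proof.
apply: (@lt_le_trans _ _ (mu2 (`[(- (1/2))%R, (1/2)%R] `*` `[(- (1/2))%R, (1/2)%R]))).
  rewrite product_measure1E// -[X in (_ < X)%E]/(mu `[(- (1/2))%R, (1/2)%R]%classic * mu `[(- (1/2))%R, (1/2)%R]%classic)%E.
  rewrite lebesgue_measure_itv/= lte_fin ifT; last by lra.
  by rewrite -EFinB -EFinM lte_fin; nra.
apply: le_measure; rewrite ?inE.
- exact: measurableX.
- exact: measurable_sqmod_le.
- move=> [x y]; rewrite /= /sqmod/= !in_itv/=.
  have H : forall x y : R, - (1/2) <= x <= 1/2 /\ - (1/2) <= y <= 1/2 -> x ^+ 2 + y ^+ 2 <= 1.
    by move=> {}x {}y [] ? ?; nra.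
  exact: H.
Qed.

Lemma mu2_sqmod_itv (a b : R) : 0 <= a <= b ->
  mu2 (sqmod @^-1` `]a, b]) = ((b - a)%:E * varpi)%E.
Proof.
move=> /andP[a0 ab].
have -> : sqmod @^-1` `]a, b] = sqmod @^-1` `]-oo, b] `\` sqmod @^-1` `]-oo, a].
  apply/seteqP; split => z /=; rewrite !in_itv/=; first by move=> /andP[? ->]; split => //; lra.
  by move=> [-> /negP]; rewrite -ltNge => ->.
have vf := varpi_fin.
have mD (A B : set (R * R)) : measurable A -> measurable B -> (mu2 A < +oo)%E ->
    (mu2 (A `\` B) = mu2 A - mu2 (A `&` B))%E by move=> mA mB fA; exact: (@measureD _ _ _ mu2 A B).
rewrite mD; [|exact: measurable_sqmod_le..|]; last first.
  by rewrite mu2_sqmod_le ?(le_trans a0)// -(fineK vf) -EFinM ltry.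
rewrite setIidr; last by move=> z /=; rewrite !in_itv/= => /le_trans; apply.
rewrite !mu2_sqmod_le ?(le_trans a0)//.
by rewrite -(fineK vf) -!EFinM -EFinB mulrBl.
Qed.

Lemma pushforward_sqmod (A : set (measurableTypeR R)) : measurable A -> A `<=` `[0, +oo[ ->
  pushforward mu2 sqmod A = (varpi * mu A)%E.
Proof.
move=> mA A0.
have vf := varpi_fin; have v0 := varpi_gt0.
have vr0 : 0 < fine varpi by rewrite fine_gt0// v0 /= ltey_eq vf.
have vr0' : 0 <= (fine varpi)^-1 by rewrite invr_ge0 ltW.
have mN : measurable (`]-oo, 0%R[%classic : set (measurableTypeR R)) by [].
have msq := measurable_sqmod.
(* Lebesgue measure is glued in on the negative half-line, which does not meet [A], so that [nu] is
   a measure on the whole line to which uniqueness on intervals applies. *)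
pose nu : {measure set (measurableTypeR R) -> \bar R} :=
  measure_add (mscale (NngNum vr0') (pushforward mu2 sqmod)) (mrestr mu mN).
have nuE B : nu msq B = ((fine varpi)^-1%:E * mu2 (sqmod @^-1` B) + mu (B `&` `]-oo, 0%R[))%E.
  exact: measure_addE.
have H : forall X, ocitv X -> mu X = nu msq X.
  move=> _ [[a b]] _ <-; rewrite nuE.
  have [ab|ba] := leP b a.
    by rewrite set_itv_ge ?bnd_simp -?leNgt// preimage_set0 set0I !measure0 mule0 adde0.
  have [a0|a0] := leP 0 a.
    rewrite mu2_sqmod_itv ?a0 ?ltW//= [X in (_ + mu X)%E](_ : _ = set0); last first.
      by apply/seteqP; split => x //=; rewrite !in_itv/=; lra.
    rewrite measure0 adde0 lebesgue_measure_itv/= lte_fin ba -EFinB -(fineK vf) -!EFinM.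
    by congr EFin; rewrite mulrCA mulVf ?mulr1// gt_eqF.
  have sq0 (z : R * R) : 0 <= sqmod z by rewrite /sqmod addr_ge0// sqr_ge0.
  have [b0|b0] := ltP b 0.
    rewrite [X in mu2 X](_ : _ = set0); last first.
      by apply/seteqP; split => z //=; rewrite in_itv/= => /andP[_ zb]; have := sq0 z; lra.
    rewrite measure0 mule0 add0e; congr (mu _).
    by apply/seteqP; split => x //=; rewrite !in_itv/=; lra.
  rewrite [X in mu2 X](_ : _ = sqmod @^-1` `]-oo, b]); last first.
    apply/seteqP; split => z //=; rewrite !in_itv/=; first by case/andP.
    by move=> ->; rewrite (lt_le_trans a0).
  rewrite [X in (_ + mu X)%E](_ : _ = `]a, 0%R[%classic); last first.
    by apply/seteqP; split => x //=; rewrite !in_itv/=; lra.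
  rewrite mu2_sqmod_le// !lebesgue_measure_itv/= !lte_fin ba a0 -!EFinB -(fineK vf) -!EFinM -EFinD.
  by congr EFin; field; rewrite gt_eqF.
have := lebesgue_measure_unique H mA; rewrite nuE => muA.
rewrite muA [X in (_ + mu X)%E](_ : _ = set0); last first.
  by apply/seteqP; split => x //= [/A0/=]; rewrite !in_itv/=; lra.
rewrite measure0 adde0 muleA -{1}(fineK vf) -EFinM divff ?gt_eqF// mul1e.
by [].
Qed.

Lemma integral_sqmod (f : R -> \bar R) : measurable_fun setT f -> (forall x, 0 <= f x)%E ->
  (\int[mu2]_z f (sqmod z) = varpi * \int[mu]_(x in `[0%R, +oo[) f x)%E.
Proof.
move=> mf f0.
have vf := varpi_fin; have v0 := varpi_gt0.
have vr0 : 0 <= fine varpi by rewrite fine_ge0// ltW.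
have -> : (\int[mu2]_z f (sqmod z) = \int[pushforward mu2 sqmod]_(x in `[0%R, +oo[) f x)%E.
  rewrite (ge0_integral_pushforward measurable_sqmod)//; last exact: measurable_funTS.
  rewrite (_ : sqmod @^-1` `[0%R, +oo[ = setT)//.
  apply/seteqP; split => z //= _; rewrite in_itv/= andbT /sqmod.
  by rewrite addr_ge0// sqr_ge0.
rewrite -[X in (X * _)%E](fineK vf) -[X in (X * _)%E]/((NngNum vr0)%:num%:E).
rewrite -(@ge0_integral_mscale _ _ _ mu)//; last exact: measurable_funTS.
apply: eq_measure_integral => [|msq A mA A0]; first exact: measurable_sqmod.
transitivity (varpi * mu A)%E; first exact: pushforward_sqmod.
by rewrite /= /mscale/= fineK.
Qed.

(** The integral of exp(-|z|^2) is computed twice: as a function of [sqmod] it is [varpi] times the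
    exponential integral 1, and by Tonelli it is the square of the Gaussian integral. *)
Lemma varpiE : varpi = pi%:E.
Proof.
have mE : measurable_fun setT (fun x : R => (expR (- x))%:E).
  by apply/measurable_EFinP; apply: measurableT_comp => //; exact: measurable_funN.
have e0 x : (0 <= (expR (- x) : R)%:E)%E by rewrite lee_fin expR_ge0.
have := integral_sqmod mE e0.
have -> : (\int[mu]_(x in `[0%R, +oo[) (expR (- x))%:E = 1)%E.
  rewrite -(@integral_exponential_pdf R 1)// [LHS]integral_mkcond.
  apply: eq_integral => x _; rewrite /exponential_pdf !patchE.
  by case: ifP => // _; rewrite mul1r mulN1r.
rewrite mule1 => <-.
rewrite integral_xy//; last by apply: (measurableT_comp mE); exact: measurable_sqmod.
have mg : measurable_fun setT (fun x : R => (gauss_fun x)%:E).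
  by apply/measurable_EFinP; exact: measurable_gauss_fun.
have g0 (x : R) : (0 <= (gauss_fun x)%:E)%E by rewrite lee_fin gauss_fun_ge0.
transitivity (\int[mu]_x ((gauss_fun x)%:E * (Num.sqrt pi)%:E))%E.
  apply: eq_integral => x _; rewrite -integralT_gauss -ge0_integralZl//.
  by apply: eq_integral => y _; rewrite -EFinM /gauss_fun -expRD -opprD.
rewrite ge0_integralZr ?lee_fin ?sqrtr_ge0//= integralT_gauss -EFinM -expr2.
by rewrite sqr_sqrtr// pi_ge0.
Qed.

Lemma integral_itv01_exprn (k : nat) :
  (\int[mu]_(x in `[0%R, 1%R[) (x ^+ k)%:E = (k.+1%:R^-1)%:E)%E.
Proof.
rewrite integral_itv_bndo_bndc; last first.
  by apply/measurable_EFinP; apply: measurable_funTS; exact: measurable_funX.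
rewrite (@continuous_FTC2 _ _ (fun x => x ^+ k.+1 / k.+1%:R))//.
- by rewrite expr0n/= expr1n mul0r mul1r sube0.
- by apply: continuous_in_subspaceT => x _; exact: exprn_continuous.
- split.
  + by move=> x _; apply: derivableM => //; exact: exprn_derivable.
  + apply: cvg_at_right_filter; apply: cvgM; last exact: cvg_cst.
    exact: exprn_continuous.
  + apply: cvg_at_left_filter; apply: cvgM; last exact: cvg_cst.
    exact: exprn_continuous.
- move=> x _; rewrite derive1Mr//; last exact: exprn_derivable.
  by rewrite derive1E exp_derive/= scaler1 mulrAC divff ?pnatr_eq0// mul1r.
Qed.

Lemma integral_disc_sqmod (k : nat) :
  (\int[mu2]_z ((sqmod z < 1)%R%:R * sqmod z ^+ k)%R%:E = (pi / k.+1%:R)%:E)%E.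
Proof.
(* The absolute value makes [f] nonnegative on the whole line, as [integral_sqmod] demands; on [[0,
   1[] it changes nothing. *)
pose f (x : R) := ((`|x| ^+ k) * (x < 1)%R%:R : R).
have mf : measurable_fun setT (EFin \o f).
  apply/measurable_EFinP; apply: measurable_funM.
    by apply: measurable_funX; exact: normr_measurable.
  have := @measurable_indic _ R R setT `]-oo, 1%R[%classic (measurable_itv _).
  rewrite (_ : \1__ = fun x : R => (x < 1)%R%:R)//.
  by apply/funext => x; rewrite indicE mem_setE in_itv/=.
transitivity (\int[mu2]_z (EFin \o f) (sqmod z))%E.
  apply: eq_integral => z _; rewrite /f/= mulrC ger0_norm// /sqmod; by rewrite addr_ge0// sqr_ge0.
rewrite integral_sqmod//; last by move=> x; rewrite lee_fin /f mulr_ge0// exprn_ge0.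
rewrite varpiE EFinM; congr (_ * _)%E; rewrite -integral_itv01_exprn.
rewrite [LHS]integral_mkcond [RHS]integral_mkcond; apply: eq_integral => x _.
rewrite !patchE !mem_setE !in_itv/= andbT /f.
by case: (leP 0 x) => x0//=; case: ifP => x1; rewrite ?mulr0// mulr1 ger0_norm.
Qed.

(** * The Haar measure of C^* and the map z |-> z^m *)

Definition hwt (z : R[i]) : R := (normc z ^+ 2)^-1.

Lemma hwt_ge0 z : 0 <= hwt z.
Proof. by rewrite invr_ge0 exprn_ge0// normc_ge0. Qed.

(** The convention [0^-1 = 0] gives the origin no weight, so planar integrals against [hwt] are
    integrals over C^*. *)
Lemma hwt0 : hwt 0 = 0.
Proof. by rewrite /hwt ComplexField.Normc.normc0 expr0n invr0. Qed.

Lemma hwtM z w : hwt (z * w) = hwt z * hwt w.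
Proof. by rewrite /hwt ComplexField.Normc.normcM exprMn invfM. Qed.

Lemma normc_eq0 (z : R[i]) : (normc z == 0) = (z == 0).
Proof.
apply/eqP/eqP => [|->]; first exact: ComplexField.Normc.eq0_normc.
exact: ComplexField.Normc.normc0.
Qed.

Lemma measurable_hwt d (T : measurableType d) (g : T -> R[i]) : cmeasurable g ->
  measurable_fun setT (fun x => hwt (g x)).
Proof.
move=> mg; rewrite (_ : (fun _ => _) = (@powR R ^~ (-1)) \o (fun x => normc (g x) ^+ 2)).
  apply: measurableT_comp; last exact: cmeasurable_normc.
  exact: measurable_powR.
by apply/funext => x /=; rewrite powR_inv1// exprn_ge0// normc_ge0.
Qed.

Lemma cmeasurable_toC1 : cmeasurable (fun z : R * R => toC z).
Proof. exact: cmeasurable_toC. Qed.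

(* The Haar integral of C^*. *)
Definition hint (f : R[i] -> R) : \bar R :=
  (\int[mu2]_z (f (toC z) * hwt (toC z))%:E)%E.

(** Multiplication by [c] multiplies area by |c|^2 and divides the density [hwt] by the same
    factor. *)
Lemma hint_mul (c : R[i]) (f : R[i] -> R) : c != 0 ->
  measurable_fun setT (fun z : R * R => f (toC z)) -> (forall z, 0 <= f z) ->
  hint (fun z => f (c * z)) = hint f.
Proof.
move=> c0 mf f0.
have mF : measurable_fun setT (fun z : R * R => (f (toC z) * hwt (toC z))%:E).
  apply/measurable_EFinP; apply: measurable_funM => //.
  by apply: measurable_hwt; exact: cmeasurable_toC1.
rewrite /hint -[RHS](@integral_caffine c 0 (fun z => (f z * hwt z)%:E))//; last first.
  by move=> z; rewrite lee_fin mulr_ge0// hwt_ge0.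
rewrite -ge0_integralZl//.
- apply: eq_integral => z _; rewrite -EFinM addr0 hwtM; congr EFin.
  by rewrite mulrCA; congr (_ * _); rewrite mulrA divff ?mul1r// expf_neq0// normc_eq0.
- apply: (measurable_comp_cmeasurable (F := fun z => (f z * hwt z)%:E)) => //.
  apply: cmeasurableD; last exact: cmeasurable_cst.
  by apply: cmeasurableM; [exact: cmeasurable_cst|exact: cmeasurable_toC1].
- by move=> z _; rewrite lee_fin mulr_ge0// hwt_ge0.
- by rewrite lee_fin exprn_ge0// normc_ge0.
Qed.

Lemma complex_root (w : R[i]) (m : nat) : (0 < m)%N -> exists c, c ^+ m = w.
Proof.
move=> m0; have [c] := @solve_monicpoly R[i] m (fun i => if i == 0%N then w else 0) m0.
case: m m0 => // m _ H; exists c; rewrite H big_ord_recl /= expr0 mulr1 big1 ?addr0//.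
by move=> i _; rewrite mul0r.
Qed.

Lemma hintZ (k : R) (f : R[i] -> R) : 0 <= k ->
  measurable_fun setT (fun z : R * R => f (toC z)) -> (forall z, 0 <= f z) ->
  hint (fun z => k * f z) = (k%:E * hint f)%E.
Proof.
move=> k0 mf f0; rewrite /hint -ge0_integralZl//.
- by apply: eq_integral => z _; rewrite -EFinM mulrA.
- apply/measurable_EFinP; apply: measurable_funM => //.
  by apply: measurable_hwt; exact: cmeasurable_toC1.
- by move=> z _; rewrite lee_fin mulr_ge0// hwt_ge0.
Qed.

Lemma mu2_sigma_finite : sigma_finite setT mu2.
Proof.
exists (fun n => sqmod @^-1` `]-oo, n%:R]).
  apply/esym/seteqP; split => // z _; exists (Num.truncn (sqmod z)).+1 => //=.
  by rewrite in_itv/= ltW// truncnS_gt.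
move=> n; split; first exact: measurable_sqmod_le.
by rewrite mu2_sqmod_le// varpiE -EFinM ltry.
Qed.

Lemma hint_tonelli (f : R[i] -> R[i] -> R) :
  measurable_fun setT (fun p : (R * R) * (R * R) => f (toC p.1) (toC p.2)) ->
  (forall z w, 0 <= f z w) ->
  (\int[mu2]_z \int[mu2]_w (f (toC z) (toC w))%:E =
   \int[mu2]_w \int[mu2]_z (f (toC z) (toC w))%:E)%E.
Proof.
move=> mf f0.
apply: (@sigma_finite_tonelli _ _ R mu2 mu2_sigma_finite (fun p => (f (toC p.1) (toC p.2))%:E)).
- exact/measurable_EFinP.
- by move=> p; rewrite lee_fin.
Qed.

(* Uniqueness of the Haar measure of C^*, for its image under z |-> z^m: both
   sides of the identity below arise from integrating the same function
   f(w) 1_{1 < |w / z^m|^2 <= 4} over z and w in the two possible orders. *)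
Let annulus (t s : R) : R := if (t < s) && (s <= 4 * t) then 1 else 0.

Let annulus_ge0 t s : 0 <= annulus t s. Proof. by rewrite /annulus; case: ifP. Qed.

Let annulusM (k t s : R) : 0 < k -> annulus (k * t) (k * s) = annulus t s.
Proof. by move=> k0; rewrite /annulus ltr_pM2l// mulrCA ler_pM2l. Qed.

Let measurable_annulus d (T : measurableType d) (f g : T -> R) :
  measurable_fun setT f -> measurable_fun setT g ->
  measurable_fun setT (fun x => annulus (f x) (g x)).
Proof.
move=> mf mg; rewrite /annulus.
apply: (@measurable_fun_ifT _ _ T R (cst 1) (cst 0) (fun x => (f x < g x) && (g x <= 4 * f x)) _ (measurable_cst _) (measurable_cst _)).
apply: measurable_and; first exact: measurable_fun_ltr.
by apply: measurable_fun_ler => //; exact: measurable_funM.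
Qed.

Let hint_annulus_pow (m : nat) (f : R[i] -> R) : (0 < m)%N ->
  measurable_fun setT (fun z : R * R => f (toC z)) -> (forall z, 0 <= f z) ->
  (hint (fun w => annulus 1 (normc w ^+ 2))%R * hint (fun z => f (z ^+ m)%R) =
   hint (fun z => annulus (normc (z ^+ m) ^+ 2) 1)%R * hint f)%E.
Proof.
move=> m0 mf f0.
pose A (w : R[i]) := annulus 1 (normc w ^+ 2).
pose B (z w : R[i]) := annulus (normc (z ^+ m) ^+ 2) (normc w ^+ 2).
have n2 (z : R[i]) : z != 0 -> 0 < normc z ^+ 2.
  by move=> z0; rewrite exprn_gt0// lt_def normc_eq0 z0 normc_ge0.
have mA : measurable_fun setT (fun z : R * R => A (toC z)).
  by apply: measurable_annulus => //; apply: cmeasurable_normc; exact: cmeasurable_toC1.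
have m1 : cmeasurable (fun p : (R * R) * (R * R) => toC p.1) by exact: cmeasurable_toC.
have m2 : cmeasurable (fun p : (R * R) * (R * R) => toC p.2) by exact: cmeasurable_toC.
have m4 d (T : measurableType d) (a b c e : T -> R) : measurable_fun setT a -> measurable_fun setT b ->
    measurable_fun setT c -> measurable_fun setT e -> measurable_fun setT (fun x => a x * b x * c x * e x).
  by move=> ma mb mc me; exact: measurable_funM (measurable_funM (measurable_funM ma mb) mc) me.
have mh1 := measurable_hwt m1; have mh2 := measurable_hwt m2.
have Bz (z w : R[i]) : z != 0 -> B z (z ^+ m * w) = A w.
  move=> z0; rewrite /B /A ComplexField.Normc.normcM exprMn -{1}[normc (z ^+ m) ^+ 2]mulr1.
  by rewrite annulusM// n2// expf_neq0.
have mf1 : measurable_fun setT (fun z : R * R => f (toC z ^+ m)).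
  apply: (measurable_comp_cmeasurable mf); apply: cmeasurableX; exact: cmeasurable_toC1.
(* With [c ^+ m = w], invariance under z |-> c z replaces z^m by z^m w inside [f]. *)
have step1 : (hint A * hint (fun z => f (z ^+ m)%R) =
    \int[mu2]_z \int[mu2]_w (f (toC z ^+ m * toC w) * A (toC w) * hwt (toC w) * hwt (toC z))%R%:E)%E.
  rewrite (@hint_tonelli (fun z w => f (z ^+ m * w) * A w * hwt w * hwt z)); last 2 first.
  - apply: m4 mh2 mh1.
      exact: (measurable_comp_cmeasurable mf (cmeasurableM (cmeasurableX m m1) m2)).
    exact: (measurable_comp_cmeasurable mA m2).
  - by move=> z w; rewrite !mulr_ge0 ?hwt_ge0 ?annulus_ge0.
  rewrite {1}/hint -ge0_integralZr//; last 3 first.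
  - apply/measurable_EFinP; apply: measurable_funM => //.
    by apply: measurable_hwt; exact: cmeasurable_toC1.
  - by move=> z _; rewrite lee_fin mulr_ge0 ?hwt_ge0 ?annulus_ge0.
  - by apply: integral_ge0 => z _; rewrite lee_fin mulr_ge0 ?hwt_ge0.
  apply: eq_integral => w _.
  have [w0|w0] := eqVneq (toC w) 0.
    rewrite w0 hwt0 mulr0 mul0e; apply/esym/integral0_eq => z _.
    by rewrite mulr0 mul0r.
  have [c cw] := complex_root (toC w) m0.
  have c0 : c != 0 by apply: contraNneq w0 => c0; rewrite -cw c0 expr0n gtn_eqF.
  rewrite -(hint_mul c0 mf1)//= -hintZ//; last 2 first.
  - by rewrite mulr_ge0 ?hwt_ge0 ?annulus_ge0.
  - apply: (measurable_comp_cmeasurable mf); apply: cmeasurableX.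
    by apply: cmeasurableM; [exact: cmeasurable_cst|exact: cmeasurable_toC1].
  by apply: eq_integral => z _; rewrite exprMn cw mulrC [X in f X]mulrC; congr EFin; ring.
(* For fixed [z], invariance under w |-> z^m w undoes the product inside [f] and turns [A w] into
   [B z w], since [annulus] is unchanged when both arguments are scaled. *)
have step2 : (\int[mu2]_z \int[mu2]_w (f (toC z ^+ m * toC w) * A (toC w) * hwt (toC w) * hwt (toC z))%R%:E =
    \int[mu2]_z \int[mu2]_w (f (toC w) * B (toC z) (toC w) * hwt (toC w) * hwt (toC z))%R%:E)%E.
  apply: eq_integral => z _.
  have [z0|z0] := eqVneq (toC z) 0.
    by rewrite z0; apply: eq_integral => w _; rewrite hwt0 !mulr0.
  have mB : measurable_fun setT (fun w : R * R => f (toC w) * B (toC z) (toC w)).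
    apply: measurable_funM => //; apply: measurable_annulus => //.
    by apply: cmeasurable_normc; exact: cmeasurable_toC1.
  have zm0 : toC z ^+ m != 0 by rewrite expf_neq0.
  have fB0 w : 0 <= f w * B (toC z) w by rewrite mulr_ge0 ?annulus_ge0.
  have := hint_mul zm0 mB fB0; move/(congr1 (fun x => (hwt (toC z))%:E * x)%E).
  rewrite -!hintZ ?hwt_ge0//; last first.
    apply: (measurable_comp_cmeasurable (F := fun w => f w * B (toC z) w) mB).
    by apply: cmeasurableM; [exact: cmeasurable_cst|exact: cmeasurable_toC1].
  move=> H; transitivity (hint (fun w => hwt (toC z) * (f (toC z ^+ m * w) * B (toC z) (toC z ^+ m * w)))).
    by apply: eq_integral => w _; rewrite Bz//; congr EFin; ring.
  by rewrite H; apply: eq_integral => w _; congr EFin; ring.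
rewrite step1 step2 (@hint_tonelli (fun z w => f w * B z w * hwt w * hwt z)); last 2 first.
- apply: m4 mh2 mh1; first exact: (measurable_comp_cmeasurable mf m2).
  exact: (measurable_annulus (cmeasurable_normc (cmeasurableX m m1)) (cmeasurable_normc m2)).
- by move=> z w; rewrite !mulr_ge0 ?hwt_ge0 ?annulus_ge0.
have mX : cmeasurable (fun z : R * R => toC z ^+ m) := cmeasurableX m cmeasurable_toC1.
pose K := hint (fun z => annulus (normc (z ^+ m) ^+ 2) 1).
have K0 : (0 <= K)%E.
  by apply: integral_ge0 => z _; rewrite lee_fin mulr_ge0 ?hwt_ge0 ?annulus_ge0.
have mBw w : measurable_fun setT (fun z : R * R => B (toC z) w).
  exact: (measurable_annulus (cmeasurable_normc mX) (measurable_cst _)).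
(* The inner integral does not depend on [w]: scaling [z] by an m-th root of [w] makes [w] cancel
   inside [annulus]. *)
have KE w : w != 0 -> K = hint (fun z => B z w).
  move=> w0; have [c cw] := complex_root w m0.
  have c0 : c != 0 by apply: contraNneq w0 => c0; rewrite -cw c0 expr0n gtn_eqF.
  have B0 z : 0 <= B z w by exact: annulus_ge0.
  transitivity (hint (fun z => B (c * z) w)); last exact: (@hint_mul c (fun z => B z w) c0 (mBw w) B0).
  apply: eq_integral => z _.
  congr (_ * _)%:E; rewrite /B exprMn cw ComplexField.Normc.normcM exprMn.
  by rewrite -[X in _ = annulus _ X]mulr1 annulusM// n2.
rewrite -/K; clearbody K.
transitivity (\int[mu2]_w (K * (f (toC w) * hwt (toC w))%R%:E))%E; last first.
  rewrite ge0_integralZl//.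
  - apply/measurable_EFinP; apply: measurable_funM => //.
    exact: (measurable_hwt cmeasurable_toC1).
  - by move=> z _; rewrite lee_fin mulr_ge0 ?hwt_ge0.
apply: eq_integral => w _.
have [w0|w0] := eqVneq (toC w) 0.
  rewrite w0 hwt0 mulr0 mule0; apply/integral0_eq => z _.
  by rewrite mulr0 mul0r.
rewrite (KE _ w0) muleC.
rewrite -hintZ//; last 2 first.
- by rewrite mulr_ge0 ?hwt_ge0.
- by move=> z; exact: annulus_ge0.
by apply: eq_integral => z _; congr EFin; ring.
Qed.

(** The identity of Haar integrals is applied to F times |z|^2; composed with z^m and divided by
    |z|^2 this factor becomes |z|^(2m-2). [F 0 = 0] settles the origin, which the Haar measure does
    not see. *)
Lemma integral_pow (m : nat) (F : R[i] -> R) : (1 < m)%N ->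
  measurable_fun setT (fun z : R * R => F (toC z)) -> (forall z, 0 <= F z) -> F 0 = 0 ->
  (\int[mu2]_z (F (toC z ^+ m) * normc (toC z) ^+ (2 * m - 2))%R%:E =
   (m%:R^-1)%:E * \int[mu2]_z (F (toC z))%:E)%E.
Proof.
move=> m1 mF F0 F00; have m0 : (0 < m)%N by exact: ltnW.
pose k1 := hint (fun w => annulus 1 (normc w ^+ 2)).
pose k2 := hint (fun z => annulus (normc (z ^+ m) ^+ 2) 1).
have n2z (z : R[i]) : z != 0 -> normc z ^+ 2 != 0 by move=> z0; rewrite expf_neq0// normc_eq0.
pose lift (F : R[i] -> R) z := F z * normc z ^+ 2.
have lift0 G : (forall z, 0 <= G z) -> forall z, 0 <= lift G z.
  by move=> G0 z; rewrite mulr_ge0// exprn_ge0// normc_ge0.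
have mlift G : measurable_fun setT (fun z : R * R => G (toC z)) ->
    measurable_fun setT (fun z : R * R => lift G (toC z)).
  by move=> mG; exact: measurable_funM mG (cmeasurable_normc cmeasurable_toC1).
have E1 G : hint (fun z => lift G (z ^+ m)) =
    (\int[mu2]_z (G (toC z ^+ m) * normc (toC z) ^+ (2 * m - 2))%R%:E)%E.
  apply: eq_integral => z _; congr EFin; rewrite /lift /hwt -mulrA; congr (_ * _).
  have -> : normc (toC z ^+ m) = normc (toC z) ^+ m.
    by elim: (m) => [|k IH]; rewrite ?expr0 ?ComplexField.Normc.normc1// !exprS ComplexField.Normc.normcM IH.
  have [->|z0] := eqVneq (toC z) 0.
    rewrite ComplexField.Normc.normc0 -exprM !expr0n/= invr0 mulr0.
    by rewrite (_ : (2 * m - 2 == 0)%N = false)//; lia.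
  by apply: (mulIf (n2z _ z0)); rewrite divfK ?n2z// -exprM -exprD; congr (_ ^+ _); lia.
have E2 G : G 0 = 0 -> hint (lift G) = (\int[mu2]_z (G (toC z))%:E)%E.
  move=> G0; apply: eq_integral => z _; congr EFin; rewrite /lift /hwt.
  have [->|z0] := eqVneq (toC z) 0; first by rewrite G0 !mul0r.
  by rewrite -mulrA divff ?mulr1// n2z.
have key (G : R[i] -> R) : measurable_fun setT (fun z : R * R => G (toC z)) -> (forall z, 0 <= G z) -> G 0 = 0 ->
  (k1 * \int[mu2]_z (G (toC z ^+ m) * normc (toC z) ^+ (2 * m - 2))%R%:E =
   k2 * \int[mu2]_z (G (toC z))%:E)%E.
  by move=> mG G0 G00; rewrite -E1 -E2//; exact: hint_annulus_pow (mlift _ mG) (lift0 _ G0).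
have mk1 : measurable_fun setT (fun z : R * R => (annulus 1 (normc (toC z) ^+ 2) * hwt (toC z))%:E).
  apply/measurable_EFinP; apply: measurable_funM (measurable_hwt cmeasurable_toC1).
  exact: (measurable_annulus (measurable_cst _) (cmeasurable_normc cmeasurable_toC1)).
have k1ge0 (z : R * R) : (0 <= (annulus 1 (normc (toC z) ^+ 2) * hwt (toC z))%:E)%E.
  by rewrite lee_fin mulr_ge0 ?annulus_ge0 ?hwt_ge0.
(* On the annulus 1 < |z|^2 <= 4 the density lies between 1/4 and 1, so [k1] is finite and positive
   and can be cancelled. *)
have k1fin : k1 \is a fin_num.
  rewrite ge0_fin_numE; last by apply: integral_ge0 => z _; exact: k1ge0.
  apply: (@le_lt_trans _ _ (mu2 (sqmod @^-1` `]-oo, 4%R]))); last first.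
    by rewrite mu2_sqmod_le// varpiE -EFinM ltry.
  have mS := measurable_sqmod_le 4.
  rewrite -integral_mu2_indic//.
  apply: ge0_le_integral => //.
  - by apply/measurable_EFinP; apply: (measurable_indic (D:=setT)).
  - move=> z _; rewrite lee_fin indic_sqmod in_itv/= sqmodE /annulus /hwt mulr1.
    case: ifP => [/andP[z1 ->]|_]; last by rewrite mul0r.
    by rewrite mul1r invf_le1 ?ltW// (lt_trans ltr01).
have k10 : (0 < k1)%E.
  have mS : measurable (sqmod @^-1` `]1%R, 4%R]).
    by rewrite -[X in measurable X]setTI; exact: measurable_sqmod.
  apply: (@lt_le_trans _ _ ((4^-1)%:E * mu2 (sqmod @^-1` `]1%R, 4%R]))%E).
    rewrite (@mu2_sqmod_itv 1 4); last by lra.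
    by rewrite varpiE -!EFinM lte_fin !mulr_gt0 ?pi_gt0//; lra.
  rewrite -integral_mu2_indic// -ge0_integralZl//; last first.
    by apply/measurable_EFinP; apply: (measurable_indic (D:=setT)).
  apply: ge0_le_integral => //.
  - by apply: measurable_funeM; apply/measurable_EFinP; apply: (measurable_indic (D:=setT)).
  - move=> z _; rewrite -EFinM lee_fin indic_sqmod in_itv/= sqmodE /annulus /hwt mulr1.
    case: ifP => [/andP[z1 z4]|_]; last by rewrite mulr0 mul0r.
    by rewrite mulr1 mul1r lef_pV2 ?posrE// (lt_trans ltr01).
(* The ratio of the two constants is read off from one test function, |z|^2 on the open unit disc,
   whose two integrals are pi/2 and pi/(2m). *)
have k12 : k2 = ((m%:R^-1)%:E * k1)%E.
  pose G (z : R[i]) : R := (normc z ^+ 2 < 1)%R%:R * normc z ^+ 2.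
  have mG : measurable_fun setT (fun z : R * R => G (toC z)).
    apply: measurable_funM (cmeasurable_normc cmeasurable_toC1).
    rewrite (_ : (fun _ => _) = \1_(sqmod @^-1` `]-oo, 1%R[)); last first.
      by apply/funext => z; rewrite indic_sqmod in_itv/= sqmodE.
    apply: (measurable_indic (D:=setT)).
    by rewrite -[X in measurable X]setTI; exact: measurable_sqmod.
  have G0 z : 0 <= G z by rewrite mulr_ge0// exprn_ge0// normc_ge0.
  have G00 : G 0 = 0 by rewrite /G ComplexField.Normc.normc0 expr0n mulr0.
  have := key _ mG G0 G00.
  have -> : (\int[mu2]_z (G (toC z))%:E = (pi / 2)%:E)%E.
    rewrite -(integral_disc_sqmod 1); apply: eq_integral => z _.
    by rewrite /G sqmodE expr1.
  have -> : (\int[mu2]_z (G (toC z ^+ m) * normc (toC z) ^+ (2 * m - 2))%R%:E = (pi / (2 * m%:R))%:E)%E.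
    rewrite -natrM (_ : 2 * m = (2 * m).-1.+1)%N; last by lia.
    rewrite -(integral_disc_sqmod (2 * m).-1); apply: eq_integral => z _.
    congr EFin; rewrite /G sqmodE.
    have -> : normc (toC z ^+ m) = normc (toC z) ^+ m.
      by elim: (m) => [|k IH]; rewrite ?expr0 ?ComplexField.Normc.normc1// !exprS ComplexField.Normc.normcM IH.
    rewrite -mulrA; congr (_%:R * _); last by rewrite -!exprM -exprD; congr (_ ^+ _); lia.
    by rewrite -exprM mulnC exprM expr_lt1// ?exprn_ge0 ?normc_ge0.
  move=> /(congr1 (fun x => x * (2 / pi)%:E)%E); rewrite -!muleA -!EFinM => H.
  have pi0 : (pi : R) != 0 by rewrite gt_eqF// pi_gt0.
  have m0' : m%:R != 0 :> R by rewrite pnatr_eq0 -lt0n.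
  move: H; rewrite (_ : pi / 2 * (2 / pi) = 1); last by rewrite mulrA divfK ?pnatr_eq0// divff.
  rewrite (_ : pi / (2 * m%:R) * (2 / pi) = m%:R^-1); last by rewrite invfM mulrC mulrA divfK// mulrA divff ?mul1r// pnatr_eq0.
  by rewrite mule1 muleC.
have := key _ mF F0 F00; rewrite k12 -(fineK k1fin) -EFinM.
have f0 : fine k1 != 0 by rewrite gt_eqF// fine_gt0// k10 -ge0_fin_numE// ltW.
move=> /(congr1 (fun x => (fine k1)^-1%:E * x)%E); rewrite !muleA -!EFinM mulVf// mul1e => ->.
by rewrite mulrCA mulVf// mulr1.
Qed.
End plane.

(** * The modulus and roots of unity *)

Section complex_facts.
Context {R : realType}.
Local Notation C := R[i].
Implicit Types (z w : C).

Lemma normcM z w : normc (z * w) = normc z * normc w.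
Proof. exact: ComplexField.Normc.normcM. Qed.

Lemma normc0 : normc (0 : C) = 0. Proof. exact: ComplexField.Normc.normc0. Qed.

Lemma normc1 : normc (1 : C) = 1. Proof. exact: ComplexField.Normc.normc1. Qed.

Lemma normcV z : normc z^-1 = (normc z)^-1.
Proof. exact: ComplexField.Normc.normcV. Qed.

Lemma normcX z n : normc (z ^+ n) = normc z ^+ n.
Proof. by elim: n => [|n IH]; rewrite ?expr0 ?normc1// !exprS normcM IH. Qed.

Lemma normcJ z : normc z^*%C = normc z.
Proof. by case: z => x y /=; rewrite sqrrN. Qed.

Lemma normcN z : normc (- z) = normc z.
Proof. by case: z => x y /=; rewrite !sqrrN. Qed.

Lemma ler_normcD z w : normc (z + w) <= normc z + normc w.
Proof. exact: le_normcD. Qed.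

Lemma normc_distC z w : normc (z - w) = normc (w - z).
Proof. by rewrite -normcN opprB. Qed.

Lemma normcR (x : R) : normc x%:C%C = `|x|.
Proof. by rewrite /= expr0n/= addr0 sqrtr_sqr. Qed.

Lemma sqr_normcE z : (normc z ^+ 2)%:C%C = z * z^*%C.
Proof.
by rewrite normc2E; case: z => x y; simpc => /=; congr Complex; ring.
Qed.

Lemma ler_normc_sum (I : Type) (s : seq I) (F : I -> C) :
  normc (\sum_(i <- s) F i) <= \sum_(i <- s) normc (F i).
Proof.
elim: s => [|i s IH]; first by rewrite !big_nil normc0.
by rewrite !big_cons (le_trans (ler_normcD _ _))// lerD2l.
Qed.

Lemma ler_Re_normc z : `|complex.Re z| <= normc z.
Proof. by case: z => x y /=; rewrite -[leLHS]sqrtr_sqr ler_sqrt ?addr_ge0 ?sqr_ge0// lerDl sqr_ge0. Qed.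

Lemma ler_Im_normc z : `|complex.Im z| <= normc z.
Proof. by case: z => x y /=; rewrite -[leLHS]sqrtr_sqr ler_sqrt ?addr_ge0 ?sqr_ge0// lerDr sqr_ge0. Qed.

Lemma exists_prim_root (N : nat) : (0 < N)%N -> exists w : C, N.-primitive_root w.
Proof.
move=> N0; pose p : {poly C} := 'X^N - 1.
have [rs pE] := closed_field_poly_normal p.
have pm : lead_coef p = 1 by rewrite lead_coefXnsubC.
rewrite pm scale1r in pE.
have N0' : (N%:R : C) != 0 by rewrite pnatr_eq0 -lt0n.
have urs : uniq rs by rewrite -separable_prod_XsubC -pE separable_Xn_sub_1.
have srs : size rs = N.
  have := congr1 (fun q : {poly C} => size q) pE.
  by rewrite size_XnsubC// size_prod_XsubC => -[].
have ars : all N.-unity_root rs.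
  apply/allP => x xrs; rewrite /root_of_unity /root -[_ - _]/p pE.
  by rewrite -/(root _ _) root_prod_XsubC.
have := has_prim_root N0 ars urs; rewrite srs leqnn => /(_ isT) /hasP[w _ pw].
by exists w.
Qed.

Lemma normc_unity_root (N : nat) w : (0 < N)%N -> w ^+ N = 1 -> normc w = 1.
Proof.
move=> N0 /(congr1 (@normc R)); rewrite normcX normc1 => /eqP.
by rewrite pexpr_eq1 ?normc_ge0// => /eqP.
Qed.

Lemma prim_root_sum (N : nat) w (d : nat) : N.-primitive_root w ->
  \sum_(l < N) w ^+ (l * d) = if (N %| d)%N then N%:R else 0.
Proof.
move=> pw; case: ifPn => [Nd|Nd].
  rewrite (eq_bigr (fun=> 1)) ?sumr_const ?card_ord// => l _.
  by apply/eqP; rewrite -(prim_order_dvd pw) dvdn_mull.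
have wd : w ^+ d - 1 != 0 by rewrite subr_eq0 -(prim_order_dvd pw).
apply: (mulfI wd); rewrite mulr0.
under eq_bigr do rewrite mulnC exprM.
by rewrite -subrX1 -exprM mulnC exprM (prim_expr_order pw) expr1n subrr.
Qed.

(** The exponent [N.-1] stands for -1: conjugating a primitive N-th root of unity amounts to raising
    it to the power [N.-1]. *)
Lemma dvdn_ord_conj (N : nat) (j k : 'I_N) : (N %| j + k * N.-1)%N = (j == k).
Proof.
have N0 : (0 < N)%N by case: j => j; lia.
have := @eqn_modDr k (j + k * N.-1) 0 N; rewrite mod0n add0n -/(dvdn N _) => <-.
by rewrite -addnA -mulnSr prednK// addnC modnMDl !modn_small.
Qed.

(** Discrete Parseval identity. It takes the place of Fourier series on circles: finitely many
    rotations already kill the cross terms of a polynomial with [N] coefficients. *)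
Lemma parseval_root (N : nat) w (c : 'I_N -> C) : N.-primitive_root w ->
  \sum_(l < N) normc (\sum_(j < N) c j * w ^+ (l * j)) ^+ 2 = N%:R * \sum_(j < N) normc (c j) ^+ 2.
Proof.
move=> pw; have N0 := prim_order_gt0 pw.
have wJ : w^*%C = w ^+ N.-1.
  have w0 : w != 0.
    apply: contra_eq_neq (prim_expr_order pw) => ->.
    by rewrite expr0n gtn_eqF// eq_sym oner_eq0.
  apply: (mulfI w0); rewrite -exprS prednK// (prim_expr_order pw).
  by rewrite -sqr_normcE (normc_unity_root N0 (prim_expr_order pw)) expr1n.
apply: complexI; rewrite rmorphM !rmorph_sum/= rmorph_nat.
transitivity (\sum_(l < N) \sum_(j < N) \sum_(k < N) c j * (c k)^*%C * w ^+ (l * (j + k * N.-1))).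
  apply: eq_bigr => l _; rewrite sqr_normcE rmorph_sum/= big_distrl/=.
  apply: eq_bigr => j _; rewrite big_distrr/=; apply: eq_bigr => k _.
  rewrite rmorphM rmorphXn/= wJ mulrACA -exprM -exprD; congr (_ * _ ^+ _); lia.
rewrite exchange_big/= mulr_sumr; apply: eq_bigr => j _.
rewrite exchange_big/= (bigD1 j)//= [X in _ + X]big1 ?addr0; last first.
  move=> k kj; rewrite -mulr_sumr (prim_root_sum _ pw) dvdn_ord_conj.
  by rewrite eq_sym (negbTE kj) mulr0.
by rewrite -mulr_sumr (prim_root_sum _ pw) dvdn_ord_conj eqxx sqr_normcE mulrC.
Qed.

End complex_facts.

(** * Averages over rotations, and integrals over G *)

Section parseval.
Context {R : realType}.
Local Notation C := R[i].
Local Notation mu := (@lebesgue_measure R).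
Local Notation mu2 := (mu \x mu)%E.
Implicit Types (F : C -> R).

Lemma ge0_integral_mu2_sum (N : nat) (f : 'I_N -> R * R -> R) :
  (forall l, measurable_fun setT (f l)) -> (forall l z, 0 <= f l z) ->
  (\int[mu2]_z (\sum_(l < N) f l z)%R%:E = \sum_(l < N) \int[mu2]_z (f l z)%:E)%E.
Proof.
move=> mf f0; under eq_integral do rewrite -sumEFin.
rewrite ge0_integral_sum//.
- by move=> l; apply/measurable_EFinP; exact: mf.
- by move=> l z _; rewrite lee_fin.
Qed.

Lemma ge0_integral_mu2Zl (k : R) (f : R * R -> R) : 0 <= k ->
  measurable_fun setT f -> (forall z, 0 <= f z) ->
  (\int[mu2]_z (k * f z)%R%:E = k%:E * \int[mu2]_z (f z)%:E)%E.
Proof.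
move=> k0 mf f0; under eq_integral do rewrite EFinM.
rewrite ge0_integralZl//.
- by apply/measurable_EFinP; exact: mf.
- by move=> z _; rewrite lee_fin.
Qed.

Lemma cmeasurable_comp d (T : measurableType d) (g : C -> C) (h : T -> C) :
  cmeasurable (fun z : R * R => g (toC z)) -> cmeasurable h -> cmeasurable (fun x => g (h x)).
Proof.
move=> [g1 g2] mh; split.
- exact: (@measurable_comp_cmeasurable _ _ _ _ _ (fun z => complex.Re (g z)) _ g1 mh).
- exact: (@measurable_comp_cmeasurable _ _ _ _ _ (fun z => complex.Im (g z)) _ g2 mh).
Qed.

Lemma integral_rotation_average (N : nat) (w : C) F : (0 < N)%N -> w ^+ N = 1 ->
  measurable_fun setT (fun z : R * R => F (toC z)) -> (forall z, 0 <= F z) ->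
  (N%:R%:E * \int[mu2]_z (F (toC z))%:E =
   \int[mu2]_z (\sum_(l < N) F (w ^+ l * toC z))%R%:E)%E.
Proof.
move=> N0 wN mF F0.
have w0 : w != 0 by rewrite -normc_eq0 (normc_unity_root N0 wN) oner_eq0.
have mFl (l : 'I_N) : measurable_fun setT (fun z : R * R => F (w ^+ l * toC z)).
  apply: (measurable_comp_cmeasurable mF).
  exact: cmeasurableM (cmeasurable_cst _) cmeasurable_toC1.
rewrite (ge0_integral_mu2_sum mFl)//.
rewrite (eq_bigr (fun=> \int[mu2]_z (F (toC z))%:E)%E); last first.
  move=> l _; have wl0 : w ^+ l != 0 by rewrite expf_neq0.
  rewrite -[RHS](@integral_caffine R (w ^+ l) 0 (fun z => (F z)%:E) wl0)//; last exact/measurable_EFinP.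
  rewrite normcX (normc_unity_root N0 wN) !expr1n mul1e.
  by apply: eq_integral => z _; rewrite addr0.
by rewrite sumr_const card_ord mule_natl.
Qed.

(** Averaging over N-th roots of unity removes the products of distinct coefficients because all
    exponents are below [N]; the monomials are then integrated one by one. *)
Lemma integral_disc_poly (q : {poly C}) (N : nat) : (size q <= N)%N -> (0 < N)%N ->
  (\int[mu2]_z ((normc (toC z) ^+ 2 < 1)%R%:R * normc q.[toC z] ^+ 2)%:E =
   (\sum_(k < N) normc q`_k ^+ 2 * (pi / k.+1%:R))%R%:E)%E.
Proof.
move=> qN N0; have [w pw] := @exists_prim_root R _ N0.
have wN := prim_expr_order pw.
have mI : measurable_fun setT (fun z : R * R => (normc (toC z) ^+ 2 < 1)%R%:R : R).
  rewrite (_ : (fun _ => _) = \1_(sqmod @^-1` `]-oo, 1%R[)); last first.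
    by apply/funext => z; rewrite indic_sqmod in_itv/= sqmodE.
  apply: (measurable_indic (D:=setT)).
  by rewrite -[X in measurable X]setTI; exact: measurable_sqmod.
pose F (z : C) : R := (normc z ^+ 2 < 1)%R%:R * normc q.[z] ^+ 2.
have mF : measurable_fun setT (fun z : R * R => F (toC z)).
  apply: measurable_funM mI _; apply: cmeasurable_normc.
  exact: cmeasurable_horner cmeasurable_toC1.
have F0 z : 0 <= F z by rewrite mulr_ge0// exprn_ge0// normc_ge0.
have := integral_rotation_average N0 wN mF F0.
have -> : (\int[mu2]_z (\sum_(l < N) F (w ^+ l * toC z))%R%:E =
  \int[mu2]_z (\sum_(k < N) (N%:R * normc q`_k ^+ 2) * ((sqmod z < 1)%R%:R * sqmod z ^+ k))%R%:E)%E.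
  apply: eq_integral => z _; congr EFin; rewrite /F.
  under eq_bigr => l _.
    rewrite normcM normcX (normc_unity_root N0 wN) expr1n mul1r.
    rewrite (horner_coef_wide _ qN).
    under eq_bigr do rewrite exprMn -exprM mulrCA mulrC.
    over.
  rewrite -mulr_sumr parseval_root// mulrCA mulr_sumr mulr_sumr; apply: eq_bigr => k _.
  by rewrite sqmodE normcM normcX exprMn -!exprM [(k * 2)%N]mulnC; ring.
have mk (k : 'I_N) : measurable_fun setT (fun z : R * R => (sqmod z < 1)%R%:R * sqmod z ^+ k : R).
  apply: measurable_funM; last by apply: measurable_funX; exact: measurable_sqmod.
  by rewrite (_ : (fun _ => _) = (fun z : R * R => (normc (toC z) ^+ 2 < 1)%R%:R : R))//; apply/funext => z; rewrite sqmodE.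
have sk (k : 'I_N) (z : R * R) : 0 <= (sqmod z < 1)%R%:R * sqmod z ^+ k :> R.
  by rewrite mulr_ge0// exprn_ge0// sqmodE exprn_ge0// normc_ge0.
rewrite (@ge0_integral_mu2_sum N (fun k z => N%:R * normc q`_k ^+ 2 * ((sqmod z < 1)%R%:R * sqmod z ^+ k))); last 2 first.
- by move=> k; apply: measurable_funM (measurable_cst _) (mk k).
- by move=> k z; rewrite mulr_ge0// mulr_ge0// exprn_ge0// normc_ge0.
rewrite (eq_bigr (fun k : 'I_N => (N%:R * (normc q`_k ^+ 2 * (pi / k.+1%:R)))%R%:E)); last first.
  move=> k _; rewrite (ge0_integral_mu2Zl _ (mk k))//; last by rewrite mulr_ge0// exprn_ge0// normc_ge0.
  by rewrite integral_disc_sqmod -EFinM mulrA.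
rewrite sumEFin -mulr_sumr => /(congr1 (fun x => (N%:R^-1)%:E * x)%E).
have N0' : N%:R != 0 :> R by rewrite pnatr_eq0 -lt0n.
by rewrite muleA -!EFinM mulVf// mul1e mulrA mulVf// mul1r.
Qed.

Definition lemI (r : R) (m : nat) (z : C) : R := (normc (z ^+ m - 1) < r ^+ m)%R%:R.

Lemma lemI_ge0 r m z : 0 <= lemI r m z. Proof. by rewrite ler0n. Qed.

Lemma measurable_lemG r m : measurable (lemG r m : set (R * R)).
Proof.
rewrite /lemG -[X in measurable X]setTI.
have mf : measurable_fun setT (fun z : R * R => normc (toC z ^+ m - 1)).
  rewrite (_ : (fun _ => _) = Num.sqrt \o (fun z : R * R => normc (toC z ^+ m - 1) ^+ 2)); last first.
    by apply/funext => z /=; rewrite sqrtr_sqr ger0_norm// normc_ge0.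
  apply: measurableT_comp; last apply: cmeasurable_normc.
    by apply: continuous_measurable_fun; exact: sqrt_continuous.
  exact: cmeasurableD (cmeasurableX m cmeasurable_toC1) (cmeasurable_cst _).
have := mf measurableT _ (measurable_itv `]-oo, (r ^+ m)%R[).
by congr (measurable (_ `&` _)); apply/seteqP; split => z /=; rewrite in_itv.
Qed.

Lemma measurable_lemI r m : measurable_fun setT (fun z : R * R => lemI r m (toC z)).
Proof.
rewrite (_ : (fun _ => _) = \1_(lemG r m)).
  by apply: (measurable_indic (D := setT)); exact: measurable_lemG.
apply/funext => z; rewrite indicE /lemI; congr ((nat_of_bool _)%:R).
by apply/idP/idP; rewrite inE.
Qed.

Lemma integral_lemG r m (f : R * R -> R) :
  (\int[mu2]_(z in lemG r m) (f z)%:E = \int[mu2]_z (lemI r m (toC z) * f z)%R%:E)%E.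
Proof.
rewrite integral_mkcond; apply: eq_integral => z _; rewrite patchE /lemI.
rewrite (_ : (z \in lemG r m) = (normc (toC z ^+ m - 1) < r ^+ m)).
  by case: ifP; rewrite ?mul1r ?mul0r.
by apply/idP/idP; rewrite inE.
Qed.


Lemma integral_lemG_conformal r m (q : {poly C}) (N : nat) : 0 < r < 1 -> (1 < m)%N ->
  (size q <= N)%N -> (0 < N)%N ->
  (\int[mu2]_(z in lemG r m) (normc (toC z) ^+ (2 * m - 2) *
     normc q.[(toC z ^+ m - 1) / (r ^+ m)%:C%C] ^+ 2)%R%:E =
   (r ^+ (2 * m) / m%:R * \sum_(k < N) normc q`_k ^+ 2 * (pi / k.+1%:R))%R%:E)%E.
Proof.
move=> /andP[r0 r1] m1 qN N0; rewrite integral_lemG.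
have rm0 : 0 < r ^+ m by rewrite exprn_gt0.
pose rho : C := (r ^+ m)%:C%C.
have rho0 : rho != 0 by rewrite eq_complex /= negb_and gt_eqF.
have nrho : normc rho = r ^+ m by rewrite normcR gtr0_norm.
pose F (z : C) : R := (normc (z - 1) < r ^+ m)%R%:R * normc q.[(z - 1) / rho] ^+ 2.
have FE z : lemI r m z * (normc z ^+ (2 * m - 2) * normc q.[(z ^+ m - 1) / rho] ^+ 2) =
    F (z ^+ m) * normc z ^+ (2 * m - 2) by rewrite /F /lemI; ring.
under eq_integral do rewrite FE.
have mF : measurable_fun setT (fun z : R * R => F (toC z)).
  apply: measurable_funM.
    have := measurable_lemI (r ^+ m) 1.
    by rewrite (_ : (fun _ => _) = (fun z : R * R => (normc (toC z - 1) < r ^+ m)%R%:R : R)).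
  apply: cmeasurable_normc; apply: cmeasurable_horner.
  apply: cmeasurableM (cmeasurable_cst _).
  exact: cmeasurableD cmeasurable_toC1 (cmeasurable_cst _).
have F0 z : 0 <= F z by rewrite mulr_ge0// exprn_ge0// normc_ge0.
(* As [r ^+ m <= 1], the origin is outside the disc |z - 1| < r^m. *)
have F00 : F 0 = 0.
  by rewrite /F sub0r normcN normc1 ltNge exprn_ile1 ?ltW//= mul0r.
rewrite (integral_pow m1 mF F0 F00).
rewrite -(@integral_caffine R rho 1 (fun z => (F z)%:E))//; last exact/measurable_EFinP.
rewrite (_ : (\int[mu2]_z _)%E = (\sum_(k < N) normc q`_k ^+ 2 * (pi / k.+1%:R))%R%:E); last first.
  rewrite -(integral_disc_poly qN N0); apply: eq_integral => z _; congr EFin.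
  rewrite /F addrK normcM nrho [_ * _ / _]mulrC mulKf//; congr (_%:R * _).
  rewrite -[X in _ < X]mulr1 ltr_pM2l//; apply/esym.
  by rewrite expr_lt1// normc_ge0.
by rewrite -!EFinM nrho; congr EFin; rewrite -exprM mulnC; ring.
Qed.

Lemma integral_lemG_residues r m (g : 'I_m -> C -> C) : (0 < m)%N ->
  (forall j, cmeasurable (fun z : R * R => g j (toC z))) ->
  (\int[mu2]_(z in lemG r m) (normc (\sum_(j < m) toC z ^+ j * g j (toC z ^+ m)) ^+ 2)%:E =
   \int[mu2]_(z in lemG r m) (\sum_(j < m) normc (toC z) ^+ (2 * j) * normc (g j (toC z ^+ m)) ^+ 2)%R%:E)%E.
Proof.
move=> m0 mg; rewrite !integral_lemG.
have [w pw] := @exists_prim_root R _ m0; have wm := prim_expr_order pw.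
pose F (z : C) : R := lemI r m z * normc (\sum_(j < m) z ^+ j * g j (z ^+ m)) ^+ 2.
have mF : measurable_fun setT (fun z : R * R => F (toC z)).
  apply: measurable_funM; first exact: measurable_lemI.
  apply: cmeasurable_normc; apply: cmeasurable_sum => j.
  apply: cmeasurableM; first exact: cmeasurableX cmeasurable_toC1.
  have mX := cmeasurableX m (@cmeasurable_toC1 R).
  exact: cmeasurable_comp (mg j) mX.
have F0 z : 0 <= F z by rewrite mulr_ge0 ?lemI_ge0// exprn_ge0// normc_ge0.
have := integral_rotation_average m0 wm mF F0.
pose G (z : C) : R := lemI r m z * \sum_(j < m) normc z ^+ (2 * j) * normc (g j (z ^+ m)) ^+ 2.
have mG : measurable_fun setT (fun z : R * R => G (toC z)).
  apply: measurable_funM; first exact: measurable_lemI.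
  apply: measurable_sum => j.
  apply: measurable_funM.
    by under eq_fun do rewrite exprM; apply: measurable_funX; exact: cmeasurable_normc cmeasurable_toC1.
  apply: cmeasurable_normc.
  have mX := cmeasurableX m (@cmeasurable_toC1 R).
  exact: cmeasurable_comp (mg j) mX.
have G0 z : 0 <= G z.
  by rewrite mulr_ge0 ?lemI_ge0// sumr_ge0// => j _; rewrite mulr_ge0// exprn_ge0// normc_ge0.
have -> : (\int[mu2]_z (\sum_(l < m) F (w ^+ l * toC z))%R%:E = \int[mu2]_z (m%:R * G (toC z))%R%:E)%E.
  apply: eq_integral => z _; congr EFin; rewrite /F.
  have wlm (l : 'I_m) : (w ^+ l * toC z) ^+ m = toC z ^+ m.
    by rewrite exprMn -exprM mulnC exprM wm expr1n mul1r.
  under eq_bigr => l _.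
    rewrite {1}/lemI wlm.
    under eq_bigr do rewrite exprMn -exprM -mulrA mulrC.
    over.
  rewrite -mulr_sumr parseval_root// mulrCA; congr (_ * (_ * _)); apply: eq_bigr => j _.
  by rewrite normcM normcX exprMn -exprM mulnC.
rewrite (ge0_integral_mu2Zl _ mG)//.
have m0' : m%:R != 0 :> R by rewrite pnatr_eq0 -lt0n.
move=> /(congr1 (fun x => (m%:R^-1)%:E * x)%E).
by rewrite !muleA -!EFinM mulVf// !mul1e.
Qed.

End parseval.

(** * Integrals of complex-valued functions *)

Section cintegral.
Context d (T : measurableType d) {R : realType}.
Variables (mu : {measure set T -> \bar R}) (D : set T) (mD : measurable D).
Local Notation C := R[i].

Definition cintegrable (W : T -> C) :=
  mu.-integrable D (EFin \o (fun z => complex.Re (W z))) /\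
  mu.-integrable D (EFin \o (fun z => complex.Im (W z))).

Definition cintegral (W : T -> C) : C :=
  Complex (\int[mu]_(z in D) complex.Re (W z)) (\int[mu]_(z in D) complex.Im (W z)).

Let iD f g : mu.-integrable D (EFin \o f) -> mu.-integrable D (EFin \o g) ->
  mu.-integrable D (EFin \o (fun z => f z + g z)).
Proof. by move=> fi gi; have := integrableD mD fi gi. Qed.

Let iB f g : mu.-integrable D (EFin \o f) -> mu.-integrable D (EFin \o g) ->
  mu.-integrable D (EFin \o (fun z => f z - g z)).
Proof. by move=> fi gi; have := integrableB mD fi gi. Qed.

Let iZ (k : R) f : mu.-integrable D (EFin \o f) ->
  mu.-integrable D (EFin \o (fun z => k * f z)).
Proof. by move=> fi; have := integrableZl mD k fi. Qed.

Lemma cintegrableD V W : cintegrable V -> cintegrable W ->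
  cintegrable (fun z => V z + W z) /\
  cintegral (fun z => V z + W z) = cintegral V + cintegral W.
Proof.
move=> [V1 V2] [W1 W2].
have ReE : (fun z => complex.Re (V z + W z)) = (fun z => complex.Re (V z) + complex.Re (W z)).
  by apply/funext => z; case: (V z) => ? ?; case: (W z).
have ImE : (fun z => complex.Im (V z + W z)) = (fun z => complex.Im (V z) + complex.Im (W z)).
  by apply/funext => z; case: (V z) => ? ?; case: (W z).
split; first by split; rewrite ?ReE ?ImE; exact: iD.
by rewrite /cintegral ReE ImE !RintegralD.
Qed.

Lemma cintegrableZ c W : cintegrable W ->
  cintegrable (fun z => c * W z) /\ cintegral (fun z => c * W z) = c * cintegral W.
Proof.
case: c => x y [W1 W2].
have ReE : (fun z => complex.Re ((x +i* y)%C * W z)) =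
    (fun z => x * complex.Re (W z) - y * complex.Im (W z)).
  by apply/funext => z; case: (W z).
have ImE : (fun z => complex.Im ((x +i* y)%C * W z)) =
    (fun z => x * complex.Im (W z) + y * complex.Re (W z)).
  by apply/funext => z; case: (W z).
split.
  by split; rewrite ?ReE ?ImE; [apply: iB; exact: iZ|apply: iD; exact: iZ].
rewrite /cintegral ReE ImE RintegralB ?RintegralD//; [|exact: iZ..].
by rewrite !RintegralZl.
Qed.

Lemma cintegrable_sum (I : Type) (s : seq I) (W : I -> T -> C) :
  (forall i, cintegrable (W i)) ->
  cintegrable (fun z => \sum_(i <- s) W i z) /\
  cintegral (fun z => \sum_(i <- s) W i z) = \sum_(i <- s) cintegral (W i).
Proof.
move=> Wi; elim: s => [|i s [IH1 IH2]].
  have -> : (fun z => \sum_(i <- [::]) W i z) = (fun=> 0 : C).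
    by apply/funext => z; rewrite big_nil.
  rewrite big_nil; split; first by split; exact: integrable0.
  by rewrite /cintegral /Rintegral/= integral0.
have -> : (fun z => \sum_(i <- i :: s) W i z) = (fun z => W i z + \sum_(i <- s) W i z).
  by apply/funext => z; rewrite big_cons.
by rewrite big_cons -IH2; exact: cintegrableD.
Qed.

End cintegral.

(** * Norms in the orthonormal basis *)

Section onp.
Context {R : realType}.
Local Notation C := R[i].
Local Notation mu := (@lebesgue_measure R).
Local Notation mu2 := (mu \x mu)%E.
Variables (r : R) (m : nat).
Hypotheses (r01 : 0 < r < 1) (m1 : (1 < m)%N).

Lemma lemG_bounded (z : R * R) : lemG r m z -> normc (toC z) <= 2.
Proof.
move=> zG; rewrite leNgt; apply/negP => z2.
have : normc (toC z ^+ m) < 2.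
  rewrite -[toC z ^+ m](subrK 1) (le_lt_trans (ler_normcD _ _))// normc1.
  rewrite -[ltRHS]/(1 + 1) ltrD2r; apply: lt_le_trans zG _.
  by move/andP: r01 => [/ltW ? /ltW ?]; rewrite exprn_ile1.
have z1 : 1 <= normc (toC z) by rewrite ltW// (lt_trans _ z2)// ltr1n.
apply/negP; rewrite -leNgt normcX (le_trans (ltW z2))// -[leLHS]expr1.
by apply: ler_weXn2l => //; exact: ltnW.
Qed.

Lemma normc_horner_le (p : {poly C}) z : normc z <= 2 ->
  normc p.[z] <= \sum_(i < size p) normc p`_i * 2 ^+ i.
Proof.
move=> z2; rewrite horner_coef (le_trans (ler_normc_sum _ _))// ler_sum// => i _.
by rewrite normcM normcX ler_wpM2l ?normc_ge0// lerXn2r ?nnegrE ?normc_ge0.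
Qed.

Lemma mu2_lemG_fin : (mu2 (lemG r m) < +oo)%E.
Proof.
apply: (@le_lt_trans _ _ (mu2 (sqmod @^-1` `]-oo, 4%R]))); last first.
  by rewrite mu2_sqmod_le// varpiE -EFinM ltry.
apply: le_measure; rewrite ?inE.
- exact: measurable_lemG.
- exact: measurable_sqmod_le.
- move=> z zG /=; rewrite in_itv/= sqmodE.
  have := lemG_bounded zG; have := @normc_ge0 R (toC z); nra.
Qed.

Lemma integrable_lemG (f : R * R -> R) (M : R) : measurable_fun setT f ->
  (forall z, lemG r m z -> `|f z| <= M) -> mu2.-integrable (lemG r m) (EFin \o f).
Proof.
move=> mf fM; apply: measurable_bounded_integrable => //.
- exact: measurable_lemG.
- exact: mu2_lemG_fin.
- exact: measurable_funTS.
- exists M; split; first exact: num_real.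
  by move=> x Mx z zG /=; rewrite (le_trans (fM z zG))// ltW.
Qed.


Local Notation G := (lemG r m).

Let mG : measurable (G : set (measurableTypeR R * measurableTypeR R)). Proof. exact: measurable_lemG. Qed.

Lemma cintegrable_poly (p q : {poly C}) :
  cintegrable mu2 G (fun z => p.[toC z] * (q.[toC z])^*%C).
Proof.
have mW : cmeasurable (fun z : R * R => p.[toC z] * (q.[toC z])^*%C).
  apply: cmeasurableM; first exact: cmeasurable_horner cmeasurable_toC1.
  by apply: cmeasurable_conj; exact: cmeasurable_horner cmeasurable_toC1.
have bW z : G z -> normc (p.[toC z] * (q.[toC z])^*%C) <=
    (\sum_(i < size p) normc p`_i * 2 ^+ i) * (\sum_(i < size q) normc q`_i * 2 ^+ i).
  by move=> /lemG_bounded zb; rewrite normcM normcJ ler_pM ?normc_ge0// normc_horner_le.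
split.
- apply: integrable_lemG; first exact: mW.1.
  by move=> z /bW; apply: le_trans; exact: ler_Re_normc.
- apply: integrable_lemG; first exact: mW.2.
  by move=> z /bW; apply: le_trans; exact: ler_Im_normc.
Qed.

Lemma ONP_norm (phi : nat -> {poly C}) (N : nat) (c : 'I_N -> C) : is_ONP r m phi ->
  (\int[mu2]_(z in G) (normc (\sum_(k < N) c k * (phi k).[toC z]) ^+ 2)%:E =
   (\sum_(k < N) normc (c k) ^+ 2)%R%:E)%E.
Proof.
move=> [_ onp].
have E j k : cintegral mu2 G (fun z => (phi j).[toC z] * ((phi k).[toC z])^*%C) = (j == k)%:R.
  have [e1 e2] := onp j k.
  transitivity (Complex (fine (ip_re r m (phi j) (phi k))) (fine (ip_im r m (phi j) (phi k)))) => //.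
  rewrite e1 e2/=.
  by case: (j == k).
(* The squared modulus as a Hermitian double sum, to which orthonormality applies term by term. *)
pose W z := \sum_(j < N) \sum_(k < N) (c j * (c k)^*%C) * ((phi j).[toC z] * ((phi k).[toC z])^*%C).
have WE z : W z = (normc (\sum_(k < N) c k * (phi k).[toC z]) ^+ 2)%:C%C.
  rewrite sqr_normcE rmorph_sum/= big_distrl/=; apply: eq_bigr => j _.
  rewrite big_distrr/=; apply: eq_bigr => k _.
  by rewrite rmorphM/= mulrACA.
have iZ (j k : 'I_N) := cintegrableZ mG (c j * (c k)^*%C) (cintegrable_poly (phi j) (phi k)).
have iS (j : 'I_N) := cintegrable_sum mG (index_enum _) (fun k => (iZ j k).1).
have [[W1 _] W2] := cintegrable_sum mG (index_enum _) (fun j => (iS j).1).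
have : cintegral mu2 G W = (\sum_(k < N) normc (c k) ^+ 2)%:C%C.
  rewrite W2 rmorph_sum/=; apply: eq_bigr => j _.
  rewrite (iS j).2 (bigD1 j)//= big1 ?addr0.
    by rewrite (iZ j j).2 E eqxx mulr1 sqr_normcE.
  by move=> k; rewrite -val_eqE /= => kj; rewrite (iZ j k).2 E eq_sym (negbTE kj) mulr0.
move=> /(congr1 (@complex.Re R)) /= <-.
rewrite /Rintegral fineK; last exact: integrable_fin_num W1.
by apply: eq_integral => z _; rewrite WE.
Qed.

End onp.

(** * The complex exponential to second order *)

Section cexp.
Context {R : realType}.
Local Notation C := R[i].

Lemma cexp0 : cexp (0 : C) = 1.
Proof. by rewrite /cexp/= expR0 cos0 sin0 mul1r. Qed.

Lemma cexpD (s t : C) : cexp (s + t) = cexp s * cexp t.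
Proof.
case: s t => [a b] [c d]; rewrite /cexp /= expRD cosD sinD; simpc.
by congr Complex; ring.
Qed.

Lemma cexp_nat (t : C) (k : nat) : cexp (k%:R * t) = cexp t ^+ k.
Proof.
elim: k => [|k IH]; first by rewrite mul0r cexp0 expr0.
by rewrite -natr1 mulrDl mul1r cexpD IH exprSr.
Qed.

Lemma normc_cexp (t : C) : normc (cexp t) = expR (complex.Re t).
Proof.
rewrite /cexp normcM normcR ger0_norm ?expR_ge0//.
by rewrite [X in _ * X](_ : _ = 1) ?mulr1//= cos2Dsin2 sqrtr1.
Qed.

Lemma normc_cexp_le (t : C) : normc (cexp t) <= expR (normc t).
Proof. by rewrite normc_cexp ler_expR (le_trans (ler_norm _))// ler_Re_normc. Qed.

Lemma normr_sin_le (y : R) : `|sin y| <= `|y|.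
Proof.
wlog y0 : y / 0 <= y.
  move=> H; have [y0|y0] := leP 0 y; first exact: H.
  by have := H (- y); rewrite sinN !normrN; apply; rewrite oppr_ge0 ltW.
move: y0; rewrite le_eqVlt => /predU1P[<-|y0]; first by rewrite sin0 normr0.
have [c _ H] : exists2 c, c \in `]0, y[%R & sin y - sin 0 = cos c * (y - 0).
  apply: (@MVT _ sin cos) => //.
  by apply: continuous_subspaceT => x; exact: continuous_sin.
rewrite sin0 !subr0 in H; rewrite H normrM ler_piMl// ler_norml.
by rewrite cos_geN1 cos_le1.
Qed.

Lemma cos_ge_sqr (y : R) : `|cos y - 1| <= y ^+ 2.
Proof.
have -> : cos y - 1 = - (2 * sin (y / 2) ^+ 2).
  have {1}-> : y = (y / 2) *+ 2 by rewrite -mulr_natr divfK.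
  have H : cos (y / 2) ^+ 2 = 1 - sin (y / 2) ^+ 2 by have := cos2Dsin2 (y / 2); lra.
  by rewrite cos_mulr2n H; ring.
have := normr_sin_le (y / 2); rewrite -(ler_pXn2r (n := 2)) ?nnegrE// !real_normK ?num_real//.
rewrite normrN ger0_norm; last by rewrite mulr_ge0// sqr_ge0.
by rewrite exprMn; have := sqr_ge0 y; lra.
Qed.

Lemma sin_sub_sqr (y : R) : `|y| <= 1 -> `|sin y - y| <= y ^+ 2.
Proof.
wlog y0 : y / 0 <= y.
  move=> H; have [y0|y0] := leP 0 y; first exact: H.
  have := H (- y); rewrite sinN -opprD !normrN sqrrN; apply.
  by rewrite oppr_ge0 ltW.
move: y0; rewrite le_eqVlt => /predU1P[<-|y0 y1]; first by rewrite sin0 subr0 normr0 expr0n.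
have [c cy H] : exists2 c, c \in `]0, y[%R & sin y - sin 0 = cos c * (y - 0).
  apply: (@MVT _ sin cos) => //.
  by apply: continuous_subspaceT => x; exact: continuous_sin.
rewrite sin0 !subr0 in H; rewrite H -{2}(mul1r y) -mulrBl normrM.
move: cy; rewrite in_itv/= => /andP[c0 cy].
have cc := cos_ge_sqr c; have n0 := normr_ge0 (cos c - 1).
rewrite gtr0_norm// in y1; rewrite (gtr0_norm y0) expr2 ler_pM2r//.
by rewrite (le_trans cc)// expr2; nra.
Qed.

Lemma expR_sub_sqr (x : R) : `|x| <= 1 / 2 -> 0 <= expR x - 1 - x <= 2 * x ^+ 2.
Proof.
move=> x1; have := expR_ge1Dx x; have := expR_ge1Dx (- x); rewrite expRN => h1 h2.
have x2 : -(1/2) <= x <= 1/2 by rewrite -ler_norml.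
have e0 := expR_gt0 x.
apply/andP; split; first lra.
have : expR x * (1 - x) <= 1.
  by rewrite -ler_pdivlMl// mulr1.
move: (expR x) e0 {h1 h2} => e e0 h.
nra.
Qed.

Lemma normc_le_ReIm (t : C) : normc t <= `|complex.Re t| + `|complex.Im t|.
Proof.
have h0 : 0 <= `|complex.Re t| + `|complex.Im t| by rewrite addr_ge0.
rewrite -(ler_pXn2r (n := 2)) ?nnegrE ?normc_ge0// normc2E sqrrD !real_normK ?num_real//.
by rewrite -addrA lerD2l lerDr mulrn_wge0// mulr_ge0.
Qed.

(** The constant 4 is 2 + 2: the real and imaginary parts of the remainder are each at most 2
    |t|^2. *)
Lemma cexp_sub_sqr (t : C) : normc t <= 1 / 2 ->
  normc (cexp t - 1 - t) <= 4 * normc t ^+ 2.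
Proof.
move=> t1; have tR := ler_Re_normc t; have tI := ler_Im_normc t.
rewrite normc2E; apply: le_trans (normc_le_ReIm _) _.
case: t t1 tR tI => x y; rewrite /cexp /=; set n := Num.sqrt _ => n1 tR tI.
have xh : `|x| <= 1 / 2 by exact: le_trans tR n1.
have yh : `|y| <= 1 / 2 by exact: le_trans tI n1.
have /andP[e1 e2] := expR_sub_sqr xh.
have s1 := normr_sin_le y; have s2 : `|sin y - y| <= y ^+ 2 by apply: sin_sub_sqr; lra.
have c1 := cos_ge_sqr y; have e0 := expR_gt0 x.
rewrite !mul0r subr0 addr0.
move: (expR x) (sin y) (cos y) e1 e2 e0 s1 s2 c1 => e s c e1 e2 e0 s1 s2 c1.
have x2 : -(1/2) <= x <= 1/2 by rewrite -ler_norml.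
have e3 : e <= 2 by nra.
have hR : `|e * c - 1 - x| <= 2 * x ^+ 2 + 2 * y ^+ 2.
  have -> : e * c - 1 - x = (e - 1 - x) + e * (c - 1) by ring.
  rewrite (le_trans (ler_normD _ _))// lerD//; first by rewrite ger0_norm.
  by rewrite normrM gtr0_norm// ler_pM// ltW.
have hI : `|e * s - 0 - y| <= 2 * x ^+ 2 + 2 * y ^+ 2.
  have -> : e * s - 0 - y = (e - 1) * s + (s - y) by ring.
  rewrite (le_trans (ler_normD _ _))//.
  have : `|(e - 1) * s| <= (2 * `|x|) * `|y|.
    rewrite normrM ler_pM//.
    have -> : e - 1 = (e - 1 - x) + x by ring.
    rewrite (le_trans (ler_normD _ _))// (ger0_norm e1) mulr2n mulrDl mul1r lerD2r.
    rewrite (le_trans e2)// -real_normK ?num_real//.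
    by have := normr_ge0 x; move: `|x| xh => k; nra.
  rewrite -(real_normK (num_real x)) -(real_normK (num_real y)).
  rewrite -(real_normK (num_real y)) in s2.
  by have := sqr_ge0 (`|x| - `|y|); nra.
lra.
Qed.

End cexp.

(** * The rescaled limit of the sum of (k + 1) x^k *)

Section SN.
Context {R : realType}.
Local Notation C := R[i].

(** At x = u conj(v) this is, up to a constant factor, the polynomial Bergman kernel of the unit
    disc. *)
Definition SN (N : nat) (x : C) : C := \sum_(k < N) k.+1%:R * x ^+ k.

Lemma normcMn_nat (n : nat) : normc (n%:R : C) = n%:R.
Proof. by rewrite -(rmorph_nat (real_complex R)) normcR normr_nat. Qed.

Lemma expn1D_le_expR (N k : nat) (a : R) : 0 <= a -> (k <= N)%N -> (0 < N)%N ->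
  (1 + a / N%:R) ^+ k <= expR a.
Proof.
move=> a0 kN N0; have h : 1 <= 1 + a / N%:R by rewrite lerDl divr_ge0.
apply: (@le_trans _ _ ((1 + a / N%:R) ^+ N)); first by rewrite ler_weXn2l.
have -> : expR a = expR (a / N%:R) ^+ N.
  by rewrite -expRM_natl mulrC divfK// pnatr_eq0 -lt0n.
by rewrite lerXn2r ?nnegrE ?expR_ge0 ?(le_trans ler01)// expR_ge1Dx.
Qed.

Lemma normc_subXX (x y : C) (E : R) (k : nat) :
  (forall i, (i <= k)%N -> normc x ^+ i <= E) -> (forall i, (i <= k)%N -> normc y ^+ i <= E) ->
  normc (x ^+ k - y ^+ k) <= k%:R * E ^+ 2 * normc (x - y).
Proof.
move=> hx hy; rewrite subrXX normcM mulrC ler_wpM2r ?normc_ge0//.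
rewrite (le_trans (ler_normc_sum _ _))//.
rewrite (@le_trans _ _ (\sum_(i < k) E ^+ 2))//; last first.
  by rewrite sumr_const card_ord -[leLHS]mulr_natl.
apply: ler_sum => i _; rewrite normcM !normcX expr2 ler_pM ?exprn_ge0 ?normc_ge0//.
- by apply: hx; lia.
- by apply: hy; exact: ltnW.
Qed.


(** With t = A/N, the summand (k + 1) exp(kt) is compared with the increment over [k, k + 1] of F,
    where F(k) is the integral of s exp(st) over [0, k]. In closed form F(N) = N^2 H(A)/2, and each
    increment differs from its summand by a bounded amount. *)
Lemma SN_cexp (N : nat) (M : R) (A : C) : (0 < N)%N -> 0 <= M -> 2 * M <= N%:R -> normc A <= M ->
  normc (SN N (cexp (A / N%:R)) - N%:R ^+ 2 * (Hfun A / 2)) <= N%:R * (expR M * (12 + 4 * M)).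
Proof.
move=> N0 M0 MN AM.
have NR : 0 < N%:R :> R by rewrite ltr0n.
have NC : N%:R != 0 :> C by rewrite pnatr_eq0 -lt0n.
rewrite /SN /Hfun; have [->|A0] := eqVneq A 0.
  rewrite mul0r cexp0.
  have -> : \sum_(k < N) k.+1%:R * 1 ^+ k - N%:R ^+ 2 * (1 / 2) = N%:R / 2 :> C.
    have -> : \sum_(k < N) k.+1%:R * 1 ^+ k = N%:R * (N%:R + 1) / 2 :> C.
      elim: (N) => [|n IH]; first by rewrite big_ord0 !mul0r.
      by rewrite big_ord_recr/= IH expr1n -!natr1; field.
    by field.
  rewrite normcM normcV !normcMn_nat ler_pM2l//.
  by have := expR_ge1Dx M; nra.
pose t : C := A / N%:R.
have t0 : t != 0 by rewrite mulf_neq0// invr_eq0.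
have tN : normc t = normc A / N%:R by rewrite normcM normcV normcMn_nat.
have t1 : normc t <= 1 / 2 by rewrite tN ler_pdivrMr//; lra.
have kt (k : nat) : (k <= N)%N -> k%:R * normc t <= M.
  move=> kN; rewrite tN mulrA ler_pdivrMr// mulrC; apply: ler_pM; rewrite ?normc_ge0 ?ler0n//.
  by rewrite ler_nat.
pose F (k : nat) : C := (cexp t ^+ k * (k%:R * t - 1) + 1) / t ^+ 2.
have FN : F N - F 0%N = N%:R ^+ 2 * (2 * (cexp A * (A - 1) + 1) / A ^+ 2 / 2).
  rewrite /F expr0 mul0r sub0r mulrN1 addNr mul0r subr0 -cexp_nat /t mulrC.
  by rewrite [A / N%:R]mulrC mulVKf//; field; rewrite A0 NC.
rewrite -FN -(telescope_sumr F (leq0n N)) big_mkord -sumrB.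
rewrite (le_trans (ler_normc_sum _ _))//.
rewrite (@le_trans _ _ (\sum_(k < N) (expR M * (12 + 4 * M))))//; last first.
  by rewrite sumr_const card_ord -[leLHS]mulr_natl.
apply: ler_sum => k _.
pose d := cexp t - 1 - t.
have dE : normc d <= 4 * normc t ^+ 2 by exact: cexp_sub_sqr.
(* With exp(t) = 1 + t + d the error terms d/t, d/t^2 and k d/t are at most 2, 4 and 4M; 2M <= N
   gave |t| <= 1/2. *)
have -> : k.+1%:R * cexp t ^+ k - (F k.+1 - F k) =
    cexp t ^+ k * (1 - (d / t + 1 - d / t ^+ 2) - k%:R * (d / t)).
  rewrite /F exprS -natr1.
  have -> : cexp t = d + 1 + t by rewrite /d; ring.
  by field.
have tp : 0 < normc t by rewrite lt_def normc_eq0 t0 normc_ge0.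
rewrite normcM -cexp_nat; apply: ler_pM; rewrite ?normc_ge0//.
  rewrite (le_trans (normc_cexp_le _))// ler_expR normcM normcMn_nat kt//.
  exact: ltnW.
have dt : normc (d / t) <= 4 * normc t.
  by rewrite normcM normcV ler_pdivrMr// -mulrA -expr2.
have dt2 : normc (d / t ^+ 2) <= 4.
  by rewrite normcM normcV normcX ler_pdivrMr// exprn_gt0.
have kd : normc (k%:R * (d / t)) <= 4 * M.
  rewrite normcM normcMn_nat (le_trans (ler_wpM2l (ler0n _ _) dt))// mulrCA ler_pM2l//.
  by apply: kt; exact: ltnW.
have -> : 1 - (d / t + 1 - d / t ^+ 2) - k%:R * (d / t) = - (d / t) + d / t ^+ 2 - k%:R * (d / t) by ring.
rewrite (le_trans (ler_normcD _ _))// normcN lerD//.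
rewrite (le_trans (ler_normcD _ _))// normcN; lra.
Qed.


(** The points of interest only satisfy N (x - 1) = A + o(1). Powers up to N of x and of exp(A/N)
    stay below exp(M + 1), so exchanging the two costs N^2 exp(2M + 2) eta up to lower order. *)
Lemma SN_asymp (M eps : R) : 0 <= M -> 0 < eps ->
  exists eta : R, exists N0 : nat, 0 < eta /\ forall N : nat, (N0 <= N)%N ->
  forall A x : C, normc A <= M -> normc (N%:R * (x - 1) - A) <= eta ->
  normc (SN N x - N%:R ^+ 2 * (Hfun A / 2)) <= eps * N%:R ^+ 2.
Proof.
move=> M0 e0.
pose E := expR (M + 1); have E0 : 0 < E by exact: expR_gt0.
pose Q := expR M * (12 + 4 * M).
pose eta := Num.min 1 (eps / 2 / E ^+ 2).
have eta0 : 0 < eta by rewrite lt_min ltr01/= !divr_gt0// exprn_gt0.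
have etaE : E ^+ 2 * eta <= eps / 2.
  by rewrite mulrC -ler_pdivlMr ?exprn_gt0// ge_min lexx orbT.
have eta1 : eta <= 1 by rewrite ge_min lexx.
(* This threshold ensures 2M <= N for [SN_cexp] and makes the errors linear in [N] at most
   [eps / 2 * N ^+ 2]. *)
exists eta, (Num.truncn (2 * M + 2 * (4 * E ^+ 2 * M ^+ 2 + Q) / eps)).+1; split => // N NN A x AM xA.
have Q0 : 0 <= Q by rewrite mulr_ge0 ?expR_ge0//; lra.
have B0 : 0 <= 4 * E ^+ 2 * M ^+ 2 + Q.
  by rewrite addr_ge0// mulr_ge0 ?sqr_ge0// mulr_ge0// sqr_ge0.
have NM : 2 * M + 2 * (4 * E ^+ 2 * M ^+ 2 + Q) / eps <= N%:R.
  rewrite ltW// (lt_le_trans (truncnS_gt _))// ler_nat//.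
have b0 : 0 <= 2 * (4 * E ^+ 2 * M ^+ 2 + Q) / eps by rewrite divr_ge0 ?(ltW e0)// mulr_ge0.
have N0 : (0 < N)%N by exact: leq_trans NN.
have NR : 0 < N%:R :> R by rewrite ltr0n.
have NC : N%:R != 0 :> C by rewrite pnatr_eq0 -lt0n.
pose y := cexp (A / N%:R).
have tN : normc (A / N%:R) = normc A / N%:R by rewrite normcM normcV normcMn_nat.
have x1 : normc (x - 1 - A / N%:R) <= eta / N%:R.
  have -> : x - 1 - A / N%:R = (N%:R * (x - 1) - A) / N%:R by field.
  by rewrite normcM normcV normcMn_nat ler_pM2r ?invr_gt0.
have y1 : normc (y - 1 - A / N%:R) <= 4 * M ^+ 2 / N%:R ^+ 2.
  have h : normc (A / N%:R) <= 1 / 2 by rewrite tN ler_pdivrMr//; lra.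
  rewrite (le_trans (cexp_sub_sqr h))// tN expr_div_n mulrA ler_pM2r ?invr_gt0 ?exprn_gt0//.
  by rewrite ler_pM2l// lerXn2r ?nnegrE ?normc_ge0.
have xE i : (i <= N)%N -> normc x ^+ i <= E.
  move=> iN; apply: le_trans (@expn1D_le_expR N i (M + 1) _ iN N0); last by lra.
  rewrite lerXn2r ?nnegrE ?normc_ge0//; first by rewrite addr_ge0// divr_ge0//; lra.
  have -> : x = 1 + (A / N%:R + (x - 1 - A / N%:R)) by ring.
  rewrite (le_trans (ler_normcD _ _))// normc1 lerD2l (le_trans (ler_normcD _ _))//.
  rewrite tN mulrDl lerD// ?ler_pM2r ?invr_gt0// (le_trans x1)// ler_pM2r ?invr_gt0//.
have yE i : (i <= N)%N -> normc y ^+ i <= E.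
  move=> iN; rewrite -normcX -cexp_nat (le_trans (normc_cexp_le _))// ler_expR.
  rewrite normcM normcMn_nat tN mulrA ler_pdivrMr//.
  rewrite (@le_trans _ _ (N%:R * M))//; first by rewrite ler_pM ?normc_ge0// ler_nat.
  by rewrite mulrC ler_pM2r//; lra.
have xy : normc (x - y) <= eta / N%:R + 4 * M ^+ 2 / N%:R ^+ 2.
  have -> : x - y = (x - 1 - A / N%:R) - (y - 1 - A / N%:R) by ring.
  by rewrite (le_trans (ler_normcD _ _))// normcN lerD.
have SS : normc (SN N x - SN N y) <= N%:R ^+ 2 * (E ^+ 2 * eta) + N%:R * (4 * E ^+ 2 * M ^+ 2).
  rewrite /SN -sumrB (le_trans (ler_normc_sum _ _))//.
  rewrite (@le_trans _ _ (\sum_(k < N) N%:R * (N%:R * E ^+ 2 * (eta / N%:R + 4 * M ^+ 2 / N%:R ^+ 2))))//.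
    apply: ler_sum => k _; rewrite -mulrBr normcM normcMn_nat ler_pM ?normc_ge0 ?ler_nat//.
    apply: (@le_trans _ _ (k%:R * E ^+ 2 * normc (x - y))).
      by apply: normc_subXX => i ik; [apply: xE|apply: yE]; rewrite (leq_trans ik)// ltnW.
    rewrite ler_pM ?normc_ge0 ?mulr_ge0 ?exprn_ge0 ?(ltW E0)//.
    by rewrite ler_pM2r ?exprn_gt0// ler_nat ltnW.
  rewrite sumr_const card_ord -[leLHS]mulr_natl le_eqVlt; apply/orP; left; apply/eqP.
  by field; rewrite gt_eqF.
have Sy : normc (SN N y - N%:R ^+ 2 * (Hfun A / 2)) <= N%:R * Q.
  by apply: SN_cexp => //; lra.
rewrite -[SN N x](subrK (SN N y)) -addrA (le_trans (ler_normcD _ _))//.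
rewrite (le_trans (lerD SS Sy))//.
have h1 : N%:R ^+ 2 * (E ^+ 2 * eta) <= N%:R ^+ 2 * (eps / 2) by rewrite ler_pM2l ?exprn_gt0.
have h2 : (4 * E ^+ 2 * M ^+ 2 + Q) <= N%:R * (eps / 2).
  have : 2 * (4 * E ^+ 2 * M ^+ 2 + Q) / eps <= N%:R by lra.
  by rewrite ler_pdivrMr//; lra.
have h3 : N%:R * (4 * E ^+ 2 * M ^+ 2 + Q) <= N%:R * (N%:R * (eps / 2)) by rewrite ler_pM2l.
move: h1 h3; rewrite expr2; move: (E ^+ 2 * eta) (4 * E ^+ 2 * M ^+ 2) => p q; lra.
Qed.

End SN.

(** * Comparison of kernels by duality *)

Section kernel_comparison.
Context {R : realType}.
Local Notation C := R[i].

Lemma cauchy_schwarz (I : finType) (a b : I -> C) :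
  normc (\sum_i a i * b i) ^+ 2 <= (\sum_i normc (a i) ^+ 2) * (\sum_i normc (b i) ^+ 2).
Proof.
pose u := \sum_i normc (a i) ^+ 2; pose v := \sum_i normc (b i) ^+ 2.
pose s := \sum_i normc (a i) * normc (b i).
have s0 : 0 <= s by apply: sumr_ge0 => i _; rewrite mulr_ge0// normc_ge0.
have u0 : 0 <= u by apply: sumr_ge0 => i _; rewrite exprn_ge0// normc_ge0.
have v0 : 0 <= v by apply: sumr_ge0 => i _; rewrite exprn_ge0// normc_ge0.
have ss : normc (\sum_i a i * b i) ^+ 2 <= s ^+ 2.
  rewrite lerXn2r ?nnegrE ?normc_ge0//.
  by rewrite (le_trans (ler_normc_sum _ _))//; apply: ler_sum => i _; rewrite normcM.
apply: le_trans ss _.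
have H (x y : R) : 0 <= x ^+ 2 * u - 2 * x * y * s + y ^+ 2 * v.
  have -> : x ^+ 2 * u - 2 * x * y * s + y ^+ 2 * v = \sum_i (x * normc (a i) - y * normc (b i)) ^+ 2.
    rewrite /u /v /s !mulr_sumr -sumrB -big_split/=; apply: eq_bigr => i _; ring.
  by apply: sumr_ge0 => i _; exact: sqr_ge0.
have := H v s; have := H 1 0; have := H s u; rewrite -/u -/v.
(* If [v = 0], the form at [(s, (u + 1) / 2)] equals -s^2, which forces s = 0; otherwise it is taken
   at [(v, s)]. *)
have [v0'|v0'] := eqVneq v 0.
  rewrite v0' mulr0.
  have := H s ((u + 1) / 2 ); rewrite v0'; nra.
have vp : 0 < v by rewrite lt_def v0'.
move=> _ _ h.
have : 0 <= v * (u * v - s ^+ 2) by nra.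
by rewrite pmulr_rge0// subr_ge0.
Qed.

(** Duality: the sum of |a_i|^2 is the squared norm of the functional x |-> sum x_i a_i, attained in
    the direction x = conj(a). Replacing this x by a y of the same value and controlled norm,
    Cauchy-Schwarz against b gives the bound. *)
Lemma kernel_comparison (I K : finType) (a : I -> C) (b : K -> C) (c : R) : 0 <= c ->
  (forall x : I -> C, exists y : K -> C, \sum_i x i * a i = \sum_k y k * b k /\
     \sum_k normc (y k) ^+ 2 <= c * \sum_i normc (x i) ^+ 2) ->
  \sum_i normc (a i) ^+ 2 <= c * \sum_k normc (b k) ^+ 2.
Proof.
move=> c0 H; have [y [yE yc]] := H (fun i => (a i)^*%C).
pose s := \sum_i normc (a i) ^+ 2; pose v := \sum_k normc (b k) ^+ 2.
have v0 : 0 <= v by apply: sumr_ge0 => i _; rewrite exprn_ge0// normc_ge0.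
have s0 : 0 <= s by apply: sumr_ge0 => i _; rewrite exprn_ge0// normc_ge0.
have sE : \sum_i (a i)^*%C * a i = s%:C%C.
  by rewrite rmorph_sum/=; apply: eq_bigr => i _; rewrite sqr_normcE mulrC.
have := cauchy_schwarz y b; rewrite -yE sE normcR ger0_norm// -/v => h.
have yc' : \sum_k normc (y k) ^+ 2 <= c * s.
  by rewrite (le_trans yc)//; under eq_bigr do rewrite normcJ.
have h2 : s ^+ 2 <= c * s * v by rewrite (le_trans h)// ler_wpM2r.
have [s1|s1] := eqVneq s 0.
  by rewrite -/s -/v s1 mulr_ge0.
have sp : 0 < s by rewrite lt_def s1.
rewrite -/s -/v -(ler_pM2l sp); move: h2; rewrite expr2; lra.
Qed.

End kernel_comparison.

(** * Polynomial approximation of an m-th root *)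

Section root_poly.
Context {R : realType}.
Local Notation C := R[i].
Variable m : nat.
Hypothesis m0 : (0 < m)%N.

(* The Taylor coefficients of (1 - x)^(1/m). *)
Fixpoint rootc (i : nat) : C :=
  if i is i'.+1 then (i'%:R - m%:R^-1) / i'.+1%:R * rootc i' else 1.

Lemma rootcS i : i.+1%:R * rootc i.+1 = (i%:R - m%:R^-1) * rootc i.
Proof. by rewrite /= mulrA mulrCA mulfV ?mulr1// pnatr_eq0. Qed.

Lemma normc_rootc i : normc (rootc i) <= 1.
Proof.
elim: i => [|i IH]; first by rewrite normc1.
rewrite /= normcM mulr_ile1 ?normc_ge0// normcM normcV normcMn_nat ler_pdivrMr ?ltr0n// mul1r.
rewrite (le_trans (ler_normcD _ _))// normcN normcV !normcMn_nat -natr1 lerD2l.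
by rewrite invf_le1 ?ltr0n// ler1n.
Qed.

Definition root_trunc (L : nat) : {poly C} := \poly_(i < L.+1) rootc i.

Let mC : m%:R != 0 :> C. Proof. by rewrite pnatr_eq0 -lt0n. Qed.

(* S = root_trunc L solves the differential equation m (1 - x) S' + S = 0 of
   (1 - x)^(1/m) up to order L, so S^m solves (1 - x) P' + P = 0 up to order L. *)
Lemma coef_root_trunc_exp (L i : nat) : (i <= L)%N ->
  (root_trunc L ^+ m)`_i = (i == 0)%:R - (i == 1)%:R.
Proof.
set S := root_trunc L; set P := S ^+ m.
have ode : (1 - 'X) * P^`() + P = S ^+ m.-1 * ((1 - 'X) * S^`() *+ m + S).
  rewrite /P deriv_exp -{3}(prednK m0) exprS.
  move: (S^`()) (S ^+ m.-1) => D E.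
  by rewrite mulrDr !mulrnAr mulrA [E * (_ * D)]mulrC [E * S]mulrC.
have odeS j : (j < L)%N -> ((1 - 'X) * S^`() *+ m + S)`_j = 0.
  move=> jL; rewrite coefD coefMn mulrBl mul1r coefB coefXM !coef_deriv /S /root_trunc !coef_poly.
  rewrite !ltnS jL (ltnW jL).
  have -> : (if j == 0 then 0 else (if (j.-1.+1 <= L)%N then rootc j.-1.+1 else 0) *+ j.-1.+1) = rootc j *+ j.
    by case: j jL => [|j] jL //=; rewrite (ltnW jL).
  rewrite -[rootc j.+1 *+ _]mulr_natl rootcS -[rootc j *+ _]mulr_natl -[_ *+ m]mulr_natl.
  move: (rootc j) (j%:R : C) => c J.
  by rewrite mulrBl addrAC subrr sub0r mulrN mulrA mulfV// mul1r addNr.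
have odeP j : (j < L)%N -> ((1 - 'X) * P^`() + P)`_j = 0.
  move=> jL; rewrite ode coefM big1// => k _; rewrite odeS ?mulr0//.
  by rewrite (leq_ltn_trans _ jL)// leq_subr.
have P0 : P`_0 = 1.
  rewrite -horner_coef0 /P horner_exp horner_coef0 /S /root_trunc coef_poly /=.
  by rewrite expr1n.
have rec j : (j < L)%N -> j.+1%:R * P`_j.+1 = (j%:R - 1) * P`_j.
  move=> /odeP; rewrite coefD mulrBl mul1r coefB coefXM !coef_deriv.
  rewrite -[P`_j.+1 *+ _]mulr_natl; case: j => [|j] /=.
    by rewrite subr0 sub0r mulN1r => /eqP; rewrite addr_eq0 => /eqP.
  rewrite -[P`_j.+1 *+ _]mulr_natl => /eqP; rewrite addr_eq0 subr_eq => /eqP ->.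
  by rewrite addrC mulrBl mul1r.
(* The factor [j%:R - 1] of the recursion vanishes at [j = 1], so up to order L the coefficients are
   1, -1, 0, 0, and so on. *)
elim: i => [|i IH] iL; first by rewrite P0 subr0.
have iC : i.+1%:R != 0 :> C by rewrite pnatr_eq0.
apply: (mulfI iC); rewrite rec// IH 1?ltnW//.
by case: i {IH iL iC} => [|[|i]] /=; rewrite ?subr0 ?mulr0 ?subrr ?mul0r ?mulr1//= ?sub0r ?mulr1 ?mul1r ?oppr0 ?mulr0.
Qed.

(** Polynomial growth in [i], uniform in [L]: this controls the coefficients beyond the order up to
    which they are known. *)
Lemma normc_coef_root_trunc_exp (L i k : nat) :
  normc (root_trunc L ^+ k)`_i <= i.+1%:R ^+ k.
Proof.
elim: k i => [|k IH] i.
  by rewrite expr0 coef1; case: eqP => _; rewrite ?normc1 ?normc0.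
rewrite exprS coefM (le_trans (ler_normc_sum _ _))//.
rewrite (@le_trans _ _ (\sum_(j < i.+1) i.+1%:R ^+ k))//; last first.
  by rewrite sumr_const card_ord -[leLHS]mulr_natl exprS.
apply: ler_sum => j _; rewrite normcM -[leRHS]mul1r ler_pM ?normc_ge0//.
  rewrite /root_trunc coef_poly; case: ifP => _; last by rewrite normc0.
  exact: normc_rootc.
rewrite (le_trans (IH _))// lerXn2r ?nnegrE// ler_nat ltnS leq_subr//.
Qed.

Lemma geometric_le (s : R) (W : nat) : 0 <= s < 1 -> \sum_(i < W) s ^+ i <= (1 - s)^-1.
Proof.
move=> /andP[s0 s1]; rewrite -[leRHS]mul1r ler_pdivlMr; last by rewrite subr_gt0.
rewrite mulrC -opprB mulNr -subrX1 opprB lerBlDr lerDl exprn_ge0//.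
Qed.

Lemma exprn_small (s eps : R) : 0 <= s < 1 -> 0 < eps -> exists L : nat, (0 < L)%N && (s ^+ L <= eps).
Proof.
move=> /andP[s0 s1] e0.
have sn : `|s| < 1 by rewrite ger0_norm.
have /cvgrPdist_le /(_ _ e0) [N _ H] := cvg_expr sn.
exists N.+1; rewrite /=; have /= := H N.+1 (leqnSn N).
by rewrite sub0r normrN ger0_norm// exprn_ge0.
Qed.

(** s^i appears twice because one copy will make the tail small and the other will sum it. Bernoulli
    gives (i + 1) h <= (1 + h)^(i + 1), so the polynomial factor only costs a ratio (1 + h)^m. *)
Lemma exprn_dominates (rho : R) : 0 <= rho < 1 ->
  exists K s : R, [/\ 0 <= K, 0 <= s < 1 & forall i : nat, i.+1%:R ^+ m * rho ^+ i <= K * s ^+ i * s ^+ i].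
Proof.
move=> /andP[r0 r1].
have mR : 0 < m%:R :> R by rewrite ltr0n.
(* With m h = (1 - rho)/2, Bernoulli gives (1 - h)^m >= (1 + rho)/2, hence (1 + h)^m (1 + rho)/2 <=
   (1 - h^2)^m <= 1 and (1 + h)^m rho < 1. *)
pose h : R := (1 - rho) / 2 / m%:R.
have h0 : 0 < h by rewrite !divr_gt0// subr_gt0.
have mh : m%:R * h = (1 - rho) / 2 by rewrite /h mulrC divfK// gt_eqF.
clearbody h.
have h1 : h <= 1 / 2.
  have m1 : 1 <= m%:R :> R by rewrite ler1n.
  have : h <= m%:R * h by rewrite ler_peMl// ltW.
  by rewrite mh; lra.
have bern (n : nat) (x : R) : 0 <= 1 + x -> 1 + n%:R * x <= (1 + x) ^+ n.
  move=> x1; elim: n => [|n IH]; first by rewrite mul0r addr0 expr0.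
  rewrite exprS; apply: le_trans (ler_wpM2l x1 IH).
  rewrite -natr1; have := ler0n R n; have := sqr_ge0 x; nra.
pose g := (1 + h) ^+ m; have g0 : 0 < g by rewrite exprn_gt0//; lra.
have gb : g * ((1 + rho) / 2) <= 1.
  have := @bern m (- h); rewrite mulrN mh => /(_ _) b.
  have b' : (1 + rho) / 2 <= (1 - h) ^+ m by apply: le_trans (b _); lra.
  apply: (@le_trans _ _ (g * (1 - h) ^+ m)); first by rewrite ler_pM2l.
  rewrite /g -exprMn exprn_ile1//; nra.
pose q := g * rho; have q0 : 0 <= q by rewrite mulr_ge0// ltW.
have q1 : q < 1.
  rewrite /q; have [->|rn] := eqVneq rho 0; first by rewrite mulr0 ltr01.
  apply: lt_le_trans gb; rewrite ltr_pM2l//; lra.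
exists (h ^- m * g), (Num.sqrt q); split.
- by rewrite mulr_ge0 ?(ltW g0)// invr_ge0 exprn_ge0// ltW.
- by rewrite sqrtr_ge0/= -[ltRHS]sqrtr1 ltr_sqrt.
- move=> i; rewrite -mulrA -exprMn -expr2 sqr_sqrtr// /q exprMn.
  rewrite [leRHS]mulrA ler_wpM2r ?exprn_ge0//.
  have : i.+1%:R * h <= (1 + h) ^+ i.+1.
    by apply: le_trans (bern i.+1 h _); lra.
  rewrite -ler_pdivlMr// => H.
  rewrite (le_trans (lerXn2r m _ _ H)) ?nnegrE ?ler0n//.
    by rewrite divr_ge0 ?(ltW h0)// exprn_ge0//; lra.
  rewrite expr_div_n mulrC -mulrA ler_pM2l ?invr_gt0 ?exprn_gt0//.
  by rewrite -exprS /g -!exprM mulnC.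
Qed.

(** Only [S.[Z] ^+ m] is compared with [Z], so no branch of the root is ever chosen. With x = 1 - Z
    the error is the tail beyond order [L] of the m-th power of the truncated series. *)
Lemma nth_root_approx (rho eps : R) : 0 <= rho < 1 -> 0 < eps ->
  exists S : {poly C}, forall Z, normc (Z - 1) <= rho -> normc (S.[Z] ^+ m - Z) <= eps.
Proof.
move=> r01 e0.
have [K [s [K0 s01 Ks]]] := exprn_dominates r01.
have r0 : 0 <= rho by case/andP: r01.
have s0 : 0 <= s by case/andP: s01.
have s1 : 0 < 1 - s by rewrite subr_gt0; case/andP: s01.
have [L /andP[L0 sL]] := @exprn_small s (eps * (1 - s) / (K + 1)) s01
  (divr_gt0 (mulr_gt0 e0 s1) (ltr_wpDl K0 ltr01)).
exists (root_trunc L \Po (1 - 'X)) => Z ZR.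
pose x := 1 - Z; have xR : normc x <= rho by rewrite normc_distC.
rewrite horner_comp !hornerE -/x.
have -> : Z = 1 - x by rewrite /x subKr.
rewrite -horner_exp; set P := root_trunc L ^+ m.
(* Two extra places, so that 1 - x can be written over the same range of exponents. *)
pose W := (size P).+2.
pose d i := P`_i - ((i == 0)%:R - (i == 1)%:R).
have -> : P.[x] - (1 - x) = \sum_(i < W) d i * x ^+ i.
  rewrite (@horner_coef_wide _ W); last exact: leq_trans (leqnSn _) (leqnSn _).
  have -> : 1 - x = \sum_(i < W) ((i == 0)%:R - (i == 1)%:R :> C) * x ^+ i.
    rewrite big_ord_recl big_ord_recl big1 => [|i _]; last by rewrite /= subr0 mul0r.
    by rewrite /= expr0 expr1 subr0 sub0r addr0 mul1r mulN1r.
  by rewrite -sumrB; apply: eq_bigr => i _; rewrite -mulrBl.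
rewrite (le_trans (ler_normc_sum _ _))//.
rewrite (@le_trans _ _ (\sum_(i < W) K * s ^+ L * s ^+ i))//.
  apply: ler_sum => i _; rewrite normcM normcX.
  have [iL|iL] := leqP i L.
    by rewrite /d coef_root_trunc_exp// subrr normc0 mul0r !mulr_ge0// exprn_ge0.
  have -> : d i = P`_i by rewrite /d !gtn_eqF ?subrr ?subr0// (leq_trans _ iL)// ltnS.
  rewrite (@le_trans _ _ (i.+1%:R ^+ m * rho ^+ i))//.
    by rewrite ler_pM ?exprn_ge0 ?normc_ge0 ?normc_coef_root_trunc_exp// lerXn2r ?nnegrE ?normc_ge0.
  rewrite (le_trans (Ks i))// ler_wpM2r ?exprn_ge0// ler_wpM2l//.
  by apply: ler_wiXn2l => //; [lra|exact: ltnW].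
rewrite -mulr_sumr (le_trans (ler_wpM2l _ (geometric_le W s01)))//.
  by rewrite mulr_ge0// exprn_ge0.
rewrite ler_pdivrMr//; apply: le_trans (ler_wpM2l K0 sL) _.
rewrite mulrA ler_pdivrMr; last by lra.
by rewrite mulrC ler_wpM2l//; [rewrite mulr_ge0// ltW|lra].
Qed.

End root_poly.

(** * Powers of |z| as moduli of polynomials in z^m *)

Section weights.
Context {R : realType}.
Local Notation C := R[i].

Lemma exprn_close1 (N : nat) (d : R) : 0 < d ->
  exists eta : R, 0 < eta < 1 /\ forall t, 1 - eta <= t <= 1 + eta -> `|t ^+ N - 1| <= d.
Proof.
move=> d0; have := @exprn_continuous R N 1.
move=> /cvgrPdist_le /(_ _ d0) /nbhs_ballP [e /= e0 H].
exists (Num.min (e / 2) (1 / 2)); split.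
  by rewrite lt_min gt_min !divr_gt0//=; apply/orP; right; lra.
move=> t te; rewrite distrC -[X in `|X - _|](expr1n _ N); apply: H.
rewrite /ball/= ltr_norml; move: te.
have : Num.min (e / 2) (1 / 2) <= e / 2 by rewrite ge_min lexx.
by move: (Num.min _ _) => k; lra.
Qed.

Lemma ler_dist_normc (x y : C) : `|normc x - normc y| <= normc (x - y).
Proof.
have h1 : normc x <= normc (x - y) + normc y by rewrite -{1}(subrK y x) ler_normcD.
have h2 : normc y <= normc (x - y) + normc x by rewrite normc_distC -{1}(subrK x y) ler_normcD.
by rewrite ler_norml; lra.
Qed.

Variables (rho : R) (m : nat).
Hypotheses (r01 : 0 <= rho < 1) (m0 : (0 < m)%N).

Lemma lemniscate_lb (z : C) : normc (z ^+ m - 1) <= rho -> 1 - rho <= normc z ^+ m.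
Proof.
move=> h; rewrite -normcX; have := ler_normcD (z ^+ m) (1 - z ^+ m).
by rewrite addrC subrK normc1 normc_distC; lra.
Qed.

Lemma lemniscate_gt0 (z : C) : normc (z ^+ m - 1) <= rho -> 0 < normc z.
Proof.
move=> h; rewrite lt_def normc_ge0 andbT; apply: contraTneq (lemniscate_lb h) => ->.
by rewrite expr0n gtn_eqF// -ltNge subr_gt0; case/andP: r01.
Qed.

(** The quotient t satisfies |t^m - 1| <= eta, and for t >= 0 the power t^m is at least as far from
    1 as t is. Dividing by |z|^m costs a bounded factor because |z|^m >= 1 - rho. *)
Lemma root_ratio (eta : R) : 0 < eta < 1 -> exists S : {poly C},
  forall z, normc (z ^+ m - 1) <= rho ->
    1 - eta <= normc S.[z ^+ m] / normc z <= 1 + eta.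
Proof.
move=> /andP[e0 e1]; have r1 : 0 < 1 - rho by rewrite subr_gt0; case/andP: r01.
have [S HS] := nth_root_approx m0 r01 (mulr_gt0 e0 r1).
exists S => z zr; have z0 := lemniscate_gt0 zr; have zm := lemniscate_lb zr.
pose t := normc S.[z ^+ m] / normc z.
have t0 : 0 <= t by rewrite divr_ge0// normc_ge0.
have tm : `|t ^+ m - 1| <= eta.
  have -> : t ^+ m - 1 = (normc (S.[z ^+ m] ^+ m) - normc (z ^+ m)) / normc z ^+ m.
    by rewrite !normcX mulrBl divff ?expf_neq0 ?gt_eqF// expr_div_n.
  rewrite normrM normfV (ger0_norm (exprn_ge0 m (ltW z0))) ler_pdivrMr ?exprn_gt0//.
  rewrite (le_trans (ler_dist_normc _ _))// (le_trans (HS _ zr))// ler_pM2l//.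
move: tm; rewrite ler_norml => /andP[t1 t2]; rewrite -/t; apply/andP; split.
- rewrite -(ler_pXn2r m0) ?nnegrE//; last by lra.
  have : (1 - eta) ^+ m <= 1 - eta.
    by case: (m) m0 => // k _; rewrite exprS ler_piMr ?exprn_ile1//; lra.
  lra.
- rewrite -(ler_pXn2r m0) ?nnegrE//; last by lra.
  have : 1 + eta <= (1 + eta) ^+ m.
    by case: (m) m0 => // k _; rewrite exprS ler_peMr ?exprn_ege1//; lra.
  lra.
Qed.

Lemma weight_approx (s : nat) (d : R) : 0 < d -> exists T : {poly C},
  forall z, normc (z ^+ m - 1) <= rho ->
  `|normc T.[z ^+ m] ^+ 2 - normc z ^+ (2 * s)| <= d * normc z ^+ (2 * s).
Proof.
move=> d0; have [eta [e01 He]] := exprn_close1 (2 * s) d0.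
have [S HS] := root_ratio e01.
exists (S ^+ s) => z zr; have z0 := lemniscate_gt0 zr.
have zs : 0 < normc z ^+ (2 * s) by rewrite exprn_gt0.
have := He _ (HS _ zr).
rewrite horner_exp normcX -exprM [(s * 2)%N]mulnC expr_div_n.
have -> : normc S.[z ^+ m] ^+ (2 * s) - normc z ^+ (2 * s) =
    (normc S.[z ^+ m] ^+ (2 * s) / normc z ^+ (2 * s) - 1) * normc z ^+ (2 * s).
  by rewrite mulrBl divfK ?mul1r// gt_eqF.
by rewrite normrM (gtr0_norm zs) ler_pM2r.
Qed.

(** Since z^(-s) = z^(m-s) z^(-m), [B] is a power of the approximate root times [I], a partial sum
    of the geometric series of 1/Z around Z = 1. *)
Lemma inv_weight_approx (s : nat) (d : R) : (s <= m)%N -> 0 < d -> exists B : {poly C},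
  forall z, normc (z ^+ m - 1) <= rho ->
  `|normc B.[z ^+ m] ^+ 2 * normc z ^+ (2 * s) - 1| <= d.
Proof.
move=> sm d0; have m2E : (m * 2 = 2 * s + 2 * (m - s))%N by rewrite mulnC -mulnDr subnKC.
(* Two factors within d' of 1 have a product within 3 d' of 1, as d' <= 1. *)
pose d' := Num.min 1 (d / 3).
have d'0 : 0 < d' by rewrite lt_min ltr01 divr_gt0.
have d'1 : d' <= 1 by rewrite ge_min lexx.
have d'd : d' <= d / 3 by rewrite ge_min lexx orbT.
have [eta [e01 He]] := exprn_close1 (2 * (m - s)) d'0.
have [eta2 [e012 He2]] := exprn_close1 2 d'0.
have [S HS] := root_ratio e01.
have [L /andP[L0 rL]] := exprn_small r01 (proj1 (andP e012)).
pose I : {poly C} := \sum_(i < L) (1 - 'X) ^+ i.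
have IE Z : I.[Z] * Z = 1 - (1 - Z) ^+ L.
  have -> : I.[Z] = \sum_(i < L) (1 - Z) ^+ i.
    by rewrite horner_sum; apply: eq_bigr => i _; rewrite horner_exp !hornerE.
  have := subrX1 (1 - Z) L; rewrite addrAC subrr add0r mulNr => H.
  by rewrite mulrC -[LHS]opprK -H opprB.
exists (S ^+ (m - s) * I) => z zr; have z0 := lemniscate_gt0 zr.
pose t := normc S.[z ^+ m] / normc z; pose w := normc (I.[z ^+ m] * z ^+ m).
have t1 : `|t ^+ (2 * (m - s)) - 1| <= d' by exact: He (HS _ zr).
have w1 : `|w ^+ 2 - 1| <= d'.
  suff : `|w - 1| <= eta2 by rewrite ler_norml => ww; apply: He2; lra.
  rewrite /w IE -[X in `|_ - X|]normc1 (le_trans (ler_dist_normc _ _))//.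
  rewrite addrAC subrr add0r normcN normcX (le_trans _ rL)// lerXn2r ?nnegrE ?normc_ge0//.
    by case/andP: r01.
  by rewrite normc_distC.
have -> : normc (S ^+ (m - s) * I).[z ^+ m] ^+ 2 * normc z ^+ (2 * s) = t ^+ (2 * (m - s)) * w ^+ 2.
  rewrite hornerM horner_exp normcM normcX /t /w normcM normcX expr_div_n !exprMn -!exprM.
  rewrite m2E exprD [((m - s) * 2)%N]mulnC.
  by field; rewrite expf_neq0// gt_eqF.
move: t1 w1; rewrite !ler_norml; move: (t ^+ _) (w ^+ 2) => a b; nra.
Qed.

End weights.

(** * Residue classes of exponents and triangular bases *)

Lemma sum_pair (V : nmodType) (m N : nat) (f : 'I_m * 'I_N -> V) :
  \sum_i f i = \sum_(j < m) \sum_(k < N) f (j, k).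
Proof. by rewrite pair_bigA; apply: eq_bigr => -[j k]. Qed.

Section poly_facts.
Variable F : fieldType.

Lemma sum_residues (V : zmodType) (f : nat -> V) (m K : nat) :
  \sum_(i < m * K) f i = \sum_(j < m) \sum_(l < K) f (j + m * l)%N.
Proof.
elim: K => [|K IH].
  by rewrite muln0 big_ord0 big1// => j _; rewrite big_ord0.
rewrite mulnS addnC big_split_ord/= IH -big_split/=; apply: eq_bigr => j _.
by rewrite big_ord_recr/= addnC.
Qed.

Lemma horner_residues (p : {poly F}) (m n : nat) (z : F) : (0 < m)%N -> (size p <= n.+1)%N ->
  p.[z] = \sum_(j < m) z ^+ j * (\poly_(l < (n %/ m).+1) p`_(j + m * l)).[z ^+ m].
Proof.
move=> m0 pn; have mn : (n.+1 <= m * (n %/ m).+1)%N by rewrite mulnC ltn_ceil.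
rewrite (horner_coef_wide _ (leq_trans pn mn)).
rewrite (sum_residues (fun i => p`_i * z ^+ i)); apply: eq_bigr => j _.
rewrite horner_poly mulr_sumr; apply: eq_bigr => l _.
by rewrite exprD exprM mulrCA mulrA.
Qed.

Lemma coef_sum_scaleXn (N : nat) (c : 'I_N -> F) (k : 'I_N) :
  (\sum_(i < N) c i *: 'X^i)`_k = c k.
Proof.
rewrite coef_sum (bigD1 k)//= coefZ coefXn eqxx mulr1 big1 ?addr0// => i ik.
by rewrite coefZ coefXn eq_sym val_eqE (negbTE ik) mulr0.
Qed.

Lemma size_sum_scaleXn (N : nat) (c : 'I_N -> F) : (size (\sum_(i < N) c i *: 'X^i)%R <= N)%N.
Proof.
apply: (leq_trans (size_sum _ _ _)); apply/bigmax_leqP => i _.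
by rewrite (leq_trans (size_scale_leq _ _))// size_polyXn.
Qed.

Lemma triangular_expand (phi : nat -> {poly F}) (n : nat) (p : {poly F}) :
  (forall k, size (phi k) = k.+1) -> (size p <= n)%N ->
  exists c : 'I_n -> F, p = \sum_(k < n) c k *: phi k.
Proof.
move=> sphi; elim: n p => [|n IH] p pn.
  exists (fun=> 0); rewrite big_ord0; apply/eqP; rewrite -size_poly_eq0; lia.
have ln : lead_coef (phi n) != 0 by rewrite lead_coef_eq0 -size_poly_eq0 sphi.
pose a := p`_n / lead_coef (phi n).
have [|c cE] := IH (p - a *: phi n).
  apply/leq_sizeP => i; rewrite leq_eqVlt => /predU1P[<-|ni].
    have lE : lead_coef (phi n) = (phi n)`_n by rewrite lead_coefE sphi.
    by rewrite coefB coefZ -lE /a divfK ?subrr.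
  by rewrite coefB coefZ !nth_default ?mulr0 ?subr0// ?sphi// (leq_trans pn).
exists (fun k => if unlift ord_max k is Some j then c j else a).
rewrite big_ord_recr/= unlift_none -[LHS](subrK (a *: phi n)) cE; congr (_ + _).
apply: eq_bigr => k _; have -> : widen_ord (leqnSn n) k = lift ord_max k.
  by apply: val_inj; rewrite /= /bump leqNgt ltn_ord.
by rewrite liftK.
Qed.

End poly_facts.

(** * Two-sided comparison of K_n with explicit kernels *)

Section kernels.
Context {R : realType}.
Local Notation C := R[i].
Local Notation mu := (@lebesgue_measure R).
Local Notation mu2 := (mu \x mu)%E.
Variables (r : R) (m : nat) (phi : nat -> {poly C}).
Hypotheses (r01 : 0 < r < 1) (m1 : (1 < m)%N) (onp : is_ONP r m phi).
Local Notation G := (lemG r m).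

(* kap k * w0^k, k = 0, 1, ..., are orthonormal for |z|^(2m-2) dA on G. *)
Definition kap (k : nat) : R := Num.sqrt (m%:R / (pi * r ^+ (2 * m)) * k.+1%:R).

Let m0 : (0 < m)%N. Proof. exact: ltnW. Qed.
Let r0 : 0 < r. Proof. by case/andP: r01. Qed.
Let rm0 : 0 < r ^+ m. Proof. by rewrite exprn_gt0. Qed.
Let rmC : (r ^+ m)%:C%C != 0 :> C. Proof. by rewrite eq_complex /= negb_and gt_eqF. Qed.

Lemma kap2 k : kap k ^+ 2 = m%:R / (pi * r ^+ (2 * m)) * k.+1%:R.
Proof.
by rewrite sqr_sqrtr// !mulr_ge0// invr_ge0 mulr_ge0 ?pi_ge0// exprn_ge0// ltW.
Qed.

Lemma kap_neq0 k : (kap k)%:C%C != 0 :> C.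
Proof.
rewrite eq_complex /= negb_and; apply/orP; left.
suff : kap k ^+ 2 != 0 by rewrite expf_eq0.
rewrite kap2 gt_eqF// mulr_gt0 ?ltr0n// divr_gt0 ?ltr0n//.
by rewrite mulr_gt0 ?pi_gt0// exprn_gt0.
Qed.

Lemma w0K z : 1 + (r ^+ m)%:C%C * w0 r m z = z ^+ m.
Proof. by rewrite /w0 mulrC divfK// addrC subrK. Qed.

Lemma integral_lemG_sum (N : nat) (f : 'I_N -> R * R -> R) :
  (forall l, measurable_fun setT (f l)) -> (forall l z, 0 <= f l z) ->
  (\int[mu2]_(z in G) (\sum_(l < N) f l z)%R%:E = \sum_(l < N) \int[mu2]_(z in G) (f l z)%:E)%E.
Proof.
move=> mf f0; rewrite integral_lemG.
rewrite (eq_bigr (fun l => \int[mu2]_z (lemI r m (toC z) * f l z)%R%:E)%E); last first.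
  by move=> l _; rewrite integral_lemG.
under eq_integral do rewrite mulr_sumr.
apply: ge0_integral_mu2_sum => l.
- exact: measurable_funM (measurable_lemI r m) (mf l).
- by move=> z; rewrite mulr_ge0// lemI_ge0.
Qed.

Lemma integral_lemGZl (k : R) (f : R * R -> R) : 0 <= k -> measurable_fun setT f ->
  (forall z, 0 <= f z) ->
  (\int[mu2]_(z in G) (k * f z)%R%:E = k%:E * \int[mu2]_(z in G) (f z)%:E)%E.
Proof.
move=> k0 mf f0; rewrite !integral_lemG.
under eq_integral do rewrite mulrCA.
apply: ge0_integral_mu2Zl => //.
- exact: measurable_funM (measurable_lemI r m) mf.
- by move=> z; rewrite mulr_ge0// lemI_ge0.
Qed.

Lemma le_integral_lemG (f g : R * R -> R) : measurable_fun setT f -> measurable_fun setT g ->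
  (forall z, 0 <= f z) -> (forall z, G z -> f z <= g z) ->
  (\int[mu2]_(z in G) (f z)%:E <= \int[mu2]_(z in G) (g z)%:E)%E.
Proof.
move=> mf mg f0 fg; apply: ge0_le_integral.
- exact: measurable_lemG.
- by move=> z _; rewrite lee_fin.
- by apply: measurable_funTS; apply/measurable_EFinP.
- by apply: measurable_funTS; apply/measurable_EFinP.
- by move=> z zG; rewrite lee_fin fg.
Qed.

Lemma conformal_norm (N : nat) (q : {poly C}) : (0 < N)%N -> (size q <= N)%N ->
  (\int[mu2]_(z in G) (normc (toC z) ^+ (2 * m - 2) * normc q.[w0 r m (toC z)] ^+ 2)%R%:E =
   (\sum_(k < N) normc (q`_k / (kap k)%:C%C) ^+ 2)%R%:E)%E.
Proof.
move=> N0 qN; rewrite (integral_lemG_conformal r01 m1 qN N0) mulr_sumr; congr EFin.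
apply: eq_bigr => k _; rewrite normcM normcV exprMn exprVn normcR real_normK ?num_real// kap2.
have p0 : (pi : R) != 0 by rewrite gt_eqF// pi_gt0.
have mR : m%:R != 0 :> R by rewrite pnatr_eq0 -lt0n.
have kR : k.+1%:R != 0 :> R by rewrite pnatr_eq0.
have rR : r ^+ (2 * m) != 0 by rewrite gt_eqF// exprn_gt0.
rewrite invfM invf_div; move: (normc _ ^+ 2) (r ^+ _) => a b; ring.
Qed.

Section lower.
Variables (T : 'I_m -> {poly C}) (D N n : nat) (c : R).
Hypotheses (c0 : 0 <= c) (N0 : (0 < N)%N).
Hypothesis TD : forall j, (size (T j) <= D)%N.
Hypothesis Nn : (m * (D + N).+1 <= n)%N.
Hypothesis Tc : forall j z, normc (z ^+ m - 1) <= r ^+ m ->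
  normc (T j).[z ^+ m] ^+ 2 * normc z ^+ (2 * j) <= c * normc z ^+ (2 * m - 2).

(** [T j] stands for z^(m-1-j): by [Tc] the area norm of a combination is controlled by its
    coefficients, and by [Nn] its degree is at most [n]. *)
Definition psi (i : 'I_m * 'I_N) (z : C) : C :=
  z ^+ i.1 * (T i.1).[z ^+ m] * ((kap i.2)%:C%C * w0 r m z ^+ i.2).

(** A combination of the [psi i] is a polynomial of degree at most n, hence a combination of the
    [phi k]; orthogonality of the residue classes and [Tc] bound its norm. The free [lam] provides
    the whole quadratic form, as polarization requires. *)
Lemma kernel_lower z w lam :
  \sum_i normc (psi i z + lam * psi i w) ^+ 2 <=
  c * \sum_(k < n.+1) normc ((phi k).[z] + lam * (phi k).[w]) ^+ 2.
Proof.
apply: kernel_comparison => // x.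
pose q j : {poly C} := \sum_(k < N) (x (j, k) * (kap k)%:C%C) *: 'X^k.
pose lin : {poly C} := (r ^+ m)%:C%C^-1 *: ('X - 1%:P).
pose g j : {poly C} := T j * (q j \Po lin).
pose p : {poly C} := \sum_(j < m) 'X^j * (g j \Po 'X^m).
have qE j v : (q j).[v] = \sum_(k < N) x (j, k) * ((kap k)%:C%C * v ^+ k).
  by rewrite /q horner_sum; apply: eq_bigr => k _; rewrite hornerZ hornerXn mulrA.
have gE j v : (g j).[v ^+ m] = (T j).[v ^+ m] * (q j).[w0 r m v].
  rewrite /g hornerM horner_comp /lin hornerZ hornerXsubC /w0.
  by rewrite [_^-1 * _]mulrC.
have pE v : p.[v] = \sum_(j < m) v ^+ j * (g j).[v ^+ m].
  by rewrite /p horner_sum; apply: eq_bigr => j _; rewrite hornerM horner_comp !hornerXn.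
have pEx v : p.[v] = \sum_i x i * psi i v.
  rewrite pE sum_pair/=; apply: eq_bigr => j _.
  rewrite gE qE mulrA mulr_sumr; apply: eq_bigr => k _; rewrite /psi/=; ring.
(* Degree count: an exponent j <= m - 1 plus m times the degree of [g j], whose size is at most D +
   N. *)
have ps : (size p <= n.+1)%N.
  apply: (leq_trans (size_sum _ _ _)); apply/bigmax_leqP => j _.
  rewrite (leq_trans (size_polyMleq _ _))// size_polyXn addSn/=.
  have sl : (size (q j \Po lin) <= N)%N.
    rewrite (leq_trans (size_comp_poly_leq _ _))//.
    rewrite (@leq_trans (N.-1 * 1).+1)//; last by rewrite muln1 prednK.
    rewrite ltnS leq_mul//; first by rewrite -!subn1 leq_sub2r// size_sum_scaleXn.
    by rewrite -subn1 leq_subLR (leq_trans (size_scale_leq _ _))// size_XsubC.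
  have sg : (size (g j) <= D + N)%N.
    rewrite (leq_trans (size_polyMleq _ _))// (leq_trans (leq_pred _))// leq_add//; exact: TD.
  have sc : (size (g j \Po 'X^m) <= (m * (D + N)).+1)%N.
    rewrite (leq_trans (size_comp_poly_leq _ _))// size_polyXn/= ltnS mulnC leq_mul2l.
    by rewrite (leq_trans (leq_pred _) sg) orbT.
  rewrite (leq_trans (leq_add (ltnW (ltn_ord j)) sc))// addnS ltnS.
  by rewrite (leq_trans _ Nn)// mulnS.
have [y yE] := triangular_expand (fun k => (onp.1 k).1) ps.
have pEy v : p.[v] = \sum_(k < n.+1) y k * (phi k).[v].
  by rewrite yE horner_sum; apply: eq_bigr => k _; rewrite hornerZ.
exists y; split.
  transitivity (p.[z] + lam * p.[w]).
    by rewrite !pEx mulr_sumr -big_split/=; apply: eq_bigr => i _; ring.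
  by rewrite !pEy mulr_sumr -big_split/=; apply: eq_bigr => i _; ring.
rewrite -lee_fin -(ONP_norm r01 m1 y onp).
under eq_integral do rewrite -pEy pE.
have mcX := cmeasurableX m (@cmeasurable_toC1 R).
rewrite (@integral_lemG_residues R r m (fun j z => (g j).[z]) m0); last first.
  by move=> j; exact: cmeasurable_horner cmeasurable_toC1.
have mn k : measurable_fun setT (fun z : R * R => normc (toC z) ^+ (2 * k)).
  by under eq_fun do rewrite exprM; apply: measurable_funX; exact: cmeasurable_normc cmeasurable_toC1.
have mq j : measurable_fun setT (fun z : R * R => normc (q j).[w0 r m (toC z)] ^+ 2).
  apply: cmeasurable_normc; apply: cmeasurable_horner.
  exact: cmeasurableM (cmeasurableD mcX (cmeasurable_cst _)) (cmeasurable_cst _).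
have E2 : (2 * m - 2 = 2 * m.-1)%N by lia.
pose f j (z : R * R) : R := c * (normc (toC z) ^+ (2 * m - 2) * normc (q j).[w0 r m (toC z)] ^+ 2).
have mf j : measurable_fun setT (f j).
  rewrite /f E2; apply: measurable_funM (measurable_cst _) _.
  exact: measurable_funM (mn _) (mq j).
have f0 j z' : 0 <= f j z' by rewrite /f mulr_ge0// mulr_ge0 ?exprn_ge0 ?normc_ge0.
apply: (@le_trans _ _ (\int[mu2]_(z in G) (\sum_(j < m) f j z)%R%:E)%E).
  apply: le_integral_lemG.
  - apply: measurable_sum => j; apply: measurable_funM (mn _) _.
    by apply: cmeasurable_normc; exact: cmeasurable_horner mcX.
  - by apply: measurable_sum => j; exact: mf.
  - by move=> v; apply: sumr_ge0 => j _; rewrite mulr_ge0// exprn_ge0// normc_ge0.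
  - move=> v vG; apply: ler_sum => j _; rewrite gE /f normcM exprMn mulrCA mulrA.
    by rewrite [leRHS]mulrA ler_wpM2r ?exprn_ge0 ?normc_ge0// Tc// ltW.
rewrite (integral_lemG_sum mf f0) sum_pair/=.
rewrite mulr_sumr -sumEFin; apply: lee_sum => j _.
have mh : measurable_fun setT (fun z : R * R => normc (toC z) ^+ (2 * m - 2) * normc (q j).[w0 r m (toC z)] ^+ 2).
  by rewrite E2; exact: measurable_funM (mn _) (mq j).
rewrite (@integral_lemGZl c _ c0 mh); last by move=> v; rewrite mulr_ge0// exprn_ge0// normc_ge0.
rewrite (conformal_norm N0 (size_sum_scaleXn _)) -EFinM lee_fin ler_wpM2l//.
by apply: ler_sum => k _; rewrite coef_sum_scaleXn mulfK// kap_neq0.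
Qed.

End lower.

Section upper.
Variables (B : 'I_m -> {poly C}) (D N n : nat) (c : R).
Hypotheses (c0 : 0 <= c) (N0 : (0 < N)%N).
Hypothesis BD : forall j, (size (B j) <= D)%N.
Hypothesis Nn : (D + (n %/ m).+1 <= N)%N.
Hypothesis Bc : forall j z, normc (z ^+ m - 1) <= r ^+ m ->
  normc (B j).[z ^+ m] ^+ 2 * normc z ^+ (2 * m - 2) <= c * normc z ^+ (2 * j).

(** Division by [B j] recovers the j-th residue part of a polynomial from its product with [B j];
    [kernel_upper] uses this where no denominator vanishes. *)
Definition psiV (i : 'I_m * 'I_N) (z : C) : C :=
  z ^+ i.1 / (B i.1).[z ^+ m] * ((kap i.2)%:C%C * w0 r m z ^+ i.2).

(** For a residue part P_j of a polynomial of degree at most n, the product B_j P_j is a polynomial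
    in [w0] of size at most [N], whose norm for the weight |z|^(2m-2) is bounded through [Bc]. One
    point is enough, since this bound serves on the diagonal. *)
Lemma kernel_upper z : (forall j, (B j).[z ^+ m] != 0) ->
  \sum_(k < n.+1) normc (phi k).[z] ^+ 2 <= c * \sum_i normc (psiV i z) ^+ 2.
Proof.
move=> Bz; apply: kernel_comparison => // x.
pose p : {poly C} := \sum_(k < n.+1) x k *: phi k.
have pE v : p.[v] = \sum_(k < n.+1) x k * (phi k).[v].
  by rewrite /p horner_sum; apply: eq_bigr => k _; rewrite hornerZ.
have ps : (size p <= n.+1)%N.
  apply: (leq_trans (size_sum _ _ _)); apply/bigmax_leqP => k _.
  by rewrite (leq_trans (size_scale_leq _ _))// (onp.1 k).1.
pose P (j : 'I_m) : {poly C} := \poly_(l < (n %/ m).+1) p`_(j + m * l).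
have pP v : p.[v] = \sum_(j < m) v ^+ j * (P j).[v ^+ m] by exact: horner_residues.
pose lin : {poly C} := 1%:P + (r ^+ m)%:C%C *: 'X.
pose Q j := (B j * P j) \Po lin.
have QE j v : (Q j).[w0 r m v] = (B j).[v ^+ m] * (P j).[v ^+ m].
  by rewrite /Q horner_comp /lin hornerD hornerC hornerZ hornerX w0K hornerM.
have Qs j : (size (Q j) <= N)%N.
  rewrite (leq_trans (size_comp_poly_leq _ _))//.
  have sl : ((size lin).-1 <= 1)%N.
    rewrite -subn1 leq_subLR (leq_trans (size_polyD _ _))// geq_max.
    rewrite (leq_trans (size_polyC_leq1 _))//=.
    by rewrite (leq_trans (size_scale_leq _ _))// size_polyX.
  have sB : ((size (B j * P j)%R).-1 <= N.-1)%N.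
    rewrite -!subn1 leq_sub2r// (leq_trans (size_polyMleq _ _))// (leq_trans (leq_pred _))//.
    by rewrite (leq_trans _ Nn)// leq_add ?BD// size_poly.
  by rewrite (@leq_trans (N.-1 * 1).+1)//; [rewrite ltnS leq_mul|rewrite muln1 prednK].
exists (fun i : 'I_m * 'I_N => (Q i.1)`_(i.2) / (kap i.2)%:C%C); split.
  rewrite -pE pP sum_pair/=.
  apply: eq_bigr => j _.
  have -> : (P j).[z ^+ m] = (Q j).[w0 r m z] / (B j).[z ^+ m] by rewrite QE mulrC mulKf.
  rewrite (horner_coef_wide _ (Qs j)) mulrA mulrC mulr_sumr.
  rewrite mulr_sumr.
  apply: eq_bigr => k _; rewrite /psiV/=.
  have k0 := kap_neq0 k; have b0 := Bz j.
  by field; rewrite k0 b0.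
rewrite -lee_fin sum_pair/=.
rewrite EFinM -(ONP_norm r01 m1 x onp).
under [X in (_ * X)%E]eq_integral do rewrite -pE pP.
have mcX := cmeasurableX m (@cmeasurable_toC1 R).
rewrite (@integral_lemG_residues R r m (fun j z => (P j).[z]) m0); last first.
  by move=> j; exact: cmeasurable_horner cmeasurable_toC1.
have mn k : measurable_fun setT (fun z : R * R => normc (toC z) ^+ (2 * k)).
  by under eq_fun do rewrite exprM; apply: measurable_funX; exact: cmeasurable_normc cmeasurable_toC1.
have E2 : (2 * m - 2 = 2 * m.-1)%N by lia.
pose f j (z : R * R) : R := normc (toC z) ^+ (2 * m - 2) * normc (Q j).[w0 r m (toC z)] ^+ 2.
have mf j : measurable_fun setT (f j).
  rewrite /f E2; apply: measurable_funM (mn _) _.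
  apply: cmeasurable_normc; apply: cmeasurable_horner.
  exact: cmeasurableM (cmeasurableD mcX (cmeasurable_cst _)) (cmeasurable_cst _).
have f0 j z' : 0 <= f j z' by rewrite /f mulr_ge0 ?exprn_ge0 ?normc_ge0.
have mg : measurable_fun setT (fun z : R * R => \sum_(j < m) normc (toC z) ^+ (2 * j) * normc (P j).[toC z ^+ m] ^+ 2).
  apply: measurable_sum => j; apply: measurable_funM (mn _) _.
  by apply: cmeasurable_normc; exact: cmeasurable_horner mcX.
rewrite -(integral_lemGZl c0 mg); last first.
  by move=> v; apply: sumr_ge0 => j _; rewrite mulr_ge0// exprn_ge0// normc_ge0.
apply: (@le_trans _ _ (\int[mu2]_(z in G) (\sum_(j < m) f j z)%R%:E)%E); last first.
  apply: le_integral_lemG.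
  - by apply: measurable_sum => j; exact: mf.
  - exact: measurable_funM (measurable_cst _) mg.
  - by move=> v; apply: sumr_ge0 => j _; exact: f0.
  - move=> v vG; rewrite mulr_sumr; apply: ler_sum => j _; rewrite /f QE normcM exprMn.
    rewrite [leLHS]mulrA [leRHS]mulrA ler_wpM2r ?exprn_ge0 ?normc_ge0//.
    by rewrite [leLHS]mulrC Bc// ltW.
rewrite (integral_lemG_sum mf f0) -sumEFin; apply: lee_sum => j _.
by rewrite (conformal_norm N0 (Qs j)).
Qed.

End upper.
End kernels.

(** * Uniform convergence of complex-valued functions *)

Section uniform.
Context {R : realType} {X : Type}.
Local Notation C := R[i].
Variable P : X -> Prop.
Implicit Types (F : nat -> X -> C) (G : X -> C).

(** A bound on the limit is part of the notion, so that products of convergent sequences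
    converge. *)
Definition ucvg F G :=
  (exists B : R, forall p, P p -> normc (G p) <= B) /\
  forall e : R, 0 < e -> exists N : nat, forall n, (N <= n)%N ->
    forall p, P p -> normc (F n p - G p) <= e.

Lemma ubound_ge1 G : (exists B : R, forall p, P p -> normc (G p) <= B) ->
  exists B : R, 1 <= B /\ forall p, P p -> normc (G p) <= B.
Proof.
move=> [B HB]; exists (Num.max 1 B); split; first by rewrite le_max lexx.
by move=> p /HB h; rewrite le_max h orbT.
Qed.

Lemma ucvg_cst G : (exists B : R, forall p, P p -> normc (G p) <= B) -> ucvg (fun=> G) G.
Proof.
by move=> B; split => // e e0; exists 0%N => n _ p _; rewrite subrr normc0 ltW.
Qed.

Lemma ucvg_const (c : C) : ucvg (fun _ _ => c) (fun=> c).
Proof. by apply: ucvg_cst; exists (normc c). Qed.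

Lemma ucvg_ext F F' G G' : (exists N : nat, forall n, (N <= n)%N -> forall p, P p -> F n p = F' n p) ->
  (forall p, P p -> G p = G' p) -> ucvg F G -> ucvg F' G'.
Proof.
move=> [N0 FF] GG [[B HB] H]; split.
  by exists B => p Pp; rewrite -GG// HB.
move=> e /H [N HN]; exists (maxn N0 N) => n; rewrite geq_max => /andP[n0 n1] p Pp.
by rewrite -FF// -GG// HN.
Qed.

Lemma ucvgD F1 F2 G1 G2 : ucvg F1 G1 -> ucvg F2 G2 ->
  ucvg (fun n p => F1 n p + F2 n p) (fun p => G1 p + G2 p).
Proof.
move=> [[B1 HB1] H1] [[B2 HB2] H2]; split.
  by exists (B1 + B2) => p Pp; rewrite (le_trans (ler_normcD _ _))// lerD// ?HB1 ?HB2.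
move=> e e0; have e2 : 0 < e / 2 by rewrite divr_gt0.
have [N1 HN1] := H1 _ e2; have [N2 HN2] := H2 _ e2.
exists (maxn N1 N2) => n; rewrite geq_max => /andP[n1 n2] p Pp.
rewrite opprD addrACA (le_trans (ler_normcD _ _))// [leRHS]splitr lerD// ?HN1 ?HN2//.
Qed.

Lemma ucvgM F1 F2 G1 G2 : ucvg F1 G1 -> ucvg F2 G2 ->
  ucvg (fun n p => F1 n p * F2 n p) (fun p => G1 p * G2 p).
Proof.
move=> [/ubound_ge1[B1 [b1 HB1]] H1] [/ubound_ge1[B2 [b2 HB2]] H2]; split.
  by exists (B1 * B2) => p Pp; rewrite normcM ler_pM ?normc_ge0 ?HB1 ?HB2.
(* The cap 1 turns the quadratic error [d * d] into [d]; the three terms then add up to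
   [d * (B1 + B2 + 1)]. *)
move=> e e0; pose d := Num.min 1 (e / (B1 + B2 + 1)).
have bp : 0 < B1 + B2 + 1 by lra.
have d0 : 0 < d by rewrite lt_min ltr01/= divr_gt0.
have d1 : d <= 1 by rewrite ge_min lexx.
have de : d * (B1 + B2 + 1) <= e by rewrite -ler_pdivlMr// ge_min lexx orbT.
have [N1 HN1] := H1 _ d0; have [N2 HN2] := H2 _ d0.
exists (maxn N1 N2) => n; rewrite geq_max => /andP[n1 n2] p Pp.
have h1 := HN1 _ n1 _ Pp; have h2 := HN2 _ n2 _ Pp; have k1 := HB1 _ Pp; have k2 := HB2 _ Pp.
set x := F1 n p in h1 *; set y := F2 n p in h2 *.
have -> : x * y - G1 p * G2 p = (x - G1 p) * (y - G2 p) + (x - G1 p) * G2 p + G1 p * (y - G2 p) by ring.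
rewrite (le_trans (ler_normcD _ _))//; apply: le_trans de.
have t1 : normc ((x - G1 p) * (y - G2 p)) <= d * 1.
  by rewrite normcM ler_pM ?normc_ge0// (le_trans h2).
have t2 : normc ((x - G1 p) * G2 p) <= d * B2 by rewrite normcM ler_pM ?normc_ge0.
have t3 : normc (G1 p * (y - G2 p)) <= B1 * d by rewrite normcM ler_pM ?normc_ge0.
have t4 := ler_normcD ((x - G1 p) * (y - G2 p)) ((x - G1 p) * G2 p).
by lra.
Qed.

Lemma ucvgX F G k : ucvg F G -> ucvg (fun n p => F n p ^+ k) (fun p => G p ^+ k).
Proof.
move=> h; elim: k => [|k IH]; first exact: ucvg_const.
apply: (ucvg_ext _ _ (ucvgM h IH)); first by exists 0%N => n _ p _; rewrite exprS.
by move=> p _; rewrite exprS.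
Qed.

Lemma ucvg_sum (I : Type) (s : seq I) (F : I -> nat -> X -> C) (G : I -> X -> C) :
  (forall i, ucvg (F i) (G i)) ->
  ucvg (fun n p => \sum_(i <- s) F i n p) (fun p => \sum_(i <- s) G i p).
Proof.
move=> h; elim: s => [|i s IH].
  apply: (ucvg_ext _ _ (ucvg_const 0)); first by exists 0%N => n _ p _; rewrite big_nil.
  by move=> p _; rewrite big_nil.
apply: (ucvg_ext _ _ (ucvgD (h i) IH)); first by exists 0%N => n _ p _; rewrite big_cons.
by move=> p _; rewrite big_cons.
Qed.

Lemma ucvg_horner (q : {poly C}) F G : ucvg F G ->
  ucvg (fun n p => q.[F n p]) (fun p => q.[G p]).
Proof.
move=> h; apply: (ucvg_ext _ _ (@ucvg_sum _ (index_enum _)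
  (fun (i : 'I_(size q)) n p => q`_i * F n p ^+ i) (fun i p => q`_i * G p ^+ i) _)).
- by exists 0%N => n _ p _; rewrite horner_coef.
- by move=> p _; rewrite horner_coef.
- by move=> i; apply: ucvgM (ucvg_const _) (ucvgX _ h).
Qed.

Lemma ucvg_conj F G : ucvg F G -> ucvg (fun n p => (F n p)^*%C) (fun p => (G p)^*%C).
Proof.
move=> [[B HB] H]; split; first by exists B => p Pp; rewrite normcJ HB.
move=> e /H [N HN]; exists N => n nN p Pp.
by rewrite -rmorphB normcJ HN.
Qed.

Lemma ucvgV F G (c : R) : 0 < c -> (forall p, P p -> c <= normc (G p)) -> ucvg F G ->
  ucvg (fun n p => (F n p)^-1) (fun p => (G p)^-1).
Proof.
move=> c0 Gc [[B HB] H]; split.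
  by exists c^-1 => p Pp; rewrite normcV lef_pV2 ?posrE ?Gc// (lt_le_trans c0)// Gc.
(* The first bound gives |F| >= c/2 for large n; the second pays for the denominator. *)
move=> e e0; pose d := Num.min (c / 2) (e * (c * (c / 2))).
have d0 : 0 < d by rewrite lt_min !mulr_gt0 ?invr_gt0.
have [N HN] := H _ d0; exists N => n nN p Pp; have h := HN _ nN _ Pp; have g := Gc _ Pp.
set x := F n p in h *; set y := G p in h g *.
have dc : d <= c / 2 by rewrite ge_min lexx.
have de : d <= e * (c * (c / 2)) by rewrite ge_min lexx orbT.
have x2 : c / 2 <= normc x.
  have := ler_normcD x (y - x); rewrite addrC subrK normc_distC; lra.
have x0 : x != 0 by rewrite -normc_eq0 gt_eqF// (lt_le_trans _ x2)// divr_gt0.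
have y0 : y != 0 by rewrite -normc_eq0 gt_eqF// (lt_le_trans c0).
have -> : x^-1 - y^-1 = - (x - y) / (x * y) by field; rewrite x0 y0.
rewrite normcM normcN normcV normcM ler_pdivrMr; last first.
  by apply: mulr_gt0; [rewrite (lt_le_trans _ x2)// divr_gt0|exact: lt_le_trans g].
rewrite (le_trans h)// (le_trans de)// ler_pM2l// mulrC ler_pM//; lra.
Qed.

Lemma ucvg_invn : ucvg (fun n _ => n%:R^-1) (fun=> 0).
Proof.
split; first by exists 0 => p _; rewrite normc0.
move=> e e0; exists (Num.truncn (e^-1)).+1 => n nN p _.
have n0 : 0 < n%:R :> R by rewrite ltr0n (leq_trans _ nN).
rewrite subr0 normcV normcMn_nat invf_ple ?posrE//.
by rewrite ltW// (lt_le_trans (truncnS_gt _))// ler_nat.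
Qed.

End uniform.

Lemma Num_conjE (R : realType) (x : R[i]) : Num.conj x = (x^*)%C.
Proof. by []. Qed.

(** * Limits of the rescaled sums *)

Section limits.
Context {R : realType} {X : Type}.
Local Notation C := R[i].
Variable P : X -> Prop.

(** Boundedness near the removable singularity 0 is read off from [SN_cexp] for one fixed [N]: [SN]
    at exp(A/N) is plainly bounded, and N^2 H(A)/2 is close to it. *)
Lemma Hfun_bounded (M : R) : 0 <= M -> exists B : R, forall A : C, normc A <= M -> normc (Hfun A) <= B.
Proof.
move=> M0; pose N := (Num.truncn (2 * M)).+1.
have NM : 2 * M <= N%:R by rewrite ltW// truncnS_gt.
have N1 : 1 <= N%:R :> R by rewrite ler1n.
pose S := \sum_(k < N) k.+1%:R * expR M ^+ k.
exists (2 * (S + N%:R * (expR M * (12 + 4 * M)))) => A AM.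
have h := SN_cexp (erefl : (0 < N)%N) M0 NM AM.
have hS : normc (SN N (cexp (A / N%:R))) <= S.
  rewrite (le_trans (ler_normc_sum _ _))// ler_sum// => k _.
  rewrite normcM normcMn_nat normcX ler_wpM2l ?ler0n// lerXn2r ?nnegrE ?normc_ge0 ?expR_ge0//.
  rewrite (le_trans (normc_cexp_le _))// ler_expR normcM normcV normcMn_nat.
  rewrite ler_pdivrMr ?(lt_le_trans ltr01)//.
  by rewrite (le_trans AM)// ler_peMr.
have e : normc (N%:R ^+ 2 * (Hfun A / 2)) <= S + N%:R * (expR M * (12 + 4 * M)).
  rewrite -[X in normc X](subKr (SN N (cexp (A / N%:R)))) addrC.
  by rewrite (le_trans (ler_normcD _ _))// addrC lerD// normcN.
rewrite normcM normcX normcMn_nat in e.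
have e2 : normc (Hfun A / 2) <= S + N%:R * (expR M * (12 + 4 * M)).
  by apply: le_trans e; rewrite ler_peMl ?normc_ge0// exprn_ege1.
by move: e2; rewrite normcM normcV normcMn_nat ler_pdivrMr// mulrC.
Qed.

Lemma ucvg_SN (N : nat -> nat) (q : C) (x : nat -> X -> C) (L : X -> C) :
  (forall K, exists n0, forall n, (n0 <= n)%N -> (K <= N n)%N) ->
  ucvg P (fun n _ => (N n)%:R / n%:R) (fun=> q) ->
  ucvg P (fun n p => (N n)%:R * (x n p - 1)) L ->
  ucvg P (fun n p => SN (N n) (x n p) / n%:R ^+ 2) (fun p => q ^+ 2 * (Hfun (L p) / 2)).
Proof.
move=> Noo qN [/ubound_ge1[M [M1 HM]] HL].
have M0 : 0 <= M by lra.
have H : ucvg P (fun n p => SN (N n) (x n p) / (N n)%:R ^+ 2) (fun p => Hfun (L p) / 2).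
  split.
    have [B HB] := Hfun_bounded M0; exists (B / 2) => p /HM/HB h.
    by rewrite normcM normcV normcMn_nat ler_pM2r.
  move=> e e0; have [eta [N0 [eta0 HN]]] := SN_asymp M0 e0.
  have [n1 Hn1] := HL _ eta0; have [n2 Hn2] := Noo N0.+1.
  exists (maxn n1 n2) => n; rewrite geq_max => /andP[k1 k2] p Pp.
  have N1 := Hn2 _ k2.
  have N0' : 0 < (N n)%:R :> R by rewrite ltr0n (leq_trans _ N1).
  have NC : (N n)%:R != 0 :> C by rewrite pnatr_eq0 -lt0n (leq_trans _ N1).
  have := HN _ (ltnW N1) _ _ (HM _ Pp) (Hn1 _ k1 _ Pp).
  have -> : SN (N n) (x n p) / (N n)%:R ^+ 2 - Hfun (L p) / 2 =
    (SN (N n) (x n p) - (N n)%:R ^+ 2 * (Hfun (L p) / 2)) / (N n)%:R ^+ 2.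
    by rewrite mulrBl; congr (_ - _); rewrite [RHS]mulrAC divff ?mul1r// expf_neq0.
  by rewrite [normc (_ / _ ^+ 2)]normcM normcV normcX normcMn_nat ler_pdivrMr// exprn_gt0.
apply: (ucvg_ext _ _ (ucvgM (ucvgX 2 qN) H)) => //.
have [n2 Hn2] := Noo 1%N; exists n2 => n /Hn2 N1 p Pp.
have NC : (N n)%:R != 0 :> C by rewrite pnatr_eq0 -lt0n.
by rewrite expr_div_n [LHS]mulrC mulrA -mulrA mulrA divfK// expf_neq0.
Qed.

Lemma ucvg_ratio (N : nat -> nat) (m D : nat) : (0 < m)%N ->
  (forall n, (m * N n <= n + D)%N /\ (n <= m * N n + D)%N) ->
  ucvg P (fun n _ => (N n)%:R / n%:R) (fun=> m%:R^-1 : C).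
Proof.
move=> m0 H.
have m0C : m%:R != 0 :> C by rewrite pnatr_eq0 -lt0n.
have m0R : 1 <= m%:R :> R by rewrite ler1n.
split; first by exists (normc (m%:R^-1 : C)).
move=> e e0; have [n0 Hn0] := (@ucvg_invn R unit (fun=> True)).2 _ (divr_gt0 e0 (ltr0Sn R D)).
exists n0.+1 => n nn p _; have n1 : (0 < n)%N by exact: leq_trans nn.
have := Hn0 _ (ltnW nn) tt I; rewrite subr0 normcV normcMn_nat.
rewrite ler_pdivlMr ?ltr0Sn// => hn.
have n0C : n%:R != 0 :> C by rewrite pnatr_eq0 -lt0n.
have n0R : 0 < n%:R :> R by rewrite ltr0n.
have -> : (N n)%:R / n%:R - m%:R^-1 = ((m * N n)%:R - n%:R) / (m%:R * n%:R) :> C.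
  by rewrite natrM; field; rewrite n0C m0C.
have d : normc ((m * N n)%:R - n%:R : C) <= D%:R.
  have [h1 h2] := H n.
  have -> : (m * N n)%:R - n%:R = ((m * N n)%:R - n%:R : R)%:C%C.
    by rewrite rmorphB !rmorph_nat.
  rewrite normcR ler_norml; apply/andP; split.
    by move: h2; rewrite -(ler_nat R) natrD; lra.
  by move: h1; rewrite -(ler_nat R) natrD; lra.
rewrite normcM normcV normcM !normcMn_nat (le_trans _ hn)// mulrC.
rewrite [m%:R * n%:R]mulrC invfM -mulrA ler_pM2l ?invr_gt0//.
rewrite mulrC ler_pdivrMr ?(lt_le_trans ltr01)// (le_trans d)//.
by rewrite (@le_trans _ _ D.+1%:R)// ?ler_nat// ler_peMr.
Qed.

End limits.

(** * Points near the lemniscate *)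

Section points.
Context {R : realType}.
Local Notation C := R[i].
Local Notation X := (C * C * C)%type.
Variables (r : R) (m : nat) (M : R).
Hypotheses (r01 : 0 < r < 1) (m1 : (1 < m)%N).

(** A parameter is a triple (z0, a, b) with components [p.1.1], [p.1.2], [p.2]; the limits below are
    uniform over this set. *)
Definition Par (p : X) : Prop :=
  [/\ normc (p.1.1 ^+ m - 1) = r ^+ m, normc p.1.2 <= M & normc p.2 <= M].

Definition pt (d : X -> C) (n : nat) (p : X) : C := p.1.1 + d p / n%:R.

Let r0 : 0 < r. Proof. by case/andP: r01. Qed.
Let rm0 : 0 < r ^+ m. Proof. by rewrite exprn_gt0. Qed.
Let rmC : (r ^+ m)%:C%C != 0 :> C. Proof. by rewrite eq_complex /= negb_and gt_eqF. Qed.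
Let rm1 : r ^+ m < 1.
Proof. by case/andP: r01 => _ h; rewrite exprn_ilt1 ?ltW// -lt0n ltnW. Qed.

Lemma Par_le2 p : Par p -> normc p.1.1 <= 2.
Proof.
case=> h _ _; rewrite leNgt; apply/negP => z2.
have z1 : normc p.1.1 ^+ m <= 2.
  have := ler_normcD (p.1.1 ^+ m - 1) 1; rewrite subrK normcX normc1 h => /le_trans; apply.
  by rewrite -[leRHS]/(1 + 1 : R) lerD2r ltW.
have : normc p.1.1 <= normc p.1.1 ^+ m.
  by apply: ler_eXnr; [exact: ltnW|rewrite (le_trans _ (ltW z2))// ler1n].
lra.
Qed.

Lemma ucvg_center : ucvg Par (fun _ p => p.1.1) (fun p => p.1.1).
Proof. by apply: ucvg_cst; exists 2 => p /Par_le2. Qed.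

Section direction.
Variable d : X -> C.
Hypothesis dM : forall p, Par p -> normc (d p) <= M.

Lemma ucvg_dir : ucvg Par (fun _ p => d p) d.
Proof. by apply: ucvg_cst; exists M. Qed.

Lemma ucvg_pt : ucvg Par (pt d) (fun p => p.1.1).
Proof.
apply: (ucvg_ext _ _ (ucvgD ucvg_center (ucvgM ucvg_dir (ucvg_invn _)))).
  by exists 0%N.
by move=> p _; rewrite mulr0 addr0.
Qed.

Lemma ucvg_w0 : ucvg Par (fun n p => w0 r m (pt d n p)) (fun p => w0 r m p.1.1).
Proof.
apply: (ucvgM _ (ucvg_const _ _)); apply: (ucvgD _ (ucvg_const _ _)).
exact: ucvgX ucvg_pt.
Qed.

(** The derivative of [w0] along [d]. Factoring x^m - y^m makes the difference quotient an explicit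
    sum, so uniformity follows from the rules for sums and products. *)
Lemma ucvg_w0_diff :
  ucvg Par (fun n p => n%:R * (w0 r m (pt d n p) - w0 r m p.1.1))
    (fun p => m%:R * (d p * p.1.1 ^+ (m - 1) / (r ^+ m)%:C%C)).
Proof.
have S := @ucvg_sum R X Par 'I_m (index_enum _)
   (fun (i : 'I_m) n p => pt d n p ^+ (m.-1 - i) * p.1.1 ^+ i)
   (fun (i : 'I_m) p => p.1.1 ^+ (m.-1 - i) * p.1.1 ^+ i)
   (fun i => ucvgM (ucvgX _ ucvg_pt) (ucvgX _ ucvg_center)).
apply: (ucvg_ext _ _ (ucvgM (ucvgM ucvg_dir S) (ucvg_const _ ((r ^+ m)%:C%C^-1)))).
  exists 1%N => n n0 p _.
  have n0C : n%:R != 0 :> C by rewrite pnatr_eq0 -lt0n.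
  rewrite /w0 -mulrBl opprB addrA subrK subrXX mulrA; congr (_ / _).
  by rewrite mulrA; congr (_ * _); rewrite /pt [_ + d p / _]addrC addrK mulrC divfK.
move=> p _.
rewrite (eq_bigr (fun=> p.1.1 ^+ (m - 1))); last first.
  by move=> i _; rewrite -exprD subn1 subnK// -ltnS prednK// ltnW.
by rewrite sumr_const card_ord -mulr_natl; ring.
Qed.

End direction.

Lemma w0_conj z : normc (z ^+ m - 1) = r ^+ m -> w0 r m z * (w0 r m z)^*%C = 1.
Proof.
move=> h; rewrite -sqr_normcE /w0 normcM normcV h normcR gtr0_norm// divff ?gt_eqF//.
by rewrite expr1n.
Qed.

(** At z0 the product is |w_0|^2 = 1, and the product rule gives the first-order term m A; the
    factor m is later cancelled by N/n -> 1/m. *)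
Lemma ucvg_w0_prod :
  ucvg Par (fun n p => n%:R * (w0 r m (pt (fun p => p.1.2) n p) *
                               (w0 r m (pt (fun p => p.2) n p))^*%C - 1))
    (fun p => m%:R * Acoef r m p.1.1 p.1.2 p.2).
Proof.
have aM p : Par p -> normc p.1.2 <= M by case.
have bM p : Par p -> normc p.2 <= M by case.
have W : ucvg Par (fun _ p => w0 r m p.1.1) (fun p => w0 r m p.1.1).
  apply: ucvg_cst; exists 1 => p [h _ _].
  by rewrite /w0 normcM normcV h normcR gtr0_norm// divff ?gt_eqF.
have := ucvgD (ucvgM (ucvg_w0_diff aM) (ucvg_conj (ucvg_w0 bM)))
              (ucvgM W (ucvg_conj (ucvg_w0_diff bM))).
apply: ucvg_ext.
  exists 0%N => n _ p [/w0_conj h _ _].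
  move: h (w0 r m (pt (fun p => p.1.2) n p)) (w0 r m (pt snd n p)) => + u v.
  move: (w0 r m p.1.1) => w h.
  rewrite (rmorphM (@conjc R)) (rmorphB (@conjc R)) (rmorph_nat (@conjc R)).
  by rewrite -h; ring.
move=> p _; rewrite /Acoef !Num_conjE; move: (w0 r m p.1.1) => w.
have -> : conjc (m%:R * (p.2 * p.1.1 ^+ (m - 1) / (r ^+ m)%:C%C)) =
    m%:R * (conjc p.2 * conjc p.1.1 ^+ (m - 1) / (r ^+ m)%:C%C).
  rewrite !(rmorphM (@conjc R)) (fmorphV (@conjc R)) (rmorphXn (@conjc R)) (rmorph_nat (@conjc R)).
  by congr (_ * (_ / _)); exact: conjc_real.
by ring.
Qed.

Local Notation kappa := (m%:R / (pi * r ^+ (2 * m)) : R).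

(** The common form of the two explicit kernels: [f j z] is z^j T_j(z^m) for the lower one and z^j /
    B_j(z^m) for the upper one. *)
Definition ksum (f : 'I_m -> C -> C) (N : nat) (z w : C) : C :=
  \sum_(i : 'I_m * 'I_N) (f i.1 z * ((kap r m i.2)%:C%C * w0 r m z ^+ i.2)) *
     conjc (f i.1 w * ((kap r m i.2)%:C%C * w0 r m w ^+ i.2)).

Lemma ksumE f N z w : ksum f N z w =
  kappa%:C%C * \sum_(j < m) f j z * conjc (f j w) * SN N (w0 r m z * conjc (w0 r m w)).
Proof.
rewrite /ksum sum_pair mulr_sumr; apply: eq_bigr => j _.
rewrite /SN !mulr_sumr; apply: eq_bigr => k _ /=.
move: (w0 r m z) (w0 r m w) => u v.
have -> : conjc (f j w * ((kap r m k)%:C%C * v ^+ k)) =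
    conjc (f j w) * ((kap r m k)%:C%C * conjc v ^+ k).
  rewrite !(rmorphM (@conjc R)) (rmorphXn (@conjc R)).
  by congr (_ * (_ * _)); exact: conjc_real.
have -> : k.+1%:R = (k.+1%:R : R)%:C%C by rewrite rmorph_nat.
have : (kappa%:C * (k.+1%:R : R)%:C = (kap r m k)%:C * (kap r m k)%:C)%C.
  by rewrite -!rmorphM/= -kap2// expr2.
move: (f j z) (conjc (f j w)) (conjc v) => x y v'.
move: (kappa%:C)%C ((k.+1%:R : R)%:C)%C ((kap r m k)%:C)%C => K L S e.
rewrite exprMn.
transitivity (S * S * (x * y * u ^+ k * v' ^+ k)); first by ring.
by rewrite -e; ring.
Qed.

Lemma ksum_diagE f N z : ksum f N z z =
  (\sum_(i : 'I_m * 'I_N) normc (f i.1 z * ((kap r m i.2)%:C%C * w0 r m z ^+ i.2)) ^+ 2)%:C%C.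
Proof. by rewrite rmorph_sum; apply: eq_bigr => i _; rewrite -sqr_normcE. Qed.

Definition limK (p : X) : C := Hfun (Acoef r m p.1.1 p.1.2 p.2) *
  ((normc p.1.1) ^+ (2 * m - 2) / (2 * pi * r ^+ (2 * m)))%:C%C.

Lemma limK_bounded : exists B : R, 0 <= B /\ forall p, Par p ->
  normc (limK p) <= B /\ normc (Hfun (Acoef r m p.1.1 p.1.2 p.2)) <= B.
Proof.
have [[B HB] _] := ucvg_w0_prod.
have m1R : 1 <= m%:R :> R by rewrite ler1n ltnW.
have HA p : Par p -> normc (Acoef r m p.1.1 p.1.2 p.2) <= Num.max 0 B.
  move=> /HB; rewrite normcM normcMn_nat => h; rewrite le_max; apply/orP; right.
  by apply: le_trans h; rewrite ler_peMl ?normc_ge0.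
have M0 : 0 <= Num.max 0 B by rewrite le_max lexx.
have [H HH] := Hfun_bounded M0.
pose c := 2 ^+ (2 * m - 2) / (2 * pi * r ^+ (2 * m)).
have p0 : 0 < 2 * pi * r ^+ (2 * m) by rewrite !mulr_gt0 ?pi_gt0// exprn_gt0.
have c0 : 0 <= c by rewrite divr_ge0 ?ltW// exprn_ge0.
exists (Num.max 0 H * (c + 1)); split.
  by rewrite mulr_ge0 ?addr_ge0// le_max lexx.
move=> p Pp; have hH : normc (Hfun (Acoef r m p.1.1 p.1.2 p.2)) <= Num.max 0 H.
  by rewrite le_max HH ?orbT// HA.
split; last by rewrite (le_trans hH)// ler_peMr ?lerDr// le_max lexx.
rewrite /limK normcM normcR ler_pM ?normc_ge0//.
rewrite ger0_norm; last by rewrite divr_ge0 ?exprn_ge0 ?normc_ge0// ltW.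
rewrite (@le_trans _ _ c) ?lerDl// ler_pM2r ?invr_gt0//.
by rewrite lerXn2r ?nnegrE ?normc_ge0// Par_le2.
Qed.

(** [C1] is chosen before [f], [N], [D] and [eta]: the multipliers and their degrees depend on the
    accuracy [eta], while the error has to stay a fixed multiple of it. *)
Lemma ksum_asymp : exists C1 : R, 0 <= C1 /\
  forall (f : 'I_m -> C -> C) (N : nat -> nat) (D : nat) (eta : R), 0 < eta ->
  (forall j (d : X -> C), (forall p, Par p -> normc (d p) <= M) ->
     ucvg Par (fun n p => f j (pt d n p)) (fun p => f j p.1.1)) ->
  (forall n, (m * N n <= n + D)%N /\ (n <= m * N n + D)%N) ->
  (forall p, Par p -> forall j,
     `|normc (f j p.1.1) ^+ 2 - normc p.1.1 ^+ (2 * m - 2)| <= eta * normc p.1.1 ^+ (2 * m - 2)) ->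
  exists n0 : nat, forall n, (n0 <= n)%N -> forall p, Par p ->
    normc (ksum f (N n) (pt (fun p => p.1.2) n p) (pt (fun p => p.2) n p) / n%:R ^+ 2 - limK p)
      <= C1 * eta.
Proof.
have [HB [HB0 Hb]] := limK_bounded.
have m0 : (0 < m)%N by exact: ltnW.
have m0C : m%:R != 0 :> C by rewrite pnatr_eq0 -lt0n.
have k0 : 0 <= kappa by rewrite divr_ge0// mulr_ge0 ?pi_ge0// exprn_ge0// ltW.
pose C0 := kappa * (m%:R * 2 ^+ (2 * m - 2)) * (normc (m%:R^-1 ^+ 2 : C) * (HB / 2)).
have C00 : 0 <= C0.
  apply: mulr_ge0; apply: mulr_ge0 => //; last by rewrite divr_ge0.
  exact: normc_ge0.
(* [C0] accounts for replacing |f_j(z0)|^2 by |z0|^(2m-2), the added 1 for the distance to the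
   uniform limit. *)
exists (C0 + 1); split; first by rewrite addr_ge0.
move=> f N D eta eta0 fc ND fz.
have aM p : Par p -> normc p.1.2 <= M by case.
have bM p : Par p -> normc p.2 <= M by case.
have Noo K : exists n0, forall n, (n0 <= n)%N -> (K <= N n)%N.
  exists (m * K + D)%N => n hn; have [_ h] := ND n.
  by rewrite -(leq_pmul2l m0) -(leq_add2r D) (leq_trans hn).
have rat := @ucvg_ratio R X Par N m D m0 ND.
pose x n p := w0 r m (pt (fun p => p.1.2) n p) * conjc (w0 r m (pt (fun p => p.2) n p)).
have xc : ucvg Par (fun n p => (N n)%:R * (x n p - 1)) (fun p => Acoef r m p.1.1 p.1.2 p.2).
  apply: (ucvg_ext _ _ (ucvgM rat ucvg_w0_prod)).
    exists 1%N => n n0 p _; have n0C : n%:R != 0 :> C by rewrite pnatr_eq0 -lt0n.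
    by rewrite mulrA divfK.
  by move=> p _; rewrite mulrA mulVf// mul1r.
have Sc := ucvg_SN Noo rat xc.
have fj (j : 'I_m) := ucvgM (ucvgM (fc j _ aM) (ucvg_conj (fc j _ bM))) Sc.
have fs := ucvgM (ucvg_const Par kappa%:C%C) (@ucvg_sum _ _ _ _ (index_enum _) _ _ fj).
have [n0 Hn0] := fs.2 _ eta0.
exists n0.+1 => n nn p Pp.
have n0C : n%:R != 0 :> C by rewrite pnatr_eq0 -lt0n (leq_trans _ nn).
move: (Hn0 n (ltnW nn) p Pp); set S := _ * _; set L := _ * _ => h.
have -> : ksum f (N n) (pt (fun p => p.1.2) n p) (pt (fun p => p.2) n p) / n%:R ^+ 2 = S.
  rewrite ksumE /S -mulrA; congr (_ * _).
  by rewrite mulr_suml; apply: eq_bigr => j _; rewrite -mulrA.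
rewrite -(subrK L S) -addrA mulrDl mul1r addrC (le_trans (ler_normcD _ _))// lerD//.
set hA := Hfun (Acoef r m p.1.1 p.1.2 p.2).
have Ld : L - limK p = kappa%:C%C *
   (\sum_(j < m) (normc (f j p.1.1) ^+ 2 - normc p.1.1 ^+ (2 * m - 2)))%:C%C *
   (m%:R^-1 ^+ 2 * (hA / 2)).
  (* The m residue classes, kappa = m / (pi r^(2m)) and the limit m^(-2) H/2 of SN / n^2 produce
     exactly the constant of [limK]. *)
  have lE : limK p = kappa%:C%C *
     (\sum_(j < m) normc p.1.1 ^+ (2 * m - 2))%:C%C * (m%:R^-1 ^+ 2 * (hA / 2)).
    rewrite sumr_const card_ord -[normc _ ^+ _ *+ m]mulr_natl /limK -/hA.
    have pi0 : (pi : R)%:C%C != 0 :> C by rewrite eq_complex/= negb_and gt_eqF// pi_gt0.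
    have r0C : r%:C%C != 0 :> C by rewrite eq_complex/= negb_and gt_eqF.
    rewrite !rmorphM/= !fmorphV/= !rmorphM/= !rmorphXn/= !rmorph_nat.
    by move: (pi%:C)%C pi0 => c c0; field; rewrite c0 m0C expf_neq0.

  rewrite lE sumrB rmorphB mulrBr mulrBl; congr (_ - _).
  rewrite /L -mulrA; congr (_ * _); rewrite rmorph_sum mulr_suml.
  by apply: eq_bigr => j _; rewrite -sqr_normcE.
have z2 : normc p.1.1 ^+ (2 * m - 2) <= 2 ^+ (2 * m - 2).
  by rewrite lerXn2r ?nnegrE ?normc_ge0// Par_le2.
have sb : `|\sum_(j < m) (normc (f j p.1.1) ^+ 2 - normc p.1.1 ^+ (2 * m - 2))|
    <= m%:R * 2 ^+ (2 * m - 2) * eta.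
  rewrite (le_trans (ler_norm_sum _ _ _))//.
  rewrite (@le_trans _ _ (\sum_(j < m) (2 ^+ (2 * m - 2) * eta)))//.
    apply: ler_sum => j _; rewrite (le_trans (fz p Pp j))// mulrC ler_pM2r//.
  by rewrite sumr_const card_ord -[_ * eta *+ m]mulr_natl mulrA.
have Hp := (Hb _ Pp).2.
rewrite Ld /C0; move: (m%:R^-1 ^+ 2 : C) => Q.
rewrite !normcM !normcR (ger0_norm k0) normcV normcMn_nat.
rewrite [leRHS]mulrAC -[kappa * _ * eta]mulrA; apply: ler_pM => //.
- by rewrite mulr_ge0.
- by rewrite !mulr_ge0 ?normc_ge0// invr_ge0.
- exact: ler_wpM2l.
- by apply: ler_wpM2l; [exact: normc_ge0|rewrite ler_pM2r].
Qed.

End points.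

(** * Polarization and the diagonal differences *)

Section polarization.
Context {R : realType}.
Local Notation C := R[i].

Lemma sqr_normcDM (x y lam : C) : normc (x + lam * y) ^+ 2 =
  normc x ^+ 2 + normc lam ^+ 2 * normc y ^+ 2 + 2 * complex.Re (conjc lam * (x * conjc y)).
Proof.
by rewrite !normc2E; case: x y lam => [a b] [c d] [e f]; simpc => /=; ring.
Qed.

Lemma sum_sqr_normcDM (I : finType) (a b : I -> C) (lam : C) :
  \sum_i normc (a i + lam * b i) ^+ 2 = \sum_i normc (a i) ^+ 2 +
    normc lam ^+ 2 * \sum_i normc (b i) ^+ 2 +
    2 * complex.Re (conjc lam * \sum_i a i * conjc (b i)).
Proof.
under eq_bigr do rewrite sqr_normcDM.
rewrite !big_split/= -!mulr_sumr; congr (_ + 2 * _).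
by rewrite mulr_sumr (raddf_sum (@complex.Re R)).
Qed.

(* A domination of the quadratic forms of two kernels controls their
   difference off the diagonal by the differences on the diagonal. *)
Lemma kernel_polarization (I K : finType) (a b : I -> C) (a' b' : K -> C) (c : R) : 0 < c ->
  (forall lam, \sum_i normc (a i + lam * b i) ^+ 2 <=
     c * \sum_k normc (a' k + lam * b' k) ^+ 2) ->
  2 * normc (\sum_k a' k * conjc (b' k) - c^-1%:C%C * \sum_i a i * conjc (b i)) <=
  (\sum_k normc (a' k) ^+ 2 - c^-1 * \sum_i normc (a i) ^+ 2) +
  (\sum_k normc (b' k) ^+ 2 - c^-1 * \sum_i normc (b i) ^+ 2).
Proof.
move=> c0 H; set D := _ - _.
have c1 : 0 < c^-1 by rewrite invr_gt0.
have H1 lam : normc lam = 1 -> - (2 * complex.Re (conjc lam * D)) <=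
  (\sum_k normc (a' k) ^+ 2 - c^-1 * \sum_i normc (a i) ^+ 2) +
  (\sum_k normc (b' k) ^+ 2 - c^-1 * \sum_i normc (b i) ^+ 2).
  move=> l1; have := H lam; rewrite !sum_sqr_normcDM l1 expr1n !mul1r.
  rewrite -(ler_pM2l c1) mulrA mulVf ?gt_eqF// mul1r.
  have -> : complex.Re (conjc lam * D) = complex.Re (conjc lam * \sum_k a' k * conjc (b' k)) -
      c^-1 * complex.Re (conjc lam * \sum_i a i * conjc (b i)).
    rewrite /D mulrBr raddfB/=; congr (_ - _).
    by case: (\sum_i a i * _) => x y; case: (lam) => u v; simpc => /=; ring.
  lra.
have [D0|D0] := eqVneq D 0.
  by have := H1 1 normc1; rewrite D0 mulr0 normc0 !mulr0 oppr0.
have d0 : 0 < normc D by rewrite lt_def normc_eq0 D0 normc_ge0.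
(* This unimodular [lam] makes [conjc lam * D] equal to -|D|, the extreme case of the inequality. *)
have := H1 (- (D / (normc D)%:C%C)).
have -> : conjc (- (D / (normc D)%:C%C)) * D = (- normc D)%:C%C.
  have dC : (normc D)%:C%C != 0 :> C by rewrite eq_complex/= negb_and gt_eqF.
  rewrite (rmorphN (@conjc R)) (rmorphM (@conjc R)) (fmorphV (@conjc R)).
  rewrite mulNr mulrAC [_ * D]mulrC -[D * _]/(D * conjc D) -sqr_normcE.
  rewrite -[X in _ / X]/(conjc (normc D)%:C%C) conjc_real rmorphXn expr2 mulfK//.
  by rewrite rmorphN.
rewrite normcN normcM normcV normcR gtr0_norm// divff ?gt_eqF// => /(_ erefl) /=.
lra.
Qed.

End polarization.

(** Bounds one diagonal difference of the polarization inequality: [lo] and [up] are both t l up to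
    t E, while (1 + d) - 1/(1 + d) <= 2d and (1 + d) + 1/(1 + d) <= 3. *)
Lemma diagonal_gap (R : realType) (S lo up t l d H E : R) : 0 < t -> 0 < d -> d <= 1 / 2 -> 0 <= E ->
  S <= (1 + d) * up -> `|lo / t - l| <= E -> `|up / t - l| <= E -> `|l| <= H ->
  S - (1 + d)^-1 * lo <= t * (2 * d * H + 3 * E).
Proof.
move=> t0 d0 d2 E0 Sup hlo hup lH; set ci := (1 + d)^-1.
have c0 : 0 < 1 + d by lra.
have ci0 : 0 < ci by rewrite invr_gt0.
have cc : (1 + d) * ci = 1 by rewrite divff// gt_eqF.
have ci1 : ci <= 1 by rewrite invf_le1// lerDl ltW.
have dci : d * ci <= d by rewrite ler_piMr// ltW.
have up1 : up <= t * (l + E).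
  by move: hup; rewrite ler_norml => /andP[_]; rewrite lerBlDl ler_pdivrMr// mulrC.
have lo1 : t * (l - E) <= lo.
  move: hlo; rewrite ler_norml => /andP[]; rewrite lerBrDl => + _.
  by rewrite ler_pdivlMr// mulrC.
have h1 : S <= (1 + d) * (t * (l + E)) by apply: (le_trans Sup); rewrite ler_pM2l.
have h2 : ci * (t * (l - E)) <= ci * lo by rewrite ler_pM2l.
have h3 : (1 + d) * (l + E) - ci * (l - E) <= 2 * d * H + 3 * E.
  have g : (1 + d - ci) * l <= (1 + d - ci) * H.
    by apply: ler_wpM2l; [clear - ci1 d0; lra|exact: le_trans (ler_norm _) lH].
  have g2 : (1 + d - ci) * H <= 2 * d * H.
    by apply: ler_wpM2r; [exact: le_trans lH|clear - cc dci; lra].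
  have g3 : (1 + d + ci) * E <= 3 * E by apply: ler_wpM2r => //; clear - d2 ci1; lra.
  by clear - g g2 g3; lra.
have := ler_wpM2l (ltW t0) h3; lra.
Qed.

(** Truncated subtraction returns 0 while n/m <= D + 1; the constant [m * D.+2] covers this range as
    well. *)
Lemma lower_count (m n D : nat) : (0 < m)%N ->
  (m * (n %/ m - D.+1) <= n + m * D.+2)%N /\ (n <= m * (n %/ m - D.+1) + m * D.+2)%N.
Proof.
move=> m0; split.
  rewrite (leq_trans _ (leq_addr _ _))// (leq_trans (leq_mul (leqnn m) (leq_subr _ _)))//.
  by rewrite mulnC leq_trunc_div.
rewrite -mulnDr (leq_trans (ltnW (ltn_ceil n m0)))// mulnC leq_mul//.
by rewrite -leq_subLR; lia.
Qed.

Lemma upper_count (m n D : nat) : (0 < m)%N ->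
  (m * (D + (n %/ m).+1) <= n + m * D.+1)%N /\ (n <= m * (D + (n %/ m).+1) + m * D.+1)%N.
Proof.
move=> m0; split.
  by rewrite -addSnnS mulnDr addnC leq_add2r mulnC leq_trunc_div.
rewrite (leq_trans _ (leq_addr _ _))// mulnDr (leq_trans _ (leq_addl _ _))//.
by rewrite mulnC ltnW// ltn_ceil.
Qed.

(** * The limit of K_n / n^2 *)

Section kernel_limit.
Context {R : realType}.
Local Notation C := R[i].
Local Notation X := (C * C * C)%type.
Variables (r : R) (m : nat) (phi : nat -> {poly C}) (M : R).
Hypotheses (r01 : 0 < r < 1) (m1 : (1 < m)%N) (onp : is_ONP r m phi).
Local Notation Par := (Par r m M).

Let m0 : (0 < m)%N. Proof. exact: ltnW. Qed.
Let r0 : 0 < r. Proof. by case/andP: r01. Qed.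
Let rho : 0 <= r ^+ m < 1.
Proof. by case/andP: r01 => _ h; rewrite exprn_ge0 ?exprn_ilt1 ?ltW// -lt0n. Qed.

Lemma expn_weightE (j : 'I_m) (z : C) :
  normc z ^+ (2 * m - 2) = normc z ^+ (2 * (m - 1 - j)) * normc z ^+ (2 * j).
Proof. by rewrite -exprD; congr (_ ^+ _); have := ltn_ord j; lia. Qed.

(** [T j] imitates z^(m-1-j) in modulus, which raises the weight |z|^(2j) to |z|^(2m-2). *)
Lemma lower_weights (d : R) : 0 < d -> exists T : 'I_m -> {poly C}, forall (j : 'I_m) z,
  normc (z ^+ m - 1) <= r ^+ m ->
  normc (T j).[z ^+ m] ^+ 2 * normc z ^+ (2 * j) <= (1 + d) * normc z ^+ (2 * m - 2) /\
  `|normc (z ^+ j * (T j).[z ^+ m]) ^+ 2 - normc z ^+ (2 * m - 2)| <= d * normc z ^+ (2 * m - 2).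
Proof.
move=> d0.
have [T HT] := choice (fun j : 'I_m => weight_approx rho m0 (m - 1 - j) d0).
exists T => j z /(HT j) h.
rewrite normcM exprMn normcX -exprM [(j * 2)%N]mulnC (expn_weightE j).
have v0 : 0 <= normc z ^+ (2 * j) by rewrite exprn_ge0 ?normc_ge0.
rewrite mulrA ler_wpM2r//; last first.
  by move: h; rewrite ler_norml => /andP[_]; rewrite mulrDl mul1r lerBlDl.
split => //; rewrite [_ ^+ _ * normc _ ^+ 2]mulrC -mulrBl normrM (ger0_norm v0).
by rewrite mulrA ler_wpM2r.
Qed.

(** [B j] imitates z^(j+1-m) in modulus. The third clause serves to bound [B j] away from 0, for the
    convergence of its inverse. *)
Lemma upper_weights (d : R) : 0 < d -> d <= 1 / 2 -> exists B : 'I_m -> {poly C},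
  (forall (j : 'I_m) z, normc (z ^+ m - 1) <= r ^+ m ->
  [/\ normc (B j).[z ^+ m] ^+ 2 * normc z ^+ (2 * m - 2) <= (1 + d) * normc z ^+ (2 * j),
     (B j).[z ^+ m] != 0,
     1 / 2 <= (normc (B j).[z ^+ m] * normc z ^+ (m - 1 - j)) ^+ 2 &
  `|normc (z ^+ j / (B j).[z ^+ m]) ^+ 2 - normc z ^+ (2 * m - 2)| <=
      (2 * d) * normc z ^+ (2 * m - 2)]).
Proof.
move=> d0 d2.
have sm (j : 'I_m) : (m - 1 - j <= m)%N by rewrite -subnDA leq_subr.
have [B HB] := choice (fun j : 'I_m => inv_weight_approx rho m0 (sm j) d0).
exists B => j z /(HB j).
have -> : normc (z ^+ j / (B j).[z ^+ m]) ^+ 2 = normc z ^+ (2 * j) / normc (B j).[z ^+ m] ^+ 2.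
  by rewrite normcM normcX normcV exprMn exprVn -exprM [(j * 2)%N]mulnC.
have -> : (normc (B j).[z ^+ m] * normc z ^+ (m - 1 - j)) ^+ 2 =
    normc (B j).[z ^+ m] ^+ 2 * normc z ^+ (2 * (m - 1 - j)).
  by rewrite exprMn -exprM [((_ - _) * 2)%N]mulnC.
rewrite (expn_weightE j).
have v0 : 0 <= normc z ^+ (2 * j) by rewrite exprn_ge0 ?normc_ge0.
have u0 : 0 <= normc z ^+ (2 * (m - 1 - j)) by rewrite exprn_ge0 ?normc_ge0.
have y0 : 0 <= normc (B j).[z ^+ m] ^+ 2 by rewrite exprn_ge0 ?normc_ge0.
rewrite -normc_eq0 -[normc _ == 0](expf_eq0 _ 2).
move: (normc z ^+ (2 * j)) (normc z ^+ (2 * (m - 1 - j))) (normc (B j).[z ^+ m] ^+ 2) v0 u0 y0.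
move=> v u y v0 u0 y0 h; have /andP[h1 h2] : 1 / 2 <= y * u <= 1 + d.
  by move: h; rewrite ler_norml => /andP[]; lra.
have yn : y != 0 by apply/eqP => yE; move: h1; rewrite yE mul0r; lra.
have yp : 0 < y by rewrite lt_def yn.
split => //; first by rewrite mulrA ler_wpM2r.
(* As |1 - y u| <= d and 1/y <= 2u, this is at most 2 d u v: the origin of the factor 2. *)
have -> : v / y - u * v = v * (1 - y * u) / y by field.
have yi : 0 < y^-1 by rewrite invr_gt0.
rewrite normrM [`|v * _|]normrM (ger0_norm v0) (gtr0_norm yi) ler_pdivrMr// distrC mulrC.
apply: (@le_trans _ _ (d * v)); first by rewrite ler_wpM2r.
have dv : 0 <= d * v by rewrite mulr_ge0// ltW.
by have := ler_wpM2l dv h1; lra.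
Qed.

Lemma ucvg_uniform (I : finType) (F : I -> nat -> X -> C) (G : I -> X -> C) (e : R) :
  0 < e -> (forall i, ucvg Par (F i) (G i)) ->
  exists n0 : nat, forall n, (n0 <= n)%N -> forall p, Par p -> forall i,
    normc (F i n p - G i p) <= e.
Proof.
move=> e0 H; have [n0 Hn0] := choice (fun i => (H i).2 _ e0).
exists (\max_i n0 i)%N => n hn p Pp i; apply: Hn0 => //.
exact: leq_trans (leq_bigmax i) hn.
Qed.

Lemma Kn_limit (eps : R) : 0 < eps -> exists n0 : nat, forall n, (n0 <= n)%N -> forall p, Par p ->
  normc (Kn phi n (pt (fun p => p.1.2) n p) (pt (fun p => p.2) n p) / n%:R ^+ 2 - limK r m p) <= eps.
Proof.
move=> e0.
have [H [H0 Hb]] := limK_bounded M r01 m1.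
have [C1 [C10 HC]] := ksum_asymp M r01 m1.
(* The error budget: 2dH + 3E from the diagonal differences, E from the lower kernel and dH from the
   factor 1/(1 + d), with E = 2 C1 d; the added 1 makes [Q] positive. *)
pose Q := 3 * H + 8 * C1 + 1.
have Q0 : 0 < Q by rewrite /Q; lra.
pose d := Num.min (1 / 2) (eps / Q).
have d0 : 0 < d by rewrite lt_min !divr_gt0.
have d2 : d <= 1 / 2 by rewrite ge_min lexx.
have dQ : d * Q <= eps by rewrite -ler_pdivlMr// ge_min lexx orbT.
have [T HT] := lower_weights d0; have [B HB] := upper_weights d0 d2.
(* One size bound for all multipliers, fixed before [n] is. *)
pose D := maxn (\max_j size (T j)) (\max_j size (B j)).
have TD j : (size (T j) <= D)%N.
  by rewrite leq_max (leq_trans (leq_bigmax (F := fun j => size (T j)) j)).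
have BD j : (size (B j) <= D)%N.
  by rewrite leq_max orbC (leq_trans (leq_bigmax (F := fun j => size (B j)) j)).
have Pr p : Par p -> normc (p.1.1 ^+ m - 1) <= r ^+ m by case=> ->.
(* |B_j| |z0|^(m-1-j) >= 1/2 by the third clause on [B], and |z0| <= 2. *)
pose b0 : R := (1 / 2) / 2 ^+ m.
have b00 : 0 < b0 by rewrite !divr_gt0// exprn_gt0.
have Bz p : Par p -> forall j, b0 <= normc (B j).[p.1.1 ^+ m].
  move=> Pp j; have [_ _ h _] := HB j _ (Pr _ Pp).
  rewrite /b0 ler_pdivrMr ?exprn_gt0//.
  have t : normc (B j).[p.1.1 ^+ m] * normc p.1.1 ^+ (m - 1 - j) <= normc (B j).[p.1.1 ^+ m] * 2 ^+ m.
    rewrite ler_wpM2l ?normc_ge0// (@le_trans _ _ (2 ^+ (m - 1 - j)))//.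
      by rewrite lerXn2r ?nnegrE ?normc_ge0// (Par_le2 r01 m1 Pp).
    by rewrite ler_weXn2l ?ler1n// -subnDA leq_subr.
  have x0 : 0 <= normc (B j).[p.1.1 ^+ m] * normc p.1.1 ^+ (m - 1 - j).
    by rewrite mulr_ge0 ?exprn_ge0 ?normc_ge0.
  apply: le_trans t; move: (normc _ * normc _ ^+ _) x0 h => x x0 h {HC}.
  rewrite leNgt; apply/negP => x2; rewrite expr2 in h.
  by have := ltr_pM x0 x0 x2 x2; lra.
pose fT (j : 'I_m) (z : C) := z ^+ j * (T j).[z ^+ m].
pose fB (j : 'I_m) (z : C) := z ^+ j / (B j).[z ^+ m].
have Bcv j (e : X -> C) : (forall p, Par p -> normc (e p) <= M) ->
    ucvg Par (fun n p => (B j).[pt e n p ^+ m]) (fun p => (B j).[p.1.1 ^+ m]).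
  by move=> eM; apply: ucvg_horner; apply: ucvgX; exact: ucvg_pt.
have fTc j (e : X -> C) : (forall p, Par p -> normc (e p) <= M) ->
    ucvg Par (fun n p => fT j (pt e n p)) (fun p => fT j p.1.1).
  move=> eM; apply: ucvgM; first by apply: ucvgX; exact: ucvg_pt.
  by apply: ucvg_horner; apply: ucvgX; exact: ucvg_pt.
have fBc j (e : X -> C) : (forall p, Par p -> normc (e p) <= M) ->
    ucvg Par (fun n p => fB j (pt e n p)) (fun p => fB j p.1.1).
  move=> eM; apply: ucvgM; first by apply: ucvgX; exact: ucvg_pt.
  by apply: (ucvgV b00 _ (Bcv j _ eM)) => p /Bz.
(* [Nlo] keeps the degrees of the lower family at most n for large n, [Nup] leaves room for B_j P_j;
   both differ from n/m by a bounded amount. *)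
pose Nlo n := (n %/ m - D.+1)%N; pose Nup n := (D + (n %/ m).+1)%N.
have Hlo n := lower_count n D m0; have Hup n := upper_count n D m0.
have fTz p : Par p -> forall j : 'I_m,
    `|normc (fT j p.1.1) ^+ 2 - normc p.1.1 ^+ (2 * m - 2)| <= d * normc p.1.1 ^+ (2 * m - 2).
  by move=> Pp j; have [] := HT j _ (Pr _ Pp).
have fBz p : Par p -> forall j : 'I_m,
    `|normc (fB j p.1.1) ^+ 2 - normc p.1.1 ^+ (2 * m - 2)| <= (2 * d) * normc p.1.1 ^+ (2 * m - 2).
  by move=> Pp j; have [] := HB j _ (Pr _ Pp).
have d20 : 0 < 2 * d by rewrite mulr_gt0.
have [n1 Hn1] := HC fT Nlo _ d d0 fTc Hlo fTz.
have [n2 Hn2] := HC fB Nup _ (2 * d) d20 fBc Hup fBz.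
have aM p : Par p -> normc p.1.2 <= M by case.
(* Closeness [b0 / 2] keeps [B j] nonzero at the displaced points, as [kernel_upper] requires. *)
have [n3 Hn3] := ucvg_uniform (divr_gt0 b00 (ltr0Sn R 1)) (fun j => Bcv j _ aM).
(* For n >= [n4] the quotient n/m exceeds D + 1, so [Nlo n] is positive. *)
pose n4 := (m * D.+3)%N.
exists (maxn (maxn n1 n2) (maxn n3 n4)) => n; rewrite !geq_max => /andP[/andP[k1 k2] /andP[k3 k4]] p Pp.
have n0 : (0 < n)%N by rewrite (leq_trans _ k4)// muln_gt0 m0.
have nR : 0 < n%:R ^+ 2 :> R by rewrite exprn_gt0// ltr0n.
have nC : n%:R ^+ 2 != 0 :> C by rewrite expf_neq0// pnatr_eq0 -lt0n.
have Nlo0 : (0 < Nlo n)%N.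
  by rewrite /Nlo subn_gt0 leq_divRL// mulnC (leq_trans _ k4)// /n4 leq_mul.
have NE : (m * (D + Nlo n).+1 <= n)%N.
  have -> : (D + Nlo n).+1 = (n %/ m)%N by rewrite -addSn subnKC// ltnW// -subn_gt0.
  by rewrite mulnC leq_trunc_div.
have c0 : 0 < 1 + d by rewrite addr_gt0.
have low := kernel_lower r01 m1 onp (ltW c0) Nlo0 TD NE (fun j z zr => (HT j z zr).1).
have Nup0 : (0 < Nup n)%N by rewrite /Nup addnS.
have upr := kernel_upper r01 m1 onp (ltW c0) Nup0 BD (leqnn _)
  (fun j z zr => let: And4 h _ _ _ := HB j z zr in h).
pose E := 2 * C1 * d.
have C1d : C1 * d <= E by rewrite /E -mulrA ler_peMl ?ler1n// mulr_ge0// ltW.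
have E0 : 0 <= E by rewrite !mulr_ge0// ltW.
(* At coinciding points the kernels are real, so the complex asymptotics can be compared through
   real parts. *)
have diag (q e : C) : Par (q, e, e) ->
    \sum_(k < n.+1) normc (phi k).[q + e / n%:R] ^+ 2 -
    (1 + d)^-1 * \sum_i normc (psi r T (N := Nlo n) i (q + e / n%:R)) ^+ 2
    <= n%:R ^+ 2 * (2 * d * H + 3 * E).
  move=> Pq; have ReE (S : R) : complex.Re (S%:C%C / n%:R ^+ 2 - limK r m (q, e, e)) =
      S / n%:R ^+ 2 - complex.Re (limK r m (q, e, e)).
    rewrite raddfB; congr (_ - _).
    have -> : S%:C%C / n%:R ^+ 2 = (S / n%:R ^+ 2)%:C%C; last by [].
    by rewrite rmorphM fmorphV rmorphXn rmorph_nat.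
  apply: (@diagonal_gap _ _ _ (\sum_i normc (psiV r B (N := Nup n) i (q + e / n%:R)) ^+ 2)
    _ (complex.Re (limK r m (q, e, e)))) => //.
  - apply: upr => j; rewrite -normc_eq0 gt_eqF//.
    have h1 := Bz _ Pq j; have h2 := Hn3 n k3 _ Pq j.
    rewrite -[X in normc X](subKr (B j).[q ^+ m]).
    have := ler_normcD (B j).[(q + e / n%:R) ^+ m]
      ((B j).[q ^+ m] - (B j).[(q + e / n%:R) ^+ m]).
    rewrite [X in normc X <= _]addrC subrK subKr normc_distC => h3.
    by move: h1 h2 h3; rewrite /pt /=; clear - b00 phi M r01 m1 onp m0 r0 rho; lra.
  - rewrite -ReE (le_trans (ler_Re_normc _))// (le_trans _ C1d)//.
    by have := Hn1 n k1 _ Pq; rewrite ksum_diagE.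
  - rewrite -ReE (le_trans (ler_Re_normc _))//.
    by have := Hn2 n k2 _ Pq; rewrite ksum_diagE mulrA [C1 * 2]mulrC.
  - by rewrite (le_trans (ler_Re_normc _))// (Hb _ Pq).1.
case: p Pp => [[q a] b] Pp.
have [Pq Pa Pb] := Pp.
have ga : Par (q, a, a) by []; have gb : Par (q, b, b) by [].
have := kernel_polarization c0 (low (q + a / n%:R) (q + b / n%:R)).
have := diag _ _ ga; have := diag _ _ gb; have := Hn1 n k1 _ Pp; rewrite /ksum /pt /=.
set Klo := \sum_i _; set K := Kn phi n _ _.
rewrite -[\sum_(k < n.+1) _ * conjc _]/K.
set L := limK r m (q, a, b); set ci := (1 + d)^-1 => hK hb ha pol.
have hD : normc (K - ci%:C%C * Klo) <= n%:R ^+ 2 * (2 * d * H + 3 * E) by clear - ha hb pol phi M r01 m1 onp m0 r0 rho; lra.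
have ci0 : 0 < ci by rewrite invr_gt0.
have ci1 : ci <= 1 by rewrite invf_le1// lerDl ltW.
have cid : 1 - ci <= d.
  have cc : (1 + d) * ci = 1 by rewrite divff// gt_eqF.
  have dci : d * ci <= d by rewrite ler_piMr// ltW.
  by clear - cc dci phi M r01 m1 onp m0 r0 rho; lra.
(* The error splits into the polarized difference, the error of the lower kernel, and the effect of
   the factor [ci]. *)
have -> : K / n%:R ^+ 2 - L = (K - ci%:C%C * Klo) / n%:R ^+ 2 +
    ci%:C%C * (Klo / n%:R ^+ 2 - L) - (1 - ci%:C%C) * L by field; rewrite pnatr_eq0 -lt0n.
have t1 : normc ((K - ci%:C%C * Klo) / n%:R ^+ 2) <= 2 * d * H + 3 * E.
  by rewrite normcM normcV normcX normcMn_nat ler_pdivrMr// [leRHS]mulrC.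
have t2 : normc (ci%:C%C * (Klo / n%:R ^+ 2 - L)) <= E.
  rewrite normcM normcR gtr0_norm// -[leRHS]mul1r ler_pM ?normc_ge0//; first exact: ltW.
  exact: le_trans hK C1d.
have t3 : normc (- ((1 - ci%:C%C) * L)) <= d * H.
  rewrite normcN normcM ler_pM ?normc_ge0//; last by rewrite (Hb _ Pp).1.
  by rewrite -(rmorph1 (real_complex R)) -rmorphB normcR ger0_norm// subr_ge0.
rewrite (le_trans (ler_normcD _ _))//.
have t4 := ler_normcD ((K - ci%:C%C * Klo) / n%:R ^+ 2) (ci%:C%C * (Klo / n%:R ^+ 2 - L)).
by move: dQ t1 t2 t3 t4; rewrite /Q /E; clear - d0 phi M r01 m1 onp m0 r0 rho; lra.
Qed.

End kernel_limit.

(** * Restriction to the points of the arc *)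

Theorem theorem3p6 (R : realType) (r : R) (m : nat)
    (phi : nat -> {poly R[i]}) (gamma : R -> R[i]) :
  0 < r < 1 -> (2 <= m)%N ->
  is_ONP r m phi ->
  closed_arc_in r m gamma ->
  forall (M eps : R), 0 < eps ->
  exists N : nat, forall n : nat, (N <= n)%N ->
  forall (a b : R[i]), normc a <= M -> normc b <= M ->
  forall t : R, t \in `[0, 1]%R ->
    normc (Kn phi n (gamma t + a / n%:R) (gamma t + b / n%:R)
           - main_term r m n (gamma t) a b)
      <= eps * (n%:R) ^+ 2.
Proof.
move=> r01 m1 onp [_ [_ [_ gJ]]] M eps e0.
have [n0 Hn0] := Kn_limit M r01 m1 onp e0.
exists n0.+1 => n nn a b aM bM t /gJ gt.
have := Hn0 n (ltnW nn) (gamma t, a, b) (And3 gt aM bM); rewrite /pt /limK /=.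
have n1 : (0 < n)%N by exact: leq_trans nn.
have nC : n%:R ^+ 2 != 0 :> R[i] by rewrite expf_neq0// pnatr_eq0 -lt0n.
have nR : 0 < n%:R ^+ 2 :> R by rewrite exprn_gt0// ltr0n.
rewrite /main_term; set K := Kn _ _ _ _; set L := Hfun _ * _ => h.
rewrite -[_ * Hfun _ * _]mulrA -/L; have -> : K - n%:R ^+ 2 * L = (K / n%:R ^+ 2 - L) * n%:R ^+ 2.
  by rewrite mulrBl divfK// [L * _]mulrC.
by rewrite normcM normcX normcMn_nat ler_pM2r.
Qed.
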